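(* Let $p(\cdot)\in\mathcal{P}(\mathbb{R}^n)\cap LH(\mathbb{R}^n)$ with $1<p_-\le p_+<\infty$ and let $W\in\mathcal{A}_{p(\cdot)}$ be a matrix weight $W:\mathbb{R}^n\to S_d$. Then there is an increasing function $\phi:[1,\infty)\to(0,\infty)$, depending only on $n$, $d$, $p_-$, $p_+$, $p_\infty$, and the $LH(\mathbb{R}^n)$ constants of $p(\cdot)$, such that for all $\mathbf f\in L^{p(\cdot)}(\mathbb{R}^n;\mathbb{F}^d)$, $$\|M'_{W,p(\cdot)}\mathbf f\|_{L^{p(\cdot)}(\mathbb{R}^n)}\le\phi([W]_{\mathcal{A}_{p(\cdot)}})\,\|\mathbf f\|_{L^{p(\cdot)}(\mathbb{R}^n;\mathbb{F}^d)}.$$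
   Context: $\mathbb{F}$ is $\mathbb{R}$ or $\mathbb{C}$. Cubes $Q\subset\mathbb{R}^n$ have sides parallel to the axes; $\chi_Q$ is the indicator function. Variable Lebesgue spaces. $\mathcal{P}(\mathbb{R}^n)$ is the set of measurable $p(\cdot):\mathbb{R}^n\to[1,\infty]$; $p_+=\operatorname{ess\,sup}p$, $p_-=\operatorname{ess\,inf}p$; $p'(\cdot)$ is defined by $\frac1{p(x)}+\frac1{p'(x)}=1$ ($1/\infty=0$); for a cube $Q$, $\frac1{p_Q}=\frac1{|Q|}\int_Q\frac{dx}{p(x)}$. With $\Omega_\infty=\{p(x)=\infty\}$, $\rho_{p(\cdot)}(f)=\int_{\mathbb{R}^n\setminus\Omega_\infty}|f(x)|^{p(x)}dx+\|f\|_{L^\infty(\Omega_\infty)}$ and $\|f\|_{L^{p(\cdot)}(\mathbb{R}^n)}=\inf\{\lambda>0:\rho_{p(\cdot)}(f/\lambda)\le1\}$. A function $r(\cdot):\mathbb{R}^n\to\mathbb{R}$ is in $LH(\mathbb{R}^n)$ if there are constants $C_0,C_\infty,r_\infty$ (the $LH$ constants are $C_0,C_\infty$) with $|r(x)-r(y)|\le \frac{C_0}{-\log|x-y|}$ for all $|x-y|<1/2$, and $|r(x)-r_\infty|\le\frac{C_\infty}{\log(e+|x|)}$ for all $x$. Matrix weights. $S_d$ is the set of Hermitian positive definite $d\times d$ matrices over $\mathbb{F}$; $|\cdot|_{\mathrm{op}}$ is the operator norm. A matrix weight is a measurable $W:\mathbb{R}^n\to S_d$ with $|W|_{\mathrm{op}}$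 locally integrable. $\|\mathbf f\|_{L^{p(\cdot)}(\mathbb{R}^n;\mathbb{F}^d)}=\||\mathbf f|\|_{L^{p(\cdot)}(\mathbb{R}^n)}$. $W\in\mathcal{A}_{p(\cdot)}$ means $$[W]_{\mathcal{A}_{p(\cdot)}}=\sup_Q|Q|^{-1}\Big\|\big\||W(x)W^{-1}(y)|_{\mathrm{op}}\chi_Q(y)\big\|_{L^{p'(\cdot)}_y(\mathbb{R}^n)}\chi_Q(x)\Big\|_{L^{p(\cdot)}_x(\mathbb{R}^n)}<\infty .$$ Reducing operators. For each cube $Q$, $\mathcal{W}_Q^{p(\cdot)}\in S_d$ is a fixed constant matrix with $|Q|^{-1/p_Q}\||W(\cdot)\mathbf u|\chi_Q\|_{L^{p(\cdot)}(\mathbb{R}^n)}\le|\mathcal{W}_Q^{p(\cdot)}\mathbf u|\le\sqrt d\,|Q|^{-1/p_Q}\||W(\cdot)\mathbf u|\chi_Q\|_{L^{p(\cdot)}(\mathbb{R}^n)}$ for all $\mathbf u\in\mathbb{F}^d$ (such a matrix exists). Goldberg auxiliary maximal operator: $$M'_{W,p(\cdot)}\mathbf f(x)=\sup_Q\Big(\frac1{|Q|}\int_Q|\mathcal{W}_Q^{p(\cdot)}W(y)^{-1}\mathbf f(y)|\,dy\Big)\chi_Q(x),$$ supremum over all cubes. *)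

(* Defs.v *)
From HB Require Import structures.
From mathcomp Require Import all_boot all_order all_algebra.
From mathcomp Require Import all_classical all_reals all_analysis.
From mathcomp Require Import measurable_realfun ess_sup_inf complex.

Set Implicit Arguments.
Unset Strict Implicit.
Unset Printing Implicit Defensive.
Import Order.TTheory GRing.Theory Num.Theory.
Import numFieldNormedType.Exports.

Local Open Scope classical_set_scope.
Local Open Scope ring_scope.

(* n-dimensional Lebesgue measure is obtained by completing the n-fold product
   of the one-dimensional Lebesgue measure, which is built by recursion on n. *)

Section product_cons.
Context (R : realType) (n : nat).
Local Notation mR := (measurableTypeR R).

Definition tuple_cons (x : mR * n.-tuple mR) : n.+1.-tuple mR :=
  [the n.+1.-tuple mR of x.1 :: x.2].

Lemma measurable_tuple_cons : measurable_fun setT tuple_cons.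
Proof. exact: measurable_cons. Qed.

Variable m : {sigma_finite_measure set (n.-tuple mR) -> \bar R}.

Definition cons_measure : set (n.+1.-tuple mR) -> \bar R :=
  pushforward (@lebesgue_measure R \x m)%E tuple_cons.

Let cons_measure0 : cons_measure set0 = 0%E.
Proof. by rewrite /cons_measure /pushforward preimage_set0 measure0. Qed.

Let mcons B : measurable B -> measurable (tuple_cons @^-1` B).
Proof.
by move=> mB; rewrite -[X in measurable X]setTI; exact: measurable_tuple_cons.
Qed.

Let cons_measure_ge0 A : (0 <= cons_measure A)%E.
Proof. exact: (@measure_ge0 _ _ _ (@lebesgue_measure R \x m)%E). Qed.

Let cons_measure_sigma_additive : semi_sigma_additive cons_measure.
Proof.
move=> F mF tF mUF; rewrite /cons_measure /pushforward preimage_bigcup.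
apply: measure_semi_sigma_additive.
- by move=> k; exact: mcons.
- apply/trivIsetP => /= i j _ _ ij; rewrite -preimage_setI.
  by move/trivIsetP : tF => /(_ _ _ _ _ ij) ->//; rewrite preimage_set0.
- by rewrite -preimage_bigcup; exact: mcons.
Qed.

HB.instance Definition _ := isMeasure.Build _ _ _ cons_measure
  cons_measure0 cons_measure_ge0 cons_measure_sigma_additive.

Let cons_measure_sigma_finite : sigma_finite setT cons_measure.
Proof.
have [F TF Foo] : sigma_finite setT (@lebesgue_measure R \x m)%E.
  have /sigma_finiteP[F [TF ndF Foo]] := sigma_finiteT (@lebesgue_measure R).
  have /sigma_finiteP[G [TG ndG Goo]] := sigma_finiteT m.
  exists (fun k => F k `*` G k).
    rewrite -setXTT TF TG predeqE => -[x y]; split.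
      move=> [/= [k _ Fkx] [l _ Gly]]; exists (maxn k l) => //; split.
      - by move: x Fkx; exact/subsetPset/ndF/leq_maxl.
      - by move: y Gly; exact/subsetPset/ndG/leq_maxr.
    by move=> [k _ []/= ? ?]; split; exists k.
  move=> k; have [? ?] := Foo k; have [? ?] := Goo k.
  split; first exact: measurableX.
  by rewrite product_measure1E// lte_mul_pinfty// ge0_fin_numE.
pose g (t : n.+1.-tuple mR) : mR * n.-tuple mR := (thead t, [tuple of behead t]).
have mg : measurable_fun setT g.
  apply: measurable_fun_pair => /=; last exact: measurable_behead.
  exact: measurable_tnth.
have gK x : g (tuple_cons x) = x.
  case: x => a t; rewrite /g /tuple_cons; congr pair => /=.
  exact/val_inj.
exists (fun k => g @^-1` F k).
  by rewrite -preimage_bigcup -TF.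
move=> k; have [mF Fk] := Foo k; split.
  by rewrite -[X in measurable X]setTI; exact: mg.
rewrite /cons_measure /pushforward -comp_preimage.
rewrite (_ : g \o tuple_cons = id)//.
exact/funext.
Qed.

HB.instance Definition _ := Measure_isSigmaFinite.Build _ _ _ cons_measure
  cons_measure_sigma_finite.

End product_cons.

Fixpoint borel_lebesgue (R : realType) (n : nat) :
    {sigma_finite_measure set (n.-tuple (measurableTypeR R)) -> \bar R} :=
  match n with
  | 0 => \d_([tuple])
  | n'.+1 => cons_measure (borel_lebesgue R n')
  end.

Section boxes.
Context (R : realType).

Lemma measurable_box (m : nat) (a b : 'I_m -> R) :
  measurable [set x : m.-tuple (measurableTypeR R) |
    forall i, a i <= (tnth x i : R) <= b i].
Proof.
rewrite [X in measurable X](_ : _ = \bigcap_(i in [set: 'I_m])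
    ((fun x : m.-tuple (measurableTypeR R) => tnth x i) @^-1` `[a i, b i])).
  apply: fin_bigcap_measurable => // i _.
  rewrite -[X in measurable X]setTI.
  by apply: (@measurable_tnth _ (measurableTypeR R)).
apply/seteqP; split => [x xB i _|x xB i].
  by rewrite /= in_itv/=; exact: xB.
by have := xB i Logic.I; rewrite /= in_itv.
Qed.

Lemma borel_box (m : nat) (a b : 'I_m -> R) : (forall i, a i <= b i) ->
  borel_lebesgue R m [set x | forall i, a i <= (tnth x i : R) <= b i]
  = (\prod_i (b i - a i))%:E.
Proof.
elim: m a b => [|m IH] a b ab.
  by rewrite big_ord0 /= /dirac indicE mem_set// => -[].
set B := (X in borel_lebesgue _ _ X).
rewrite /= /cons_measure /pushforward.
have -> : @tuple_cons R m @^-1` B = `[a ord0, b ord0] `*`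
   [set x : m.-tuple (measurableTypeR R) |
     forall i, a (lift ord0 i) <= (tnth x i : R) <= b (lift ord0 i)].
  apply/seteqP; split => [[t x] /= xB|[t x] /= [+ xB]].
    split; first by have := xB ord0; rewrite /= in_itv.
    by move=> i; have := xB (lift ord0 i); rewrite /tuple_cons tnthS.
  rewrite in_itv/= => At i.
  by case: (unliftP ord0 i) => [j|] ->; rewrite /tuple_cons/= ?tnthS//; exact: xB.
rewrite product_measure1E//=; last exact: measurable_box.
rewrite IH// lebesgue_measure_itv /= lte_fin big_ord_recl EFinM.
case: ltP => // ba; congr (_ * _)%E; apply/eqP.
by rewrite eq_sym eqe subr_eq0 eq_le ba ab.
Qed.

End boxes.

(* R^n with the sigma-algebra of Lebesgue measurable (i.e. Caratheodory
   measurable) sets; the points are n-tuples of reals *)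
Definition euclid (R : realType) (n : nat) :=
  caratheodory_type (mu_ext (borel_lebesgue R n)).
HB.instance Definition _ (R : realType) (n : nat) :=
  Measurable.on (euclid R n).

Definition lebesgue (R : realType) (n : nat) : set (euclid R n) -> \bar R :=
  @completed_measure_extension _ _ R (borel_lebesgue R n).
HB.instance Definition _ (R : realType) (n : nat) :=
  Measure.on (@lebesgue R n).

Lemma lebesgue_sigma_finite (R : realType) (n : nat) :
  sigma_finite setT (@lebesgue R n).
Proof.
exact: (completed_measure_extension_sigma_finite (sigma_finiteT _)).
Qed.
HB.instance Definition _ (R : realType) (n : nat) :=
  Measure_isSigmaFinite.Build _ _ _ (@lebesgue R n)
    (@lebesgue_sigma_finite R n).
Arguments lebesgue : clear implicits.

Section euclidean_space.
Context {R : realType} {n : nat}.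
Implicit Types x y a : euclid R n.

Definition coordinate x (i : 'I_n) : R := tnth x i.

Definition enorm x : R := Num.sqrt (\sum_(i < n) coordinate x i ^+ 2).

Definition edist x y : R :=
  Num.sqrt (\sum_(i < n) (coordinate x i - coordinate y i) ^+ 2).

Definition cube a (l : R) : set (euclid R n) :=
  [set x | forall i, coordinate a i <= coordinate x i <= coordinate a i + l].

Lemma lebesgue_cube (a : euclid R n) (l : R) : 0 <= l ->
  lebesgue R n (cube a l) = (l ^+ n)%:E.
Proof.
move=> l0; have := @borel_box R n (coordinate a) (fun i => coordinate a i + l).
move=> box; transitivity (borel_lebesgue R n (cube a l)).
  by apply: measurable_mu_extE; exact: measurable_box.
rewrite [LHS]box; last by move=> i; rewrite lerDl.
under eq_bigr do rewrite addrC addKr.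
by rewrite prodr_const card_ord.
Qed.

Definition cubes : set (set (euclid R n)) :=
  [set Q | exists a l, 0 < l /\ Q = cube a l].

Definition vol (A : set (euclid R n)) : R := fine (lebesgue R n A).

End euclidean_space.

Section variable_exponent.
Context {R : realType} {n : nat}.
Implicit Types (p : euclid R n -> \bar R) (f : euclid R n -> \bar R)
  (r : euclid R n -> R) (Q : set (euclid R n)).
Local Notation mu := (lebesgue R n).

Definition is_exponent p : Prop :=
  measurable_fun [set: euclid R n] p /\ forall x, (1 <= p x)%E.

(* 1/p_Q, the mean of 1/p over Q *)
Definition recip_mean p Q : R :=
  (vol Q)^-1 * \int[mu]_(x in Q) fine ((p x)^-1)%E.

Definition modular p f : \bar R :=
  let Omega := [set x | p x = +oo%E] in
  (\int[mu]_(x in ~` Omega) (`|f x| `^ fine (p x))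
   + Lnorm mu +oo (fun x => f x * (\1_Omega x)%:E))%E.

Definition Lpnorm p f : \bar R :=
  ereal_inf [set (lambda%:E) | lambda in
    [set lambda : R | 0 < lambda
       /\ (modular p (fun x => f x * (lambda^-1)%:E) <= 1)%E]].

(* At x = y the right-hand side is 0, since ln 0 = 0 and 0^-1 = 0. *)
Definition log_hoelder (C0 Cinf rinf : R) r : Prop :=
  (forall x y, edist x y < 2^-1 -> `|r x - r y| <= C0 / - ln (edist x y)) /\
  (forall x, `|r x - rinf| <= Cinf / ln (expR 1 + enorm x)).

End variable_exponent.

Variant scalars := RealScalars | ComplexScalars.

Section scalar_fields.
Context (R : realType).

Definition scalar_field (K : scalars) : numFieldType :=
  match K with RealScalars => R | ComplexScalars => R[i]%C end.

Definition scalar_re {K} : scalar_field K -> R :=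
  match K return scalar_field K -> R with
  | RealScalars => id
  | ComplexScalars => @complex.Re R
  end.

Definition scalar_im {K} : scalar_field K -> R :=
  match K return scalar_field K -> R with
  | RealScalars => fun=> 0
  | ComplexScalars => @complex.Im R
  end.

Definition scalar_conj {K} : scalar_field K -> scalar_field K :=
  match K return scalar_field K -> scalar_field K with
  | RealScalars => id
  | ComplexScalars => @conjc R
  end.

(* the modulus, as an element of R rather than of the scalar field *)
Definition modulus {K} : scalar_field K -> R :=
  match K return scalar_field K -> R with
  | RealScalars => fun z => `|z|
  | ComplexScalars => @Normc.normc R
  end.

End scalar_fields.
Arguments scalar_re {R K}.
Arguments scalar_im {R K}.
Arguments scalar_conj {R K}.
Arguments modulus {R K}.

Section matrices.
Context {R : realType} {K : scalars} {d : nat}.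
Local Notation F := (scalar_field R K).
Implicit Types (A : 'M[F]_d) (u : 'cV[F]_d).

Definition vnorm u : R := Num.sqrt (\sum_(i < d) modulus (u i 0) ^+ 2).

Definition opnorm A : R := sup [set vnorm (A *m u) | u in [set u | vnorm u <= 1]].

Definition posdef A : Prop :=
  map_mx scalar_conj A^T = A /\
  forall u, u != 0 -> 0 < (map_mx scalar_conj u^T *m A *m u) 0 0.

End matrices.

Section matrix_weights.
Context {R : realType} {K : scalars} {n d : nat}.
Local Notation F := (scalar_field R K).
Local Notation Rn := (euclid R n).
Local Notation mu := (lebesgue R n).
Implicit Types (p : Rn -> \bar R) (W : Rn -> 'M[F]_d) (f : Rn -> 'cV[F]_d)
  (WQ : set Rn -> 'M[F]_d).

Definition measurable_mx m k (g : Rn -> 'M[F]_(m, k)) : Prop :=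
  forall i j, measurable_fun [set: Rn] (fun x => scalar_re (g x i j)) /\
              measurable_fun [set: Rn] (fun x => scalar_im (g x i j)).

Definition vLpnorm p f : \bar R := Lpnorm p (fun x => (vnorm (f x))%:E).

Definition in_vLp p f : Prop := measurable_mx f /\ (vLpnorm p f < +oo)%E.

Definition matrix_weight W : Prop :=
  [/\ measurable_mx W, forall x, posdef (W x) &
      forall x, exists2 r : R, 0 < r &
        mu.-integrable [set y | edist x y < r] (fun y => (opnorm (W y))%:E)].

Definition Ap_const p W : \bar R :=
  ereal_sup [set (((vol Q)^-1)%:E *
    Lpnorm p (fun x =>
      Lpnorm (hoelder_conjugate \o p)
        (fun y => (opnorm (W x *m invmx (W y)) * \1_Q y)%:E)
      * (\1_Q x)%:E))%E | Q in cubes].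

Definition in_Ap p W : Prop := (Ap_const p W < +oo)%E.

Definition reducing_operators p W WQ : Prop :=
  forall Q, cubes Q -> posdef (WQ Q) /\ forall u,
    let N := ((vol Q `^ (- recip_mean p Q))%:E *
      Lpnorm p (fun x => (vnorm (W x *m u) * \1_Q x)%:E))%E in
    (N <= (vnorm (WQ Q *m u))%:E <= (Num.sqrt d%:R)%:E * N)%E.

Definition goldberg_aux WQ W f (x : Rn) : \bar R :=
  ereal_sup [set (((vol Q)^-1)%:E *
    (\int[mu]_(y in Q) (vnorm (WQ Q *m invmx (W y) *m f y))%:E) *
    (\1_Q x)%:E)%E | Q in cubes].

End matrix_weights.

(* Main.v *)
(* Idea. Fix a cube Q. With w_i(y) = |W(y)^-1 W_Q e_i| one has
   |W_Q W^-1 f| <= sum_i w_i |f|, and the A_p(.) condition for W makes each w_i a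
   scalar weight satisfying an A_q(.) condition, q = p', with a constant that does
   not depend on Q; duality with the reducing operator normalizes the L^q(.)(Q)
   norm of w_i. A stopping-time argument on dyadic subcubes gives a reverse
   Hoelder inequality for w_i^q, where above unit scale w_i^q is replaced by a
   density built from the norms of w_i on cells of side about 1, on which q is
   comparable to its limit at infinity. Young's inequality with the improved
   exponent and log-Hoelder continuity then yield, when the modular of f is at
   most 1, some s > 1 with
     (avg_Q w_i |f|)^p(x) <= C (avg_Q (|f|^(p/s) + eta) + eta(x))^s  for x in Q,
   where eta(x) = (e + |x|)^-(n+1) is integrable, and the theorem follows from the
   L^s bound for the Hardy-Littlewood maximal operator. *)

Require Import Defs.
From mathcomp Require Import all_boot all_order all_algebra.
From mathcomp Require Import all_classical all_reals all_analysis ess_sup_inf.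
From mathcomp Require Import measurable_realfun complex.
From mathcomp Require Import ring lra zify.
Set Implicit Arguments.
Unset Strict Implicit.
Unset Printing Implicit Defensive.
Import Order.TTheory GRing.Theory Num.Theory.
Import numFieldNormedType.Exports.
Local Open Scope classical_set_scope.
Local Open Scope ring_scope.

(** * Integrals of nonnegative functions and real powers *)

(** The $A_{p(\cdot)}$ condition bounds norms, while reverse Hoelder inequalities live on modulars.
    On cubes of side at most 2 the two can be exchanged: the ratio of the norms of a weight on a
    subcube and on the cube is bounded below by a power of the sides, and log-Hoelder continuity
    makes its powers [q x] and [q y] comparable. On large cubes the oscillation of [q] does not
    shrink with the side, and only [t^a <= C t^b + eps * decay x] with the limit exponent remains.
    This additive error is the reason for a density with prescribed cell masses [Nrm u ^ qinf], and
    [eps] has to be chosen after the $A_q$ constant.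

    Two features of the definitions shape the rest. The reducing matrix is tied to the norms of
    [W u], not to those of $W^{-1}$, so the norm of $w_i$ is bounded by pairing $W_Qe_i$ with an
    explicit extremal vector. The inner norm in $[W]$ and the maximal operator are not known to be
    measurable, so they enter only through one-sided bounds and monotonicity of the integral. *)

Section integral_monotone.
Local Open Scope ereal_scope.
Context d (T : measurableType d) (R : realType) (mu : {measure set T -> \bar R}).

Import HBNNSimple.

(* The integral of a nonnegative function is a supremum over simple functions
   below it, so that monotonicity needs no measurability. *)
Lemma ge0_le_integralW (D : set T) (f g : T -> \bar R) :
  (forall x, D x -> 0 <= f x) -> (forall x, D x -> f x <= g x) ->
  \int[mu]_(x in D) f x <= \int[mu]_(x in D) g x.
Proof.
move=> f0 fg; rewrite !(integral_mkcond D).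
have f0' x : 0 <= (f \_ D) x.
  by rewrite patchE; case: ifPn => // /set_mem/f0.
have fg' x : (f \_ D) x <= (g \_ D) x.
  by rewrite !patchE; case: ifPn => // /set_mem/fg.
have g0' x : 0 <= (g \_ D) x by exact: le_trans (f0' x) (fg' x).
rewrite !ge0_integralTE//; apply: ub_ereal_sup => _ [h hf <-].
by apply: ereal_sup_ubound; exists h => // x; exact: le_trans (hf x) (fg' x).
Qed.

Lemma ge0_integralU_EFin (A B : set T) (g : T -> R) :
  measurable A -> measurable B -> measurable_fun setT g ->
  (forall x, (0 <= g x)%R) -> A `&` B = set0 ->
  \int[mu]_(x in A `|` B) (g x)%:E =
  \int[mu]_(x in A) (g x)%:E + \int[mu]_(x in B) (g x)%:E.
Proof.
move=> mA mB mg g0 AB; apply: ge0_integral_setU => //.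
- exact/measurable_funTS/measurable_EFinP.
- by move=> x _; rewrite lee_fin.
- exact/eqP.
Qed.

Lemma ge0_integralD_EFin (A : set T) (f g : T -> R) : measurable A ->
  measurable_fun setT f -> (forall x, (0 <= f x)%R) ->
  measurable_fun setT g -> (forall x, (0 <= g x)%R) ->
  \int[mu]_(x in A) (f x + g x)%:E =
  \int[mu]_(x in A) (f x)%:E + \int[mu]_(x in A) (g x)%:E.
Proof.
move=> mA mf f0 mg g0; under eq_integral do rewrite EFinD.
rewrite (ge0_integralD mu mA)//.
- by move=> x _; rewrite lee_fin.
- exact/measurable_funTS/measurable_EFinP.
- by move=> x _; rewrite lee_fin.
- exact/measurable_funTS/measurable_EFinP.
Qed.

Lemma ge0_integralZ_EFin (A : set T) (c : R) (f : T -> R) : measurable A ->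
  measurable_fun setT f -> (forall x, (0 <= f x)%R) -> (0 <= c)%R ->
  \int[mu]_(x in A) (c * f x)%:E = c%:E * \int[mu]_(x in A) (f x)%:E.
Proof.
move=> mA mf f0 c0; under eq_integral do rewrite EFinM.
rewrite (ge0_integralZl_EFin mu mA)//.
- by move=> x _; rewrite lee_fin.
- exact/measurable_funTS/measurable_EFinP.
Qed.

End integral_monotone.

Section powR_facts.
Context {R : realType}.
Implicit Types a b p q : R.

Lemma measurable_powR_fun d (T : measurableType d) (f g : T -> R) :
  measurable_fun setT f -> measurable_fun setT g ->
  measurable_fun setT (fun x => f x `^ g x).
Proof.
move=> mf mg; rewrite /powR.
have eq0 (h : T -> R) : measurable_fun setT h ->
    measurable_fun setT (fun x => h x == 0).
  by move=> mh; apply: measurable_fun_eqr => //; exact: measurable_cst.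
have -> : (fun x => if f x == 0 then (g x == 0)%:R else
   expR (g x * ln (f x))) = (fun x => if f x == 0 then
     (if g x == 0 then 1 else 0 : R) else expR (g x * ln (f x))).
  by apply/funext => x; case: (g x == 0).
apply: measurable_fun_ifT; first exact: eq0.
  by apply: measurable_fun_ifT; [exact: eq0|exact: measurable_cst..].
apply: measurableT_comp => //; apply: measurable_funM => //.
exact: measurableT_comp.
Qed.

Lemma gt0_powRE a (x : R) : 0 < a -> a `^ x = expR (x * ln a).
Proof. by move=> a0; rewrite /powR gt_eqF. Qed.

Lemma ge0_powR_le a b (x : R) : 0 <= x -> 0 <= a -> a <= b -> a `^ x <= b `^ x.
Proof.
move=> x0 a0 ab; apply: ge0_ler_powR => //; rewrite nnegrE//.
exact: le_trans ab.
Qed.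

Lemma young a b p q : 0 <= a -> 0 <= b -> 1 < p -> q = p / (p - 1) ->
  a * b <= a `^ p + b `^ q.
Proof.
move=> a0 b0 p1 qE.
have p0 : 0 < p by lra.
have p10 : 0 < p - 1 by lra.
have q0 : 0 < q by rewrite qE divr_gt0.
have pq : p^-1 + q^-1 = 1 by rewrite qE; field; rewrite !gt_eqF.
apply: le_trans (conjugate_powR a0 b0 p0 q0 pq) _.
have ip : 0 <= p^-1 by rewrite invr_ge0 ltW.
have iq : 0 <= q^-1 by rewrite invr_ge0 ltW.
apply: lerD; rewrite ler_piMr ?powR_ge0//; lra.
Qed.

Lemma powR_le1D a p q : 0 <= a -> 0 <= p <= q -> a `^ p <= 1 + a `^ q.
Proof.
move=> a0 /andP[p0 pq]; have [a1|a1] := leP 1 a.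
  by rewrite (le_trans (ler_powR a1 pq))// lerDr.
rewrite (@le_trans _ _ (1 `^ p))//; first by apply: ge0_powR_le => //; exact: ltW.
by rewrite powR1 lerDl powR_ge0.
Qed.

Lemma powR_scale_le (c t q Q : R) : 1 <= c -> 0 <= t -> q <= Q ->
  (c * t) `^ q <= c `^ Q * t `^ q.
Proof.
move=> c1 t0 qQ; rewrite powRM ?(le_trans _ c1)//.
by rewrite ler_wpM2r ?powR_ge0 ?ler_powR.
Qed.

Lemma powR_inv a (x : R) : 0 < a -> a^-1 `^ x = (a `^ x)^-1.
Proof. by move=> a0; rewrite -powR_inv1 ?ltW// -powRrM mulN1r powRN. Qed.

(* J N stands for the modular of w / N, and q, Q for bounds of the exponent. *)
Lemma unit_scale (J : R -> R) Q : 1 <= Q ->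
  (forall N, 0 < N -> 0 <= J N) -> 0 < J 1 ->
  (forall N c, 0 < N -> 1 <= c -> J (N / c) <= c `^ Q * J N) ->
  (forall N c, 0 < N -> 1 <= c -> c * J N <= J (N / c)) ->
  exists2 N, 0 < N & J N = 1.
Proof.
move=> Q1 J0 J1 Jub Jlb; pose S := [set N | 0 < N /\ J N <= 1].
have Q0 : 0 < Q by lra.
have Sex : S (Num.max 1 (J 1)).
  have M1 : 1 <= Num.max 1 (J 1) by rewrite le_max lexx.
  have M0 : 0 < Num.max 1 (J 1) by lra.
  split=> //; have := Jlb _ _ M0 M1; rewrite divff ?gt_eqF// => H.
  rewrite -(ler_pM2l M0) mulr1 (le_trans H)// le_max lexx orbT//.
have lbS N : S N -> Num.min 1 (J 1) <= N.
  move=> [N0 JN]; rewrite ge_min; have [//|N1 /=] := leP 1 N.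
  have iN : 1 <= N^-1 by rewrite invf_ge1// ltW.
  have := Jlb 1 N^-1 ltr01 iN; rewrite invrK mul1r => H.
  have := le_trans H JN; rewrite mulrC ler_pdivrMr// mul1r//.
have hS : has_inf S.
  by split; [exists (Num.max 1 (J 1))|exists (Num.min 1 (J 1)) => N /lbS].
set m := inf S.
have m0 : 0 < m.
  have : Num.min 1 (J 1) <= m by apply: lb_le_inf => //; case: hS.
  by apply: lt_le_trans; rewrite lt_min J1 ltr01.
exists m => //; apply/eqP; rewrite eq_le; apply/andP; split.
- rewrite leNgt; apply/negP => Jm.
  (* Here $c^Q$ is [J m], so [Jub] at [m * c] gives [J (m * c) >= 1]. No smaller [N] then has
     [J N <= 1], and [m * c > m] would be a lower bound of [S]. *)
  pose c := J m `^ Q^-1.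
  have c1 : 1 < c.
    by rewrite /c gt0_powRE ?(lt_trans _ Jm)// expR_gt1 mulr_gt0 ?invr_gt0 ?ln_gt0.
  have c0 : 0 < c by lra.
  have cQ : c `^ Q = J m.
    by rewrite /c -powRrM mulVf ?gt_eqF// powRr1// ltW// (lt_trans _ Jm).
  have Jmc : 1 <= J (m * c).
    have := Jub (m * c) c (mulr_gt0 m0 c0) (ltW c1).
    rewrite mulfK ?gt_eqF// cQ => H.
    by rewrite -(@ler_pM2l _ (J m)) ?(lt_trans _ Jm)// mulr1.
  have lb N : S N -> m * c <= N.
    move=> [N0 JN]; rewrite leNgt; apply/negP => Nmc.
    have r1 : 1 < m * c / N by rewrite ltr_pdivlMr// mul1r.
    have := Jlb (m * c) (m * c / N) (mulr_gt0 m0 c0) (ltW r1).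
    have -> : m * c / (m * c / N) = N by field; rewrite !gt_eqF.
    move=> H; have : m * c / N * J (m * c) <= 1 by exact: le_trans H JN.
    by apply/negP; rewrite -ltNge; nra.
  have : m * c <= m by apply: lb_le_inf => //; case: hS.
  by apply/negP; rewrite -ltNge; nra.
- rewrite leNgt; apply/negP => Jm.
  (* If [J m < 1], the scale can still be lowered, by the factor 2 when [J m = 0] and by $(J
     m)^{-1/Q}$ otherwise; either contradicts [m = inf S]. *)
  have [Jm0|Jm0] := eqVneq (J m) 0.
    have := Jub m 2 m0; rewrite Jm0 mulr0 => /(_ _) H.
    have : m <= m / 2.
      apply: ge_inf; first by case: hS.
      by split; [lra|apply: (le_trans (H _)); lra].
    by lra.
  have Jm1 : 0 < J m by rewrite lt_neqAle eq_sym Jm0 J0.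
  pose c := (J m)^-1 `^ Q^-1.
  have c1 : 1 < c.
    rewrite /c gt0_powRE ?invr_gt0// expR_gt1 mulr_gt0 ?invr_gt0 ?ln_gt0//.
    by rewrite invf_gt1.
  have c0 : 0 < c by lra.
  have cQ : c `^ Q = (J m)^-1.
    by rewrite /c -powRrM mulVf ?gt_eqF// powRr1// ltW// invr_gt0.
  have : m <= m / c.
    apply: ge_inf; first by case: hS.
    split; first exact: divr_gt0.
    by rewrite (le_trans (Jub _ _ m0 (ltW c1)))// cQ mulVf.
  by apply/negP; rewrite -ltNge ltr_pdivrMr//; nra.
Qed.

End powR_facts.

(** * Stopping times and reverse Hoelder inequalities on trees *)

Section tree.
Context {R : realType} d (T : measurableType d) (V : Type) (I : finType).
Variables (C : V -> set T) (child : V -> I -> V) (good : V -> Prop).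
Variables (m s : set T -> R) (kappa alpha gamma : R).

(** On these sets the stopping time ends after [k] steps, because every bottom node is full or
    empty; general sets are reached later by approximation. *)
Fixpoint saturated (k : nat) (v : V) (F : set T) : Prop :=
  match k with
  | 0 => C v `<=` F \/ F `&` C v = set0
  | k'.+1 => forall i, saturated k' (child v i) F
  end.

(* Union of the maximal nodes below v, up to depth k, in which F has density
   larger than t. *)
Fixpoint stopped (F : set T) (t : R) (k : nat) (v : V) : set T :=
  if t * m (C v) < m (F `&` C v) then C v else
  match k with
  | 0 => set0
  | k'.+1 => \bigcup_i stopped F t k' (child v i)
  end.

Hypotheses (good_child : forall v i, good v -> good (child v i))
  (mC : forall v, measurable (C v))
  (subC : forall v i, C (child v i) `<=` C v)
  (disjC : forall v i j, i != j -> C (child v i) `&` C (child v j) = set0)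
  (m0 : m set0 = 0) (s0 : s set0 = 0)
  (m_ge0 : forall A, 0 <= m A) (s_ge0 : forall A, 0 <= s A)
  (m_split : forall v A, good v -> measurable A ->
     m (A `&` C v) = \sum_i m (A `&` C (child v i)))
  (s_split : forall v A, good v -> measurable A ->
     s (A `&` C v) = \sum_i s (A `&` C (child v i)))
  (m_child : forall v i, good v -> m (C v) = kappa * m (C (child v i)))
  (kappa2 : 2 <= kappa) (alpha01 : 0 < alpha <= 1) (gamma0 : 0 <= gamma)
  (m_gt0 : forall v, good v -> 0 < m (C v))
  (s_le : forall v A, measurable A -> s (A `&` C v) <= s (C v))
  (Ainfty : forall v A, good v -> measurable A ->
     m (A `&` C v) <= alpha * m (C v) -> s (A `&` C v) <= gamma * s (C v)).

Lemma measurable_stopped F t k v : measurable (stopped F t k v).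
Proof.
elim: k v => [|k IH] v /=; case: ifPn => // _.
exact: fin_bigcup_measurable.
Qed.

Lemma stopped_sub F t k v : stopped F t k v `<=` C v.
Proof.
elim: k v => [|k IH] v x /=; case: ifP => // _ [i _ /IH]; exact: subC.
Qed.

Lemma stopped_child F t k v i : m (F `&` C v) <= t * m (C v) ->
  stopped F t k.+1 v `&` C (child v i) = stopped F t k (child v i).
Proof.
move=> h; rewrite /= ltNge h /=; apply/seteqP; split; last first.
  by move=> x Hx; split; [exists i|exact: stopped_sub Hx].
move=> x [[j _ jx] ix].
have [<-//|ji] := eqVneq j i.
have := disjC v ji => /seteqP[/(_ x) + _]; case; split => //.
exact: stopped_sub jx.
Qed.

Lemma stopped_measure F t k v : measurable F -> 0 < t -> good v ->
  t * m (stopped F t k v) <= m (F `&` C v).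
Proof.
move=> mF t0; elim: k v => [|k IH] v gv.
  by rewrite /=; case: ifPn => [/ltW//|_]; rewrite m0 mulr0.
have [h|h] := leP (m (F `&` C v)) (t * m (C v)); last by rewrite /= h ltW.
rewrite -(setIidl (@stopped_sub F t k.+1 v)).
rewrite !m_split//; last exact: measurable_stopped.
rewrite mulr_sumr; apply: ler_sum => i _.
by rewrite stopped_child//; apply: IH; exact: good_child.
Qed.

(** A stopped node strictly below [v] has an unstopped parent, of density at most [t], so its own
    density is at most [kappa * t] and the hypothesis applies to it. Outside the stopped nodes [F]
    is empty: a bottom node contained in [F] has density 1, which exceeds [t]. *)
Lemma stopped_le F t c k v : measurable F ->
  0 < t < 1 -> 0 <= c ->
  (forall u k', good u -> saturated k' u F -> m (F `&` C u) <= kappa * t * m (C u) ->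
     s (F `&` C u) <= c * s (C u)) ->
  good v -> saturated k v F -> m (F `&` C v) <= kappa * t * m (C v) ->
  s (F `&` C v) <= c * s (stopped F t k v).
Proof.
move=> mF /andP[t0 t1] c0 H; elim: k v => [|k IH] v gv sv mv.
  rewrite /=; case: ifPn => h; first exact: (H v 0).
  case: sv => [Cv|->]; last by rewrite s0 mulr0.
  have vv : F `&` C v = C v by apply/setIidr.
  exfalso; move: h; rewrite vv => /negP; apply.
  by rewrite gtr_pMl// m_gt0.
have [h|h] := leP (m (F `&` C v)) (t * m (C v)); last first.
  by rewrite /= h; exact: (H v k.+1).
rewrite -(setIidl (@stopped_sub F t k.+1 v)).
rewrite !s_split//; last exact: measurable_stopped.
rewrite mulr_sumr; apply: ler_sum => i _.
rewrite stopped_child//; apply: IH; [exact: good_child|exact: sv|].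
rewrite (mulrC kappa) -mulrA -m_child//; apply: le_trans h.
by rewrite (m_split gv mF) (bigD1 i)//= lerDl sumr_ge0.
Qed.

Let a := alpha / kappa.

(** Stopping at density [t = a ^+ n / kappa] selects a set whose measure is at most that of [F] over
    [t], that is at most the fraction [a * kappa = alpha] of [C v], and [Ainfty] gives one factor
    [gamma]. Inside each stopped node [F] has density at most [kappa * t = a ^+ n], and induction
    gives the other [n] factors. *)
Lemma saturated_decay n k v F : measurable F -> good v -> saturated k v F ->
  m (F `&` C v) <= a ^+ n * m (C v) -> s (F `&` C v) <= gamma ^+ n * s (C v).
Proof.
move=> mF; have k2 := kappa2; have k0 : 0 < kappa by lra.
case/andP: alpha01 => al0 al1.
have a0 : 0 < a by rewrite divr_gt0.
have a2 : a <= 1 / 2 by rewrite /a ler_pdivrMr//; lra.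
elim: n k v => [|n IH] k v gv sv mv.
  by rewrite expr0 mul1r; exact: s_le.
set t := a ^+ n / kappa.
have an1 : a ^+ n <= 1 by apply: exprn_ile1; lra.
have t0 : 0 < t by rewrite divr_gt0// exprn_gt0.
have t1 : t < 1 by rewrite /t ltr_pdivrMr// mul1r; lra.
have kt : kappa * t = a ^+ n by rewrite /t mulrC divfK// gt_eqF.
have gn0 : 0 <= gamma ^+ n by rewrite exprn_ge0.
apply: (@le_trans _ _ (gamma ^+ n * s (stopped F t k v))).
  apply: (@stopped_le F t) => //; first by rewrite t0.
    by move=> u k' gu su; rewrite kt; exact: (IH k').
  rewrite kt; apply: le_trans mv _; rewrite exprSr -mulrA ler_wpM2l ?exprn_ge0 ?(ltW a0)//.
  by rewrite ger_pMl ?m_gt0//; lra.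
rewrite exprSr -mulrA ler_wpM2l//.
rewrite -(setIidl (@stopped_sub F t k v)); apply: Ainfty => //.
  exact: measurable_stopped.
rewrite (setIidl (@stopped_sub _ _ _ _)).
rewrite -(ler_pM2l t0); apply: le_trans (stopped_measure _ mF t0 gv) _.
apply: le_trans mv _.
rewrite le_eqVlt; apply/orP; left; apply/eqP.
rewrite exprSr {2}/a /t; move: (a ^+ n) => y; field.
by rewrite gt_eqF.
Qed.

End tree.

Section reverse_holder.
Context {R : realType}.

Lemma nneseries_ub (u : nat -> \bar R) (c : \bar R) : (forall n, 0 <= u n)%E ->
  (forall n, \sum_(0 <= i < n) u i <= c)%E -> (\sum_(i <oo) u i <= c)%E.
Proof.
move=> u0 uc; apply: lime_le; first exact: is_cvg_nneseries.
exact: nearW.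
Qed.

Lemma nneseries_ge_term (u : nat -> \bar R) n : (forall n, 0 <= u n)%E ->
  (u n <= \sum_(i <oo) u i)%E.
Proof.
move=> u0; apply: (@le_trans _ _ (\sum_(0 <= i < n.+1) u i)%E).
  by rewrite big_nat_recr//= leeDr// sume_ge0.
by apply: nneseries_lim_ge => k _ _.
Qed.

Lemma geometric_partial_le (z : R) n : 0 <= z < 1 ->
  \sum_(0 <= i < n) z ^+ i <= (1 - z)^-1.
Proof.
move=> /andP[z0 z1]; have h : 0 < 1 - z by lra.
rewrite -(ler_pM2r h) mulVf ?gt_eqF//.
have -> : (\sum_(0 <= i < n) z ^+ i) * (1 - z) = 1 - z ^+ n.
  elim: n => [|n IH]; first by rewrite big_nil mul0r expr0 subrr.
  by rewrite big_nat_recr//= mulrDl IH exprS; ring.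
by rewrite lerBlDr lerDl exprn_ge0.
Qed.

Lemma exists_exprn_ge (b y : R) : 1 < b -> exists n, y <= b ^+ n.
Proof.
move=> b1; have L0 : 0 < ln b by exact: ln_gt0.
have b0 : 0 < b by lra.
exists (Num.truncn (`|y| / ln b)).+1.
have : `|y| / ln b < (Num.truncn (`|y| / ln b)).+1%:R.
  by apply: truncnS_gt.
set N := _.+1 => h; rewrite -powR_mulrn ?(ltW b0)// /powR gt_eqF//.
apply: le_trans (expR_ge1Dx _).
move: h; rewrite ltr_pdivrMr// => h; have := ler_norm y; lra.
Qed.

Lemma exists_exprn_between (b y : R) : 1 < b -> 1 < y ->
  exists n, b ^+ n < y <= b ^+ n.+1.
Proof.
move=> b1 y1; have ex := exists_exprn_ge y b1.
case: (ex_minnP ex) => -[|n] h1 h2; first by move: h1; rewrite expr0 leNgt y1.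
exists n; rewrite h1 andbT ltNge; apply/negP => /h2; rewrite ltnn//.
Qed.

Lemma powR_le_level_series (b delta y : R) : 1 < b -> 0 < delta -> 0 <= y ->
  ((y `^ delta)%:E <=
   1 + \sum_(j <oo) ((b `^ delta) ^+ j.+1 * (b ^+ j < y)%R%:R)%:E)%E.
Proof.
move=> b1 d0 y0; have b0 : 0 < b by lra.
have bd0 : 0 <= b `^ delta by exact: powR_ge0.
have t0 n : (0 <= ((b `^ delta) ^+ n.+1 * (b ^+ n < y)%R%:R)%:E :> \bar R)%E.
  by rewrite lee_fin mulr_ge0 ?exprn_ge0.
have [y1|y1] := leP y 1.
  apply: (@le_trans _ _ 1%E).
    have -> : 1 = 1 `^ delta :> R by rewrite powR1.
    by rewrite lee_fin; apply: ge0_powR_le => //; exact: ltW.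
  by rewrite leeDl// nneseries_ge0.
have [n /andP[n1 n2]] := exists_exprn_between b1 y1.
apply: (@le_trans _ _ (((b `^ delta) ^+ n.+1 * (b ^+ n < y)%R%:R)%:E)).
  rewrite n1 mulr1 lee_fin -powR_mulrn// -powRrM mulrC powRrM powR_mulrn ?(ltW b0)//.
  by apply: ge0_powR_le => //; exact: ltW.
apply: le_trans (nneseries_ge_term n t0) _.
by rewrite leeDr.
Qed.

(* With b = 1 / a the layers [b^j < sigma / avg] have measure at most a^j, hence
   sigma-mass decaying like gamma^j; delta is small enough for b^delta to be
   beaten by this decay. *)
Lemma reverse_holder (a gamma : R) : 0 < a <= 1 / 2 -> 0 <= gamma < 1 ->
  exists delta, exists2 c, 0 < delta /\ 0 < c &
  forall d (T : measurableType d) (mu : {measure set T -> \bar R})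
    (P : set T) (sigma : T -> R) (M S : R),
    measurable P -> mu P = M%:E -> 0 < M ->
    measurable_fun setT sigma -> (forall x, 0 <= sigma x) ->
    (\int[mu]_(x in P) (sigma x)%:E = S%:E)%E -> 0 < S ->
    (forall n E, measurable E -> E `<=` P -> (mu E <= (a ^+ n / 2 * M)%:E)%E ->
       (\int[mu]_(x in E) (sigma x)%:E <= (gamma ^+ n * S)%:E)%E) ->
    (\int[mu]_(x in P) (sigma x `^ (1 + delta))%:E
       <= (c * (S / M) `^ delta * S)%:E)%E.
Proof.
move=> /andP[a0 a2] /andP[g0 g1].
(* [gamma = 0] is allowed; the maximum keeps [g] positive, so that its logarithm can be used. *)
pose g := Num.max gamma (1 / 2).
have g01 : 0 < g by rewrite lt_max; apply/orP; right; lra.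
have gl1 : g < 1 by rewrite gt_max g1; lra.
have gg : gamma <= g by rewrite le_max lexx.
pose b := a^-1.
have b1 : 1 < b by rewrite invf_gt1//; lra.
have b0 : 0 < b by lra.
have lnb : 0 < ln b by exact: ln_gt0.
have lng : ln g < 0 by rewrite ln_lt0// g01.
(* This makes $b^\delta g$ the square root of [g], hence less than 1. *)
pose delta := - (ln g) / 2 / ln b.
have d0 : 0 < delta by rewrite /delta divr_gt0// divr_gt0//; lra.
pose z := b `^ delta * g.
have zE : z = expR (ln g / 2).
  rewrite /z gt0_powRE// -[X in _ * X = _](lnK g01) -expRD; congr expR.
  by rewrite /delta; field; rewrite gt_eqF.
have z0 : 0 < z by rewrite zE expR_gt0.
have z1 : z < 1 by rewrite zE expR_lt1; lra.
have bd0 : 0 < b `^ delta by exact: powR_gt0.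
pose c := 1 + b `^ delta / g / (1 - z).
have c00 : 0 < b `^ delta / g / (1 - z) by rewrite !divr_gt0//; lra.
exists delta, c; first by split => //; rewrite /c; lra.
move=> d T mu P sigma M S mP muP M0 ms s0 intS S0 H.
pose l := S / M; have l0 : 0 < l by rewrite divr_gt0.
pose E j := P `&` [set x | l * b ^+ j < sigma x].
have mE j : measurable (E j).
  apply: measurableI => //.
  rewrite [X in measurable X](_ : _ = sigma @^-1` `]l * b ^+ j, +oo[%classic).
    by rewrite -[X in measurable X]setTI; exact: ms.
  by apply/seteqP; split => x /=; rewrite in_itv/= andbT.
have sE0 j : (0 <= \int[mu]_(x in E j) (sigma x)%:E)%E.
  by apply: integral_ge0 => x _; rewrite lee_fin.
have msE : measurable_fun setT (EFin \o sigma) by exact/measurable_EFinP.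
have sES j : (\int[mu]_(x in E j) (sigma x)%:E <= S%:E)%E.
  rewrite -intS; apply: ge0_subset_integral => //.
  - exact: measurable_funTS.
  - by move=> x _; rewrite lee_fin.
  - by move=> x [].
have muE j : (mu (E j) <= (a ^+ j * M)%:E)%E.
  have : ((l * b ^+ j)%:E * mu (E j) <= S%:E)%E.
    rewrite -integral_cst//; apply: le_trans (sES j).
    apply: ge0_le_integralW => x.
      by move=> _; rewrite lee_fin mulr_ge0 ?exprn_ge0// ltW.
    by move=> [_ /= /ltW]; rewrite lee_fin.
  rewrite -lee_pdivlMl; last by rewrite mulr_gt0 ?exprn_gt0.
  rewrite -EFinM; have -> // : (l * b ^+ j)^-1 * S = a ^+ j * M.
  by rewrite /l /b exprVn; field; rewrite ?gt_eqF ?exprn_gt0.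
(* The hypothesis asks for measure [a ^+ n / 2 * M], while [muE] has no factor 1/2. One power of
   [a <= 1 / 2] supplies it, so the exponent of [g] drops by one; level 0 is bounded by [S]
   itself. *)
have sE j : (\int[mu]_(x in E j) (sigma x)%:E <= (g ^+ j / g * S)%:E)%E.
  case: j => [|j].
    apply: le_trans (sES 0) _; rewrite lee_fin expr0 ler_peMl ?(ltW S0)//.
    by rewrite mul1r invf_ge1// ltW.
  apply: (@le_trans _ _ (gamma ^+ j * S)%:E).
    apply: H => //; first by move=> x [].
    apply: le_trans (muE _) _; rewrite lee_fin ler_wpM2r ?(ltW M0)// exprSr.
    by rewrite ler_wpM2l ?exprn_ge0 ?(ltW a0)//; lra.
  rewrite lee_fin ler_wpM2r ?(ltW S0)// exprSr mulfK ?gt_eqF//.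
  by apply: lerXn2r; rewrite ?nnegrE ?(ltW g01).
pose u j x := (l `^ delta * (b `^ delta) ^+ j.+1 * (\1_(E j) x * sigma x))%:E.
have u0 j x : (0 <= u j x)%E.
  by rewrite lee_fin !mulr_ge0// ?exprn_ge0// ?powR_ge0// indicE.
have mu_ j : measurable_fun setT (u j).
  apply/measurable_EFinP; apply: measurable_funM => //.
  exact: measurable_funM.
have pt x : P x -> ((sigma x `^ (1 + delta))%:E <=
    (l `^ delta * sigma x)%:E + \sum_(j <oo) u j x)%E.
  move=> Px; rewrite powRD; last by apply/implyP => /eqP; lra.
  rewrite powRr1//.
  have slE : sigma x = l * (sigma x / l) by field; rewrite gt_eqF.
  have y0 : 0 <= sigma x / l by rewrite divr_ge0// ltW.
  rewrite [in X in (X <= _)%E]slE [in X in (_ * X)%:E]slE powRM ?(ltW l0)//.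
  rewrite -slE.
  have := powR_le_level_series b1 d0 y0.
  set Z := (\sum_(j <oo) _)%E => h.
  have k0 : (0 <= (sigma x * l `^ delta)%:E)%E by rewrite lee_fin mulr_ge0 ?powR_ge0.
  rewrite mulrA EFinM; apply: le_trans (lee_wpmul2l k0 h) _.
  rewrite ge0_muleDr// ?nneseries_ge0//; last first.
    by move=> n _ _; rewrite lee_fin mulr_ge0 ?exprn_ge0 ?powR_ge0.
  rewrite mule1 mulrC; apply: leeD2l.
  rewrite -nneseriesZl; last first.
    by move=> n _; rewrite lee_fin mulr_ge0 ?exprn_ge0 ?powR_ge0.
  apply: lee_nneseries => [n _ _|n _].
    by rewrite mule_ge0// ?lee_fin ?mulr_ge0 ?exprn_ge0 ?powR_ge0.
  rewrite /u -EFinM lee_fin indicE.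
  have -> : (x \in E n) = (b ^+ n < sigma x / l).
    rewrite /E; apply/idP/idP => [/set_mem[_ /=]|h1].
      by rewrite ltr_pdivlMr// mulrC.
    by apply/mem_set; split => //=; rewrite mulrC -ltr_pdivlMr.
  by rewrite le_eqVlt; apply/orP; left; apply/eqP; ring.
apply: (@le_trans _ _ (\int[mu]_(x in P)
   ((l `^ delta * sigma x)%:E + \sum_(j <oo) u j x))%E).
  apply: ge0_le_integralW => // x _.
  by rewrite lee_fin powR_ge0.
rewrite ge0_integralD//; last 4 first.
- by move=> x _; rewrite lee_fin mulr_ge0 ?powR_ge0.
- by apply/measurable_funTS/measurable_EFinP/measurable_funM.
- by move=> x _; apply: nneseries_ge0 => n _ _; exact: u0.
- apply: ge0_emeasurable_sum => [n x _ _|n _]; first exact: u0.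
  exact/measurable_funTS.
under eq_integral do rewrite EFinM.
rewrite ge0_integralZl_EFin ?powR_ge0//; last 2 first.
- by move=> x _; rewrite lee_fin.
- exact: measurable_funTS.
rewrite intS integral_nneseries//; last by move=> n; exact: measurable_funTS.
have -> : (c * (S / M) `^ delta * S)%:E =
   ((l `^ delta)%:E * S%:E + (l `^ delta * (b `^ delta / g / (1 - z)) * S)%:E)%E.
  by rewrite -EFinM -EFinD; congr EFin; rewrite /c -/l; ring.
apply: leeD2l; apply: nneseries_ub.
  by move=> n; apply: integral_ge0 => x _; exact: u0.
move=> n; apply: (@le_trans _ _ (\sum_(0 <= i < n)
    (l `^ delta * (b `^ delta / g) * S * z ^+ i)%:E)%E); last first.
  rewrite sumEFin lee_fin -mulr_sumr.
  have zz : 0 <= z < 1 by rewrite ltW.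
  apply: le_trans (ler_wpM2l _ (geometric_partial_le n zz)) _.
    by rewrite !mulr_ge0 ?powR_ge0 ?invr_ge0 ?(ltW g01) ?(ltW S0).
  by rewrite le_eqVlt; apply/orP; left; apply/eqP; ring.
apply: lee_sum => i _.
have -> : (\int[mu]_(x in P) u i x =
   (l `^ delta * (b `^ delta) ^+ i.+1)%:E * \int[mu]_(x in E i) (sigma x)%:E)%E.
  rewrite /u; under eq_integral do rewrite EFinM.
  rewrite ge0_integralZl_EFin//; last 3 first.
  - by move=> x _; rewrite lee_fin mulr_ge0.
  - by apply/measurable_funTS/measurable_EFinP/measurable_funM.
  - by rewrite mulr_ge0 ?exprn_ge0 ?powR_ge0.
  congr (_ * _)%E; rewrite [in RHS](_ : E i = P `&` E i); last first.
    by apply/seteqP; split => [x [? ?]|x []//]; split.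
  rewrite integral_mkcondr; apply: eq_integral => x _.
  by rewrite epatch_indic mulrC EFinM.
apply: le_trans (lee_wpmul2l _ (sE i)) _.
  by rewrite lee_fin mulr_ge0 ?exprn_ge0 ?powR_ge0.
rewrite -EFinM lee_fin /z exprMn exprS.
by rewrite le_eqVlt; apply/orP; left; apply/eqP; ring.
Qed.

End reverse_holder.

(** * Half-open cubes and their dyadic subdivisions *)

Section half_open_boxes.
Context (R : realType).

Lemma measurable_hbox (m : nat) (a b : 'I_m -> R) :
  measurable [set x : m.-tuple (measurableTypeR R) |
    forall i, a i <= (tnth x i : R) < b i].
Proof.
rewrite [X in measurable X](_ : _ = \bigcap_(i in [set: 'I_m])
    ((fun x : m.-tuple (measurableTypeR R) => tnth x i) @^-1` `[a i, b i[)).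
  apply: fin_bigcap_measurable => // i _.
  rewrite -[X in measurable X]setTI.
  by apply: (@measurable_tnth _ (measurableTypeR R)).
apply/seteqP; split => [x xB i _|x xB i].
  by rewrite /= in_itv/=; exact: xB.
by have := xB i Logic.I; rewrite /= in_itv.
Qed.

Lemma borel_hbox (m : nat) (a b : 'I_m -> R) : (forall i, a i <= b i) ->
  borel_lebesgue R m [set x | forall i, a i <= (tnth x i : R) < b i]
  = (\prod_i (b i - a i))%:E.
Proof.
elim: m a b => [|m IH] a b ab.
  by rewrite big_ord0 /= /dirac indicE mem_set// => -[].
set B := (X in borel_lebesgue _ _ X).
rewrite /= /cons_measure /pushforward.
have -> : @tuple_cons R m @^-1` B = `[a ord0, b ord0[ `*`
   [set x : m.-tuple (measurableTypeR R) |
     forall i, a (lift ord0 i) <= (tnth x i : R) < b (lift ord0 i)].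
  apply/seteqP; split => [[t x] /= xB|[t x] /= [+ xB]].
    split; first by have := xB ord0; rewrite /= in_itv.
    by move=> i; have := xB (lift ord0 i); rewrite /tuple_cons tnthS.
  rewrite in_itv/= => At i.
  by case: (unliftP ord0 i) => [j|] ->; rewrite /tuple_cons/= ?tnthS//; exact: xB.
rewrite product_measure1E//=; last exact: measurable_hbox.
rewrite IH// lebesgue_measure_itv /= lte_fin big_ord_recl EFinM.
case: ltP => // ba; congr (_ * _)%E; apply/eqP.
by rewrite eq_sym eqe subr_eq0 eq_le ba ab.
Qed.

End half_open_boxes.

Section euclid_geometry.
Context {R : realType} {n : nat}.
Local Notation T := (euclid R n).
Local Notation edist := Defs.edist.
Local Notation mu := (lebesgue R n).
Implicit Types (x y : T) (b : 'I_n -> R) (s : R).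

Lemma measurable_borel (A : set (n.-tuple (measurableTypeR R))) :
  measurable A -> measurable (A : set T).
Proof. exact: caratheodory_measurable_mu_ext. Qed.

Lemma lebesgue_borel (A : set (n.-tuple (measurableTypeR R))) :
  measurable A -> mu A = borel_lebesgue R n A.
Proof. exact: measurable_mu_extE. Qed.

Lemma measurable_coordinate i : measurable_fun [set: T] (fun x => coordinate x i).
Proof.
move=> _ Y mY; rewrite setTI; apply: measurable_borel.
rewrite -[X in measurable X]setTI.
exact: (@measurable_tnth _ (measurableTypeR R) n i).
Qed.

(** Half-open sides make the $2^n$ dyadic children a partition; the difference from [cube] is a null
    set, so averages are unaffected. *)
Definition hcube b s : set T :=
  [set x | forall i, b i <= coordinate x i < b i + s].

Lemma measurable_hcube b s : measurable (hcube b s).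
Proof.
exact: (measurable_borel (measurable_hbox b (fun i => b i + s))).
Qed.
Hint Resolve measurable_hcube : core.

Lemma measurable_cube (a : T) s : measurable (cube a s).
Proof.
exact: (measurable_borel (measurable_box (coordinate a)
  (fun i => coordinate a i + s))).
Qed.

Lemma lebesgue_hcube b s : 0 <= s -> mu (hcube b s) = (s ^+ n)%:E.
Proof.
move=> s0; have := @borel_hbox R n b (fun i => b i + s).
move=> box; transitivity (borel_lebesgue R n (hcube b s)).
  by apply: lebesgue_borel; exact: measurable_hbox.
rewrite [LHS]box; last by move=> i; rewrite lerDl.
under eq_bigr do rewrite addrC addKr.
by rewrite prodr_const card_ord.
Qed.

Definition point b : T := [tuple b i | i < n].

Lemma coordinate_point b i : coordinate (point b) i = b i.
Proof. by rewrite /coordinate tnth_mktuple. Qed.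

Lemma hcube_cube_sub (a : T) s : hcube (coordinate a) s `<=` cube a s.
Proof. by move=> x Hx i; have /andP[-> /ltW ->] := Hx i. Qed.

Lemma cube_null (a : T) s : 0 <= s ->
  mu (cube a s `\` hcube (coordinate a) s) = 0%E.
Proof.
move=> s0; have := @measureD _ _ _ mu (cube a s) (hcube (coordinate a) s)
  (measurable_cube a s) (measurable_hcube _ s).
rewrite setIidr; last exact: hcube_cube_sub.
rewrite [X in (X < _)%E]lebesgue_cube// ltry => /(_ isT) ->.
rewrite [X in (X - _)%E](_ : _ = (s ^+ n)%:E); last exact: lebesgue_cube.
by rewrite [X in (_ - X)%E]lebesgue_hcube// subee.
Qed.

Lemma ge0_integral_cube (a : T) s (f : T -> \bar R) : 0 <= s ->
  measurable_fun setT f -> (forall x, 0 <= f x)%E ->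
  (\int[mu]_(x in cube a s) f x =
   \int[mu]_(x in hcube (coordinate a) s) f x)%E.
Proof.
move=> s0 mf f0.
rewrite (@ge0_negligible_integral _ _ _ mu (cube a s)
  (cube a s `\` hcube (coordinate a) s))//.
- by rewrite setDD setIidr//; exact: hcube_cube_sub.
- by apply: measurableD => //; exact: measurable_cube.
- exact: measurable_cube.
- exact: measurable_funTS.
- exact: cube_null.
Qed.

(* A dyadic node is a corner together with a side length. *)
Definition node : Type := ('I_n -> R) * R.
Definition node_set (v : node) : set T := hcube v.1 v.2.
Definition node_child (v : node) (e : {ffun 'I_n -> bool}) : node :=
  (fun i => v.1 i + (e i)%:R * (v.2 / 2), v.2 / 2).

Lemma node_child_sub v e : 0 <= v.2 -> node_set (node_child v e) `<=` node_set v.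
Proof.
move=> s0 x Hx i; have /andP[/= h1 h2] := Hx i.
move: h1 h2; case: (e i); rewrite ?mul1r ?mul0r ?addr0 => h1 h2; apply/andP; split; lra.
Qed.

Lemma node_child_disj v e e' : e != e' ->
  node_set (node_child v e) `&` node_set (node_child v e') = set0.
Proof.
move=> ee'; rewrite -subset0 => x [h h']; apply: (negP ee').
apply/eqP/ffunP => i; have := h i; have := h' i => /=.
by case: (e i); case: (e' i) => //;
  rewrite ?mul1r ?mul0r ?addr0 => /andP[? ?] /andP[? ?]; exfalso; lra.
Qed.

Lemma node_child_cover v x : node_set v x ->
  exists e, node_set (node_child v e) x.
Proof.
move=> Hx; exists [ffun i => v.1 i + v.2 / 2 <= coordinate x i] => i /=.
rewrite ffunE; have /andP[h1 h2] := Hx i.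
by case: (leP (v.1 i + v.2 / 2) (coordinate x i)) => h /=; rewrite ?mul1r ?mul0r ?addr0; apply/andP; split; lra.
Qed.

Lemma node_split v : 0 <= v.2 ->
  node_set v = \big[setU/set0]_e node_set (node_child v e).
Proof.
move=> s0; rewrite -bigcup_seq; apply/seteqP; split => [x Hx|x [e _ He]].
  by have [e He] := node_child_cover Hx; exists e => //=; rewrite mem_index_enum.
exact: node_child_sub He.
Qed.

Lemma ge0_integral_node v (A : set T) (f : T -> \bar R) : 0 <= v.2 ->
  measurable A -> measurable_fun setT f -> (forall x, 0 <= f x)%E ->
  (\int[mu]_(x in A `&` node_set v) f x =
   \sum_e \int[mu]_(x in A `&` node_set (node_child v e)) f x)%E.
Proof.
move=> s0 mA mf f0; rewrite {1}(node_split s0) big_distrr/=.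
rewrite ge0_integral_bigsetU//=.
- by move=> e; apply: measurableI => //; exact: measurable_hcube.
- exact: index_enum_uniq.
- move=> e e' _ _ [x [[_ h] [_ h']]]; apply/eqP/negPn/negP => /(node_child_disj v).
  by move=> /seteqP[/(_ x) + _]; apply.
- exact: measurable_funTS.
Qed.

Lemma integral_cst1 (A : set T) : measurable A ->
  (\int[mu]_(x in A) 1%:E)%E = mu A.
Proof. by move=> mA; rewrite integral_cst// mul1e. Qed.

Lemma enorm_ge0 x : 0 <= enorm x. Proof. exact: sqrtr_ge0. Qed.

Lemma coordinate_le_enorm x i : `|coordinate x i| <= enorm x.
Proof.
rewrite -sqrtr_sqr /enorm ler_wsqrtr// (bigD1 i)//= lerDl sumr_ge0// => j _.
exact: sqr_ge0.
Qed.

Lemma sqrt_sum_sqr_le (f : 'I_n -> R) :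
  Num.sqrt (\sum_i f i ^+ 2) <= \sum_i `|f i|.
Proof.
have h0 : 0 <= \sum_i `|f i| by exact: sumr_ge0.
rewrite -[leRHS](ger0_norm h0) -sqrtr_sqr ler_wsqrtr//.
suff [] : 0 <= \sum_i `|f i| /\ \sum_i f i ^+ 2 <= (\sum_i `|f i|) ^+ 2 by [].
elim/big_rec2: _ => [|i y1 y2 _ [h1 h2]]; first by rewrite expr0n.
split; first by rewrite addr_ge0.
rewrite -(real_normK (num_real (f i))).
have := mulr_ge0 (normr_ge0 (f i)) h1; rewrite sqrrD; lra.
Qed.

Lemma enorm_le_sum x : enorm x <= \sum_i `|coordinate x i|.
Proof. exact: sqrt_sum_sqr_le. Qed.

Lemma hcube_edist b s x y : 0 <= s -> hcube b s x -> hcube b s y ->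
  edist x y <= n%:R * s.
Proof.
move=> s0 Hx Hy; apply: le_trans (sqrt_sum_sqr_le _) _.
rewrite -[n in n%:R]card_ord -sumr_const mulr_suml; apply: ler_sum => i _.
rewrite mul1r ler_norml; have := Hx i; have := Hy i.
by move=> /andP[? ?] /andP[? ?]; apply/andP; split; lra.
Qed.

Lemma edist_gt0 x y : x <> y -> 0 < edist x y.
Proof.
move=> xy; rewrite lt_neqAle sqrtr_ge0 andbT eq_sym sqrtr_eq0 -ltNge.
have [i xyi] : exists i, coordinate x i != coordinate y i.
  apply: contrapT => h; apply: xy; apply: eq_from_tnth => i.
  by apply: contrapT => /eqP hi; apply: h; exists i.
rewrite (bigD1 i)//= ltr_pwDl ?sumr_ge0// => [|j _]; last exact: sqr_ge0.
by rewrite lt_neqAle sqr_ge0 andbT eq_sym sqrf_eq0 subr_eq0.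
Qed.

Lemma hcube_enorm b s x y : 0 <= s -> hcube b s x -> hcube b s y ->
  enorm x <= n%:R * (enorm y + s).
Proof.
move=> s0 Hx Hy; apply: le_trans (enorm_le_sum x) _.
rewrite -[n in n%:R]card_ord -sumr_const mulr_suml; apply: ler_sum => i _.
rewrite mul1r; apply: le_trans (lerD (coordinate_le_enorm y i) (lexx s)).
have /andP[? ?] := Hx i; have /andP[? ?] := Hy i.
have -> : coordinate x i = coordinate y i + (coordinate x i - coordinate y i) by ring.
apply: le_trans (ler_normD _ _) _; rewrite lerD2l ler_norml.
by apply/andP; split; lra.
Qed.

End euclid_geometry.

(** * Approximation of measurable sets by finite unions of dyadic nodes *)

Definition mass {R : realType} {n : nat} (Q : @node R n) (g : euclid R n -> R)
  (A : set (euclid R n)) :=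
  fine (\int[lebesgue R n]_(x in A `&` node_set Q) (g x)%:E)%E.

Section approximation.
Context {R : realType} {n : nat}.
Local Notation T := (euclid R n).
Local Notation mu := (lebesgue R n).
Local Notation saturated := (saturated (@node_set R n) node_child).
Implicit Types (u v : @node R n) (A B F G : set T).
Variables (Q : @node R n) (g : T -> R).
Hypotheses (Q0 : 0 <= Q.2) (mg : measurable_fun setT g) (g0 : forall x, 0 <= g x)
  (gfin : (\int[mu]_(x in node_set Q) (g x)%:E < +oo)%E).

Let mQ : measurable (node_set Q). Proof. exact: measurable_hcube. Qed.

Let mg' (A : set T) : measurable_fun A (EFin \o g).
Proof. exact/measurable_funTS/measurable_EFinP. Qed.

Local Notation nu := (mass Q g).

Lemma massE A : measurable A ->
  (\int[mu]_(x in A `&` node_set Q) (g x)%:E)%E = (nu A)%:E.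
Proof.
move=> mA; rewrite fineK// ge0_fin_numE.
  apply: le_lt_trans gfin; apply: ge0_subset_integral => //.
  - exact: measurableI.
  - by move=> x _; rewrite lee_fin.
by apply: integral_ge0 => x _; rewrite lee_fin.
Qed.

Lemma mass_ge0 A : 0 <= nu A.
Proof. by apply/fine_ge0/integral_ge0 => x _; rewrite lee_fin. Qed.

Lemma mass_le A B : measurable A -> measurable B ->
  A `&` node_set Q `<=` B -> nu A <= nu B.
Proof.
move=> mA mB AB; rewrite -lee_fin -!massE//.
apply: ge0_subset_integral => //; [exact: measurableI..| |].
- by move=> x _; rewrite lee_fin.
- by move=> x [Ax Qx]; split => //; exact: AB.
Qed.

Lemma mass_leU A B C : measurable A -> measurable B -> measurable C ->
  A `&` node_set Q `<=` B `|` C -> nu A <= nu B + nu C.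
Proof.
move=> mA mB mC ABC; apply: (@le_trans _ _ (nu (B `|` (C `\` B)))).
  apply: mass_le => //; first by apply: measurableU => //; exact: measurableD.
  move=> x /ABC[Bx|Cx]; first by left.
  by have [Bx|Bx] := pselect (B x); [left|right].
apply: (@le_trans _ _ (nu B + nu (C `\` B))); last first.
  by rewrite lerD2l mass_le//; [exact: measurableD|move=> x [[]]].
rewrite -lee_fin EFinD -!massE//; [|exact: measurableD|]; last first.
  by apply: measurableU => //; exact: measurableD.
rewrite setIUl ge0_integralU_EFin//.
- exact: measurableI.
- by apply: measurableI => //; exact: measurableD.
- by rewrite -subset0 => x [[Bx _] [[_ nBx] _]].
Qed.

Lemma mass_bigcup (F : (set T)^nat) e : (forall k, measurable (F k)) ->
  nondecreasing_seq F -> 0 < e ->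
  exists N, nu ((\bigcup_k F k) `\` F N) <= e.
Proof.
move=> mF ndF e0.
pose G k := F k `&` node_set Q.
have mG k : measurable (G k) by exact: measurableI.
have ndG : nondecreasing_seq G.
  move=> i j ij; apply/subsetPset => x [Fx Qx]; split => //.
  by have /subsetPset := ndF _ _ ij; exact.
have mUF : measurable (\bigcup_k F k) by exact: bigcup_measurable.
pose I k := (\int[mu]_(x in G k) (g x)%:E)%E.
have ndI : nondecreasing_seq I.
  apply: ge0_nondecreasing_set_nondecreasing_integral => //.
  by move=> i x _; rewrite lee_fin.
have : I @ \oo --> (\int[mu]_(x in \bigcup_k G k) (g x)%:E)%E.
  apply: ge0_nondecreasing_set_cvg_integral => //.
  by move=> i x _; rewrite lee_fin.
rewrite -setI_bigcupl massE// => cI.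
have sI : ereal_sup (range I) = (nu (\bigcup_k F k))%:E.
  apply: (cvg_unique _ _ cI) => //; exact: ereal_nondecreasing_cvgn.
have [_ [N _ <-]] := @ub_ereal_sup_adherent _ (range I) e e0
  ltac:(by rewrite sI).
rewrite sI /I massE// -EFinB lte_fin => h.
exists N; have mD : measurable (\bigcup_k F k `\` F N) by exact: measurableD.
suff : nu (\bigcup_k F k) = nu (F N) + nu (\bigcup_k F k `\` F N) by lra.
apply: EFin_inj; rewrite EFinD -!massE// -ge0_integralU_EFin//.
- congr (integral mu _ _); rewrite -setIUl; congr (_ `&` _).
  by rewrite setDUK//; exact: bigcup_sup.
- exact: measurableI.
- exact: measurableI.
- by rewrite -subset0 => x [[Bx _] [[_ nBx] _]].
Qed.

Let symd (A B : set T) := (A `\` B) `|` (B `\` A).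

(** Closeness is measured by [nu], which will be the mass of [1 + sigma], so that one approximant
    serves Lebesgue measure and [sigma] together. The class is shown to be a sigma-algebra
    containing the coordinate rays. *)
Definition approximable (A : set T) := measurable A /\
  forall e, 0 < e -> exists k F, [/\ measurable F, saturated k Q F &
    nu ((A `\` F) `|` (F `\` A)) <= e].

Let symd_fine A F : nu ((A `\` F) `|` (F `\` A)) = nu (symd A F).
Proof. by []. Qed.

Lemma saturatedS k v F : 0 <= v.2 -> saturated k v F -> saturated k.+1 v F.
Proof.
elim: k v => [|k IH] v v0 H e.
  case: H => H; [left|right].
    by move=> x /(node_child_sub v0) /H.
  rewrite -subset0 => x [Fx /(node_child_sub v0) vx].
  by rewrite -H.
by apply: IH; [rewrite /= divr_ge0|exact: H].
Qed.

Lemma saturated_le k l v F : 0 <= v.2 -> (k <= l)%N -> saturated k v F ->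
  saturated l v F.
Proof.
move=> v0 /subnK <-; elim: (l - k)%N => [//|j IH] /IH; rewrite addSn.
exact: saturatedS.
Qed.

Lemma saturatedC k v F : saturated k v F -> saturated k v (~` F).
Proof.
elim: k v => [|k IH] v H; last by move=> e; apply: IH; exact: H.
case: H => H; [right|left].
  by rewrite -subset0 => x [nF /H].
by move=> x vx Fx; have : set0 x by rewrite -H.
Qed.

Lemma saturatedU k v F G : saturated k v F -> saturated k v G ->
  saturated k v (F `|` G).
Proof.
elim: k v => [|k IH] v HF HG; last by move=> e; apply: IH; [exact: HF|exact: HG].
case: HF => HF; first by left => x /HF; left.
case: HG => HG; first by left => x /HG; right.
by right; rewrite setIUl HF HG setU0.
Qed.

Lemma approximableC A : approximable A -> approximable (~` A).
Proof.
move=> [mA HA]; split; first exact: measurableC.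
move=> e /HA[k [F [mF sF h]]]; exists k, (~` F); split.
- exact: measurableC.
- exact: saturatedC.
- move: h; rewrite !symd_fine (_ : symd A F = symd (~` A) (~` F))// /symd.
  by rewrite !setDE !setCK setUC; congr (_ `|` _); rewrite setIC.
Qed.

Lemma measurable_symd (A F : set T) :
  measurable A -> measurable F -> measurable (symd A F).
Proof. by move=> mA mF; apply: measurableU; exact: measurableD. Qed.

Lemma approximableU A B : approximable A -> approximable B ->
  approximable (A `|` B).
Proof.
move=> [mA HA] [mB HB]; split; first exact: measurableU.
move=> e e0; have e2 : 0 < e / 2 by lra.
have [k [F [mF sF hF]]] := HA _ e2; have [l [G [mG sG hG]]] := HB _ e2.
exists (maxn k l), (F `|` G); split; first exact: measurableU.
  apply: saturatedU; [exact: (saturated_le Q0 (leq_maxl k l))|].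
  exact: (saturated_le Q0 (leq_maxr k l)).
rewrite symd_fine; move: hF hG; rewrite !symd_fine => hF hG.
apply: (@le_trans _ _ (nu (symd A F) + nu (symd B G))); last by lra.
apply: mass_leU; try exact: measurable_symd.
  by apply: measurable_symd; exact: measurableU.
move=> x [[[[Ax|Bx] nFG]|[[Fx|Gx] nAB]] _].
- by left; left; split => // Fx; apply: nFG; left.
- by right; left; split => // Gx; apply: nFG; right.
- by left; right; split => // Ax; apply: nAB; left.
- by right; right; split => // Bx; apply: nAB; right.
Qed.

Lemma approximable_close A : measurable A ->
  (forall e, 0 < e -> exists2 B, approximable B & nu (symd A B) <= e) ->
  approximable A.
Proof.
move=> mA HA; split => // e e0; have e2 : 0 < e / 2 by lra.
have [B [mB HB] hAB] := HA _ e2; have [k [F [mF sF hF]]] := HB _ e2.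
exists k, F; split => //; rewrite symd_fine; move: hF; rewrite symd_fine => hF.
apply: (@le_trans _ _ (nu (symd A B) + nu (symd B F))); last by lra.
apply: mass_leU; try exact: measurable_symd.
move=> x [[[Ax nF]|[Fx nA]] _].
- have [Bx|nB] := pselect (B x); [by right; left|by left; left].
- have [Bx|nB] := pselect (B x); [by left; right|by right; right].
Qed.

Lemma approximable_bigcup (F : (set T)^nat) : (forall k, approximable (F k)) ->
  approximable (\bigcup_k F k).
Proof.
move=> HF; pose G k := \big[setU/set0]_(i < k.+1) F i.
have aG k : approximable (G k).
  rewrite /G; elim: k => [|k IH]; first by rewrite big_ord1.
  by rewrite big_ord_recr/=; apply: approximableU.
have ndG : nondecreasing_seq G.
  by move=> i j ij; apply/subsetPset; apply: subset_bigsetU.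
have UG : \bigcup_k F k = \bigcup_k G k.
  apply/seteqP; split => [x [k _ Fk]|x [k _]]; last exact: bigsetU_bigcup.
  by exists k => //; apply: (bigsetU_sup (ltnSn k)).
have mU : measurable (\bigcup_k F k) by apply: bigcup_measurable => k _; case: (HF k).
apply: approximable_close => // e e0; rewrite UG.
have mG k : measurable (G k) by case: (aG k).
have [N hN] := mass_bigcup mG ndG e0; exists (G N) => //.
apply: le_trans hN; apply: mass_le.
- by rewrite -UG; apply: measurable_symd.
- by apply: measurableD; rewrite // -UG.
- by move=> x [[//|[Gx nG]] _]; exfalso; apply: nG; exists N.
Qed.

Lemma approximable0 : approximable set0.
Proof.
split=> // e e0; exists 0%N, set0; split => //; first by right; rewrite set0I.
by rewrite !set0D setU0 /mass set0I integral_set0 ltW.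
Qed.

(* Union of the nodes of depth at most k below v that are contained in A. *)
Fixpoint inner (A : set T) k v : set T :=
  match k with
  | 0 => [set x | node_set v x /\ node_set v `<=` A]
  | k'.+1 => [set x | node_set v x /\ node_set v `<=` A] `|`
             \bigcup_e inner A k' (node_child v e)
  end.

Lemma measurable_inner A k v : measurable (inner A k v).
Proof.
have m0 u : measurable [set x | @node_set R n u x /\ node_set u `<=` A].
  have [h|h] := pselect (node_set u `<=` A).
    rewrite (_ : mkset _ = node_set u); first exact: measurable_hcube.
    by apply/seteqP; split => [x []|].
  rewrite (_ : mkset _ = set0)//.
  by apply/seteqP; split => [x []|].
elim: k v => [|k IH] v //=.
by apply: measurableU => //; apply: fin_bigcup_measurable.
Qed.

Lemma inner_sub A k v : inner A k v `<=` A.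
Proof.
elim: k v => [|k IH] v x /=; first by move=> [vx]; exact.
by move=> [[vx]|[e _ /IH//]]; exact.
Qed.

Lemma inner_subv A k v : 0 <= v.2 -> inner A k v `<=` node_set v.
Proof.
elim: k v => [|k IH] v v0 x /=; first by move=> [].
move=> [[]//|[e _ /IH h]]; apply: (@node_child_sub _ _ v e v0).
by apply: h; rewrite /= divr_ge0.
Qed.

Lemma saturated_inner A k v : 0 <= v.2 -> saturated k v (inner A k v).
Proof.
elim: k v => [|k IH] v v0 /=.
  have [h|h] := pselect (node_set v `<=` A); [by left => x|].
  by right; rewrite -subset0 => x [[]].
move=> e; have v20 : 0 <= (node_child v e).2 by rewrite /= divr_ge0.
have [h|h] := pselect (node_set v `<=` A).
  apply: (saturated_le v20 (leq0n k)); left => x Hx; left.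
  by split => //; exact: node_child_sub Hx.
suff E : (inner A k.+1 v) `&` node_set (node_child v e) =
    inner A k (node_child v e) `&` node_set (node_child v e).
  have sat_ext j u F G : (saturated j u F) ->
      F `&` node_set u = G `&` node_set u -> 0 <= u.2 -> saturated j u G.
    elim: j u => [|j IHj] u /=.
      move=> [H|H] FG _; [left => x ux|right; by rewrite -FG].
      by have [] : (G `&` node_set u) x by rewrite -FG; split => //; exact: H.
    move=> H FG u0 i; apply: (IHj _ (H i)); last by rewrite /= divr_ge0.
    apply/seteqP; split => x [Fx ux]; split => //.
      have : (G `&` node_set u) x.
        by rewrite -FG; split => //; exact: node_child_sub ux.
      by case.
    have : (F `&` node_set u) x.
      by rewrite FG; split => //; exact: node_child_sub ux.
    by case.
  by apply: sat_ext (IH _ v20) (esym E) v20.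
apply/seteqP; split => x [Hx vx]; split => //; last by right; exists e.
case: Hx => [[]//|[e' _ He']].
have [<-//|ee'] := eqVneq e' e; exfalso.
have : (node_set (node_child v e') `&` node_set (node_child v e)) x.
  by split => //; apply: inner_subv He'; rewrite /= divr_ge0.
by rewrite node_child_disj.
Qed.

Lemma innerS A k v : inner A k v `<=` inner A k.+1 v.
Proof.
elim: k v => [|k IH] v x; first by move=> h; left.
by move=> [h|[e _ /IH h]]; [left|right; exists e].
Qed.

(** The sets [inner A k Q] increase to [A] inside [Q], so continuity of the mass from below makes
    the remainder small. *)
Lemma approximable_exhaust A : measurable A ->
  (forall x, A x -> node_set Q x -> exists k, inner A k Q x) -> approximable A.
Proof.
move=> mA HA; split => // e e0.
have ndI : nondecreasing_seq (fun k => inner A k Q).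
  by apply/nondecreasing_seqP => k; apply/subsetPset; exact: innerS.
have mI k : measurable (inner A k Q) by exact: measurable_inner.
have [N hN] := mass_bigcup mI ndI e0.
exists N, (inner A N Q); split => //; first exact: saturated_inner.
rewrite symd_fine; apply: le_trans hN; apply: mass_le.
- exact: measurable_symd.
- by apply: measurableD => //; exact: bigcup_measurable.
- move=> x [[[Ax nI]|[Ix nA]] Qx]; last by exfalso; apply: nA; exact: inner_sub Ix.
  by split => //; have [k Hk] := HA x Ax Qx; exists k.
Qed.

(** A point of the ray has a positive gap to [c], and a node containing it whose side is at most
    that gap lies entirely in the ray. The children cover their parent, so such a node is found by
    descending far enough. *)
Lemma approximable_ray i c : approximable [set x | coordinate x i < c].
Proof.
apply: approximable_exhaust.
  rewrite [X in measurable X](_ : _ = (fun x => coordinate x i) @^-1` `]-oo, c[%classic).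
    by rewrite -[X in measurable X]setTI; exact: measurable_coordinate.
  by apply/seteqP; split => x /=; rewrite in_itv.
move=> x /= xc Qx.
have small k v : node_set v x -> v.2 <= (c - coordinate x i) * 2 ^+ k ->
    inner [set x | coordinate x i < c] k v x.
  elim: k v => [|k IH] v vx hv.
    split => // y vy /=; have /andP[h1 h2] := vx i; have /andP[h3 h4] := vy i.
    by move: hv; rewrite expr0 mulr1; lra.
  have [e ex] := node_child_cover vx; right; exists e => //; apply: IH => //=.
  by move: hv; rewrite exprS; lra.
have [k hk] := @exists_exprn_ge R 2 (Q.2 / (c - coordinate x i)) ltac:(lra).
exists k; apply: small => //; move: hk; rewrite ler_pdivrMr; first by lra.
by lra.
Qed.

Lemma approximable_borel (A : set (n.-tuple (measurableTypeR R))) :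
  measurable A -> approximable (A : set T).
Proof.
have sa : @sigma_algebra T setT approximable.
  split; [exact: approximable0|move=> B HB|exact: approximable_bigcup].
  by rewrite setTD; exact: approximableC.
apply: smallest_sub => //; rewrite -bigcup_seq => B [i _ [Y mY <-]].
rewrite setTI.
pose c := fun x : T => coordinate x i.
suff : image_set_system setT c approximable Y.
  by rewrite /image_set_system /= setTI.
have : <<s (@RGenInftyO.G R) >> Y.
  have : ((@RGenInftyO.G R).-sigma.-measurable) Y by rewrite -RGenInftyO.measurableE.
  exact.
apply: smallest_sub; first exact: sigma_algebra_image.
move=> _ [y ->]; rewrite /image_set_system /= setTI.
rewrite (_ : _ @^-1` _ = [set x | coordinate x i < y]).
  exact: approximable_ray.
by apply/seteqP; split => x /=; rewrite in_itv.
Qed.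

(** A Caratheodory measurable set of finite measure lies in a Borel set of the same measure, the
    intersection of covers that nearly realize the outer measure. The difference is null for
    Lebesgue measure, hence for [g] times it. *)
Lemma approximable_measurable A : measurable A -> approximable A.
Proof.
move=> mA; apply: approximable_close => // e e0.
pose X := A `&` node_set Q.
have mX : measurable X by exact: measurableI.
have muX : (mu X < +oo)%E.
  apply: (@le_lt_trans _ _ (mu (node_set Q))); first by apply: le_measure; rewrite ?inE//; exact: subIsetr.
  by rewrite lebesgue_hcube// ltry.
have muXfin : mu X \is a fin_num by rewrite ge0_fin_numE.
have H (j : nat) : exists B : set (n.-tuple (measurableTypeR R)),
   [/\ measurable B, X `<=` B & (mu B <= mu X + (j.+1%:R^-1)%:E)%E].
  have j0 : 0 < j.+1%:R^-1 :> R by rewrite invr_gt0.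
  have [_ [F [mF XF] <-] hF] := lb_ereal_inf_adherent j0 muXfin.
  exists (\bigcup_k F k); split => //; first exact: bigcup_measurable.
  apply: le_trans (ltW hF); apply: le_trans (measure_sigma_subadditive _ _ _ _) _.
  - by move=> k; apply: measurable_borel; exact: mF.
  - by apply: measurable_borel; exact: bigcup_measurable.
  - exact: subset_refl.
  - apply: lee_nneseries => [k _ _|k _]; first exact: measure_ge0.
    rewrite le_eqVlt; apply/orP; left; apply/eqP; apply: lebesgue_borel.
    exact: mF.
have [F HF] := choice H.
pose B : set T := \bigcap_j F j.
have mB : measurable (B : set (n.-tuple (measurableTypeR R))).
  by apply: bigcap_measurable => // j _; case: (HF j).
have mB' : measurable B by exact: measurable_borel.
have XB : X `<=` B by move=> x Xx j _; case: (HF j) => _ + _; exact.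
have muB : (mu B <= mu X)%E.
  apply/lee_addgt0Pr => d d0.
  have [j hj] : exists j : nat, j.+1%:R^-1 < d.
    exists (Num.truncn d^-1); rewrite -[ltRHS]invrK ltf_pV2 ?posrE ?invr_gt0//.
    exact: truncnS_gt.
  have [mFj _ hF] := HF j.
  apply: (@le_trans _ _ (mu (F j))).
    apply: le_measure; rewrite ?inE//; first exact: measurable_borel.
    by move=> x; apply.
  by apply: le_trans hF _; rewrite leeD2l// lee_fin ltW.
have muBX : mu (B `\` X) = 0%E.
  have muBf : (mu B < +oo)%E by exact: le_lt_trans muB muX.
  apply/eqP; rewrite eq_le measure_ge0 andbT.
  by rewrite measureD// setIidr// sube_le0.
exists B; first exact: approximable_borel.
rewrite -lee_fin -massE; last exact: measurable_symd.
apply: (@le_trans _ _ (\int[mu]_(x in B `\` X) (g x)%:E)%E).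
  apply: ge0_subset_integral => //.
  - by apply: measurableI => //; exact: measurable_symd.
  - exact: measurableD.
  - by move=> x _; rewrite lee_fin.
  - move=> x [[[Ax nB]|[Bx nA]] Qx]; first by exfalso; apply: nB; exact: XB.
    by split => // -[].
rewrite (_ : (\int[mu]_(x in _) _ = 0)%E) ?lee_fin ?ltW//.
rewrite (eq_integral (fun x => `|(g x)%:E|%E)); last first.
  by move=> x _; rewrite gee0_abs ?lee_fin.
by apply: integral_abs_eq0 => //; exact: measurableD.
Qed.

End approximation.

(** * Decay and reverse Hoelder inequality on dyadic nodes *)

Section node_reverse_holder.
Context {R : realType} {n : nat}.
Local Notation T := (euclid R n).
Local Notation mu := (lebesgue R n).
Implicit Types (u v : @node R n) (A B E F : set T).

Inductive descendant v : @node R n -> Prop :=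
| descendant_refl : descendant v v
| descendant_child u e : descendant v u -> descendant v (node_child u e).

Lemma descendant_gt0 v u : 0 < v.2 -> descendant v u -> 0 < u.2.
Proof. by move=> v0; elim=> //= {}u e _ u0; rewrite divr_gt0. Qed.

Lemma descendant_sub v u : 0 < v.2 -> descendant v u ->
  node_set u `<=` node_set v.
Proof.
move=> v0; elim=> // {}u e du IH x Hx; apply: IH.
by apply: node_child_sub Hx; exact: ltW (descendant_gt0 v0 du).
Qed.

(** A child of a node of negative side is empty as soon as there is a coordinate. This gives the
    inclusion for all nodes, as the tree section demands. *)
Lemma node_child_sub_dim v e : (0 < n)%N ->
  node_set (node_child v e) `<=` node_set v.
Proof.
move=> n0; have [s0|s0] := leP 0 v.2; first exact: node_child_sub.
by move=> x /(_ (Ordinal n0)) /andP[/= h1 h2]; exfalso; lra.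
Qed.

Lemma integral_node_fin v (g : T -> R) A : 0 <= v.2 ->
  measurable A -> measurable_fun setT g -> (forall x, 0 <= g x) ->
  (\int[mu]_(x in node_set v) (g x)%:E < +oo)%E ->
  (\int[mu]_(x in A `&` node_set v) (g x)%:E < +oo)%E.
Proof.
move=> v0 mA mg g0; have mv := measurable_hcube v.1 v.2; apply: le_lt_trans.
apply: (ge0_subset_integral mu (measurableI _ _ mA mv) mv _ _ (@subIsetr _ _ _)).
  by apply/measurable_EFinP; exact: (measurable_funTS mg).
by move=> x _; rewrite lee_fin.
Qed.

Lemma mass_sub v u (g : T -> R) A : node_set u `<=` node_set v ->
  mass v g (A `&` node_set u) = mass u g A.
Proof.
by move=> uv; rewrite /mass -setIA (setIidl uv).
Qed.

Lemma mass_split v u (g : T -> R) A : 0 <= u.2 -> 0 <= v.2 ->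
  node_set u `<=` node_set v ->
  measurable A -> measurable_fun setT g -> (forall x, 0 <= g x) ->
  (\int[mu]_(x in node_set v) (g x)%:E < +oo)%E ->
  mass v g (A `&` node_set u) =
  \sum_e mass v g (A `&` node_set (node_child u e)).
Proof.
move=> u0 v0 uv mA mg g0 gfin.
have sub e : node_set (node_child u e) `<=` node_set v.
  by move=> x Hx; apply: uv; exact: node_child_sub Hx.
under eq_bigr do rewrite mass_sub//.
have mg' : measurable_fun setT (EFin \o g) by exact/measurable_EFinP.
have g0' x : (0 <= (EFin \o g) x)%E by rewrite lee_fin.
rewrite mass_sub// /mass (ge0_integral_node u0 mA mg' g0').
rewrite sum_fine// => e _; rewrite ge0_fin_numE.
  rewrite -(setIidl (sub e)) setIA; apply: integral_node_fin => //.
  by apply: measurableI => //; exact: measurable_hcube.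
by apply: integral_ge0 => x _; rewrite lee_fin.
Qed.

Lemma mass1 v A : 0 <= v.2 -> measurable A ->
  mass v (cst 1) A = fine (mu (A `&` node_set v)).
Proof.
move=> v0 mA; rewrite /mass integral_cst1//.
by apply: measurableI => //; exact: measurable_hcube.
Qed.

(** [saturated_decay] sees only finite unions of nodes. [E] is replaced by such an [F], close to it
    for the mass of [1 + sigma] and hence for both masses; the factor [/ 2] in the size condition
    leaves room for the error. *)
Lemma node_decay (v : @node R n) (sigma : T -> R) (gamma S : R) :
  (0 < n)%N -> 0 <= gamma -> 0 < v.2 -> measurable_fun setT sigma ->
  (forall x, 0 <= sigma x) ->
  (\int[mu]_(x in node_set v) (sigma x)%:E = S%:E)%E ->
  (forall u E, descendant v u -> measurable E ->
    (mu (E `&` node_set u) <= (1 / 2)%:E * mu (node_set u))%E ->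
    (\int[mu]_(x in E `&` node_set u) (sigma x)%:E <=
     gamma%:E * \int[mu]_(x in node_set u) (sigma x)%:E)%E) ->
  forall k E, measurable E -> E `<=` node_set v ->
    (mu E <= ((1 / 2 / 2 ^+ n) ^+ k / 2 * v.2 ^+ n)%:E)%E ->
    (\int[mu]_(x in E) (sigma x)%:E <= (gamma ^+ k * S)%:E)%E.
Proof.
move=> n0 g0 v0 ms s0 sS HA k E mE Ev hE.
have v0' := ltW v0.
have m1 : measurable_fun setT (cst 1 : T -> R) by exact: measurable_cst.
have muv : mu (node_set v) = (v.2 ^+ n)%:E by exact: lebesgue_hcube.
have mv : measurable (node_set v) by exact: measurable_hcube.
have mvT u : measurable (node_set u) by exact: measurable_hcube.
have f1 : (\int[mu]_(x in node_set v) (cst 1 x)%:E < +oo)%E.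
  by rewrite integral_cst1// muv ltry.
have fs : (\int[mu]_(x in node_set v) (sigma x)%:E < +oo)%E.
  by rewrite sS ltry.
have fs1 : (\int[mu]_(x in node_set v) (1 + sigma x)%:E < +oo)%E.
  have c10 : forall x : T, 0 <= cst 1 x :> R by [].
  by rewrite (ge0_integralD_EFin mu mv m1 c10 ms s0) lte_add_pinfty.
have ms1 : measurable_fun setT (fun x => 1 + sigma x) by exact: measurable_funD.
have s10 x : 0 <= 1 + sigma x by rewrite addr_ge0.
pose m := mass v (cst 1); pose s := mass v sigma.
have mulsub u : descendant v u -> m (node_set u) = u.2 ^+ n.
  move=> du; rewrite /m mass1// setIidl; last exact: descendant_sub.
  by rewrite [X in fine X]lebesgue_hcube//; exact: ltW (descendant_gt0 v0 du).
have sE A : measurable A ->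
   (\int[mu]_(x in A `&` node_set v) (sigma x)%:E)%E = (s A)%:E.
  by move=> mA; rewrite massE.
have mE' A : measurable A -> mu (A `&` node_set v) = (m A)%:E.
  move=> mA; rewrite -massE//.
  by rewrite integral_cst1//; exact: measurableI.
have decay k' F j : measurable F -> saturated (@node_set R n) node_child j v F ->
    m (F `&` node_set v) <= (1 / 2 / 2 ^+ n) ^+ k' * m (node_set v) ->
    s (F `&` node_set v) <= gamma ^+ k' * s (node_set v).
  move=> mF sF hF.
  apply: (@saturated_decay R _ T (@node R n) {ffun 'I_n -> bool} (@node_set R n)
    node_child (descendant v) m s (2 ^+ n) (1 / 2) gamma) sF hF => //.
  - by move=> u e; exact: descendant_child.
  - by move=> u e; exact: node_child_sub_dim.
  - exact: node_child_disj.
  - by rewrite /m /mass set0I integral_set0.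
  - by rewrite /s /mass set0I integral_set0.
  - by move=> A; apply: mass_ge0.
  - move=> u A du mA; apply: mass_split => //.
      exact: ltW (descendant_gt0 v0 du).
    exact: descendant_sub.
  - move=> u A du mA; apply: mass_split => //.
      exact: ltW (descendant_gt0 v0 du).
    exact: descendant_sub.
  - move=> u e du; rewrite !mulsub//; last exact: descendant_child.
    by rewrite -exprMn /= mulrC divfK.
  - by rewrite -{1}(expr1 2) ler_weXn2l//; lra.
  - by lra.
  - by move=> u du; rewrite mulsub// exprn_gt0//; exact: descendant_gt0 du.
  - by move=> u A mA; apply: mass_le => //; [exact: measurableI|move=> x [[]]].
  - move=> u A du mA; have du' := descendant_sub v0 du.
    have [mAu mu'] : measurable (A `&` node_set u) /\ measurable (node_set u).
      by split => //; exact: measurableI.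
    have Auv : A `&` node_set u `<=` node_set v by move=> x [_ /du'].
    have mE2 B : measurable B -> B `<=` node_set v -> mu B = (m B)%:E.
      by move=> mB Bv; rewrite -mE'// setIidl.
    have sE2 B : measurable B -> B `<=` node_set v ->
        (\int[mu]_(x in B) (sigma x)%:E)%E = (s B)%:E.
      by move=> mB Bv; rewrite -sE// setIidl.
    have := HA u A du mA; rewrite (mE2 _ mAu Auv) (mE2 _ mu' du').
    by rewrite (sE2 _ mAu Auv) (sE2 _ mu' du') -!EFinM !lee_fin.
  - exact: descendant_refl.
have iE : E = E `&` node_set v by rewrite setIidl.
rewrite iE sE// lee_fin.
have Sv : s (node_set v) = S by rewrite /s /mass setIid sS.
have mvv : m (node_set v) = v.2 ^+ n by apply: mulsub; exact: descendant_refl.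
set a := (1 / 2 / 2 ^+ n) ^+ k in hE.
have a0 : 0 < a by rewrite exprn_gt0// divr_gt0// ?exprn_gt0//; lra.
have M0 : 0 < v.2 ^+ n by rewrite exprn_gt0.
apply/ler_addgt0Pr => e e0.
(* The first bound keeps the loss of [sigma]-mass at most [e], the second keeps the measure of [F]
   at most [a * v.2 ^+ n]. *)
pose e' := Num.min e (a / 2 * v.2 ^+ n).
have e'0 : 0 < e' by rewrite lt_min e0 mulr_gt0// divr_gt0.
have [_ /(_ _ e'0)[j [F [mF sF hF]]]] :=
  @approximable_measurable R n v _ v0' ms1 s10 fs1 E mE.
have mD : measurable ((E `\` F) `|` (F `\` E)).
  by apply: measurableU; exact: measurableD.
have mle (g h : T -> R) A : (forall x, 0 <= g x) -> (forall x, 0 <= h x) ->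
    measurable_fun setT g -> measurable_fun setT h ->
    (\int[mu]_(x in node_set v) (g x)%:E < +oo)%E ->
    (\int[mu]_(x in node_set v) (h x)%:E < +oo)%E -> measurable A ->
    (forall x, g x <= h x) -> mass v g A <= mass v h A.
  move=> gg0 h0 mg mh gfin hfin mA gh; rewrite -lee_fin -!massE//.
  by apply: ge0_le_integralW => x _; rewrite lee_fin.
have h1 : m ((E `\` F) `|` (F `\` E)) <= e'.
  by apply: le_trans hF; apply: mle => // x; rewrite /= ?lerDl.
have h2 : s ((E `\` F) `|` (F `\` E)) <= e'.
  by apply: le_trans hF; apply: mle => // x; rewrite lerDr.
have h3 : m (F `&` node_set v) <= a * m (node_set v).
  apply: (@le_trans _ _ (m E + m ((E `\` F) `|` (F `\` E)))).
    apply: mass_leU => //; first exact: measurableI.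
    move=> x [[Fx vx] _]; have [Ex|nE] := pselect (E x); [by left|].
    by right; right.
  have : m E <= a / 2 * v.2 ^+ n by rewrite -lee_fin -mE'// -iE.
  have : e' <= a / 2 * v.2 ^+ n by rewrite ge_min lexx orbT.
  by rewrite mvv; lra.
have h4 := decay k F j mF sF h3.
apply: (@le_trans _ _ (s (F `&` node_set v) + s ((E `\` F) `|` (F `\` E)))).
  apply: mass_leU => //; first exact: measurableI.
  move=> x [Ex vx]; have [Fx|nF] := pselect (F x); [by left|].
  by right; left.
apply: lerD; first by rewrite -Sv.
by apply: le_trans h2 _; rewrite ge_min lexx.
Qed.

Lemma node_reverse_holder (gamma : R) : (0 < n)%N -> 0 <= gamma < 1 ->
  exists delta, exists2 c, 0 < delta /\ 0 < c &
  forall (v : @node R n) (sigma : T -> R) (S : R),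
    0 < v.2 -> measurable_fun setT sigma -> (forall x, 0 <= sigma x) ->
    (\int[mu]_(x in node_set v) (sigma x)%:E = S%:E)%E -> 0 < S ->
    (forall u E, descendant v u -> measurable E ->
      (mu (E `&` node_set u) <= (1 / 2)%:E * mu (node_set u))%E ->
      (\int[mu]_(x in E `&` node_set u) (sigma x)%:E <=
       gamma%:E * \int[mu]_(x in node_set u) (sigma x)%:E)%E) ->
    (\int[mu]_(x in node_set v) (sigma x `^ (1 + delta))%:E
       <= (c * (S / v.2 ^+ n) `^ delta * S)%:E)%E.
Proof.
move=> n0 /andP[g0 g1].
have p2 : 1 <= 2 ^+ n :> R by rewrite exprn_ege1//; lra.
have a12 : 0 < (1 / 2 / 2 ^+ n : R) <= 1 / 2.
  apply/andP; split; first by rewrite !divr_gt0// exprn_gt0.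
  by rewrite ler_pdivrMr ?exprn_gt0//; lra.
have g01 : 0 <= gamma < 1 by rewrite g0.
have [delta [c dc H]] := reverse_holder a12 g01.
exists delta, c => // v sigma S v0 ms s0 sS S0 HA.
apply: H => //; first exact: measurable_hcube.
- exact: lebesgue_hcube (ltW v0).
- by rewrite exprn_gt0.
- by move=> k E; exact: (node_decay n0 g0 v0 ms s0 sS HA).
Qed.

End node_reverse_holder.

(** * Log-Hoelder exponents *)

Section powR_comparison.
Context {R : realType}.
Implicit Types t a b M : R.

Lemma powR_compare t a b M : 0 < t -> `|a - b| * `|ln t| <= M ->
  t `^ a <= expR M * t `^ b.
Proof.
move=> t0 h; rewrite !gt0_powRE// -expRD ler_expR.
suff : (a - b) * ln t <= M by lra.
by apply: le_trans h; rewrite -normrM ler_norm.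
Qed.

End powR_comparison.

Section exponents.
Context {R : realType} {n : nat}.
Local Notation T := (euclid R n).
Local Notation edist := Defs.edist.
Local Notation mu := (lebesgue R n).
Implicit Types (x y : T) (b : 'I_n -> R) (s : R).

Definition logmod x : R := ln (expR 1 + enorm x).

(** $(e+|x|)^{-(n+1)}$, written as an exponential so that its logarithm can be read off. *)
Definition decay x : R := expR (- n.+1%:R * logmod x).

Lemma expR1_gt2 : 2 < expR 1 :> R.
Proof. by have := @expR_gt1Dx R 1 (oner_neq0 _); lra. Qed.

Lemma logmod_ge1 x : 1 <= logmod x.
Proof.
rewrite /logmod -[leLHS]expRK ler_ln ?posrE ?expR_gt0//.
  by rewrite lerDl enorm_ge0.
by rewrite ltr_pwDl ?expR_gt0 ?enorm_ge0.
Qed.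

Lemma logmod_gt0 x : 0 < logmod x.
Proof. by have := logmod_ge1 x; lra. Qed.

Lemma decay_gt0 x : 0 < decay x. Proof. exact: expR_gt0. Qed.

Lemma decay_le1 x : decay x <= 1.
Proof.
rewrite -expR0 ler_expR mulNr oppr_le0 mulr_ge0//.
exact: ltW (logmod_gt0 x).
Qed.

Lemma ln_decay x : ln (decay x) = - n.+1%:R * logmod x.
Proof. by rewrite /decay expRK. Qed.

Lemma measurable_sqrt_fun d (U : measurableType d) (f : U -> R) :
  measurable_fun setT f -> (forall u, 0 <= f u) ->
  measurable_fun setT (fun u => Num.sqrt (f u)).
Proof.
move=> mf f0; under eq_fun do rewrite -powR12_sqrt//.
by apply: measurable_powR_fun => //; exact: measurable_cst.
Qed.

Lemma measurable_inv_fun d (U : measurableType d) (f : U -> R) :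
  measurable_fun setT f -> (forall u, 0 <= f u) ->
  measurable_fun setT (fun u => (f u)^-1).
Proof.
move=> mf f0; under eq_fun do rewrite -powR_inv1//.
by apply: measurable_powR_fun => //; exact: measurable_cst.
Qed.

Lemma measurable_enorm : measurable_fun [set: T] (@enorm R n).
Proof.
apply: measurable_sqrt_fun; last by move=> x; apply: sumr_ge0 => i _; exact: sqr_ge0.
apply: measurable_sum => i; apply: measurable_funX.
exact: measurable_coordinate.
Qed.

Lemma measurable_logmod : measurable_fun [set: T] logmod.
Proof.
apply: (measurableT_comp (@measurable_ln R)).
exact: (measurable_funD (measurable_cst _) measurable_enorm).
Qed.

Lemma measurable_decay : measurable_fun [set: T] decay.
Proof.
apply: (measurableT_comp (@measurable_expR R)).
exact: (measurable_funM (measurable_cst _) measurable_logmod).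
Qed.

(* Below the threshold eps * decay x the left-hand side is absorbed by the
   second term; above it, |ln t| is controlled by logmod x. *)
Lemma powR_compare_decay (D eps : R) : 0 <= D -> 0 < eps <= 1 ->
  exists2 C, 1 <= C & forall x (a b t : R),
    `|a - b| * logmod x <= D -> 1 <= a -> 0 <= t <= 1 ->
    t `^ a <= C * t `^ b + eps * decay x.
Proof.
move=> D0 /andP[e0 e1]; pose A := - ln eps.
have A0 : 0 <= A by rewrite oppr_ge0 ln_le0.
exists (expR (D * (n.+1%:R + A))); first by rewrite -expR0 ler_expR mulr_ge0 ?addr_ge0.
move=> x a b t hD a1 /andP[t0 t1].
have L1 := logmod_ge1 x.
have [->|tn0] := eqVneq t 0.
  rewrite powR0; last by apply/eqP; lra.
  by rewrite addr_ge0// mulr_ge0 ?expR_ge0 ?powR_ge0 ?(ltW e0).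
have t0' : 0 < t by rewrite lt_neqAle eq_sym tn0.
have [tle|tgt] := leP t (eps * decay x).
  apply: (@le_trans _ _ (eps * decay x)); last by rewrite lerDr mulr_ge0 ?expR_ge0 ?powR_ge0.
  by apply: le_trans tle; apply: ge1r_powR => //; rewrite t0' t1.
apply: (@le_trans _ _ (expR (D * (n.+1%:R + A)) * t `^ b)); last first.
  by rewrite lerDl mulr_ge0 ?expR_ge0 ?(ltW e0).
apply: powR_compare => //.
have lt : `|ln t| <= (n.+1%:R + A) * logmod x.
  rewrite ler0_norm ?ln_le0//.
  have : ln (eps * decay x) <= ln t.
    by rewrite ler_ln ?posrE ?mulr_gt0 ?decay_gt0 ?(ltW tgt).
  rewrite lnM ?posrE ?decay_gt0// ln_decay -/A => h.
  have : A <= A * logmod x by rewrite ler_peMr.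
  have AE : A = - ln eps by [].
  by rewrite mulNr in h; rewrite mulrDl; lra.
apply: le_trans (ler_wpM2l (normr_ge0 _) lt) _.
have -> : `|a - b| * ((n.+1%:R + A) * logmod x) =
  `|a - b| * logmod x * (n.+1%:R + A) by ring.
by rewrite ler_wpM2r// addr_ge0.
Qed.

(** [hcube_enorm] gives $|x|\le n(|y|+s)$, and $s\le2<e$, so $e+|x|\le(n+1)(e+|y|)$. *)
Lemma logmod_hcube b s x y : s <= 2 -> hcube b s x -> hcube b s y ->
  logmod x <= logmod y + ln n.+1%:R.
Proof.
move=> s2 Hx Hy.
have e0 : 0 < expR 1 + enorm y by rewrite ltr_pwDl ?expR_gt0 ?enorm_ge0.
have e0' : 0 < expR 1 + enorm x by rewrite ltr_pwDl ?expR_gt0 ?enorm_ge0.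
rewrite /logmod -lnM ?posrE// ler_ln ?posrE//; last by rewrite mulr_gt0.
have [n0|n0] := posnP n.
  have -> : x = y by apply: eq_from_tnth => j; have := ltn_ord j; rewrite [X in (_ < X)%N]n0.
  by rewrite ler_peMr ?(ltW e0)// ler1n.
have s0 : 0 <= s.
  by have /andP[h1 h2] := Hx (Ordinal n0); lra.
have h := hcube_enorm s0 Hx Hy.
have e2 := expR1_gt2; have ey := enorm_ge0 y.
apply: (@le_trans _ _ (expR 1 + n%:R * (enorm y + s))); first by lra.
have : n%:R * s <= n%:R * expR 1 by rewrite ler_wpM2l//; lra.
rewrite -natr1; have : 0 <= n%:R :> R by [].
by nra.
Qed.

Lemma decay_hcube b s x y : s <= 2 -> hcube b s x -> hcube b s y ->
  decay x <= n.+1%:R ^+ n.+1 * decay y.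
Proof.
move=> s2 Hx Hy; have := logmod_hcube s2 Hy Hx => h.
rewrite -[n.+1%:R in X in _ <= X * _]lnK ?posrE// -expRM_natl -expRD ler_expR.
by have : 0 <= n.+1%:R :> R by []; nra.
Qed.

(** Dyadic shells: off [B j] the integrand is at most $2^{-j(n+1)}$, while [B j.+1] has volume
    $4^n2^{jn}$, so the terms $4^n2^{-j}$ are summable. *)
Lemma integral_decay_fin : exists2 C : R, 0 < C &
  (\int[mu]_x (decay x)%:E <= C%:E)%E.
Proof.
pose B j := hcube (fun _ : 'I_n => - 2 ^+ j : R) (2 * 2 ^+ j).
have mB j : measurable (B j) by exact: measurable_hcube.
have p2 j : 0 < 2 ^+ j :> R by rewrite exprn_gt0.
have muB j : mu (B j) = ((2 * 2 ^+ j) ^+ n)%:E.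
  by rewrite [LHS]lebesgue_hcube// mulr_ge0 ?(ltW (p2 j)).
have notB j x : ~ B j x -> 2 ^+ j <= enorm x.
  move=> nB; rewrite leNgt; apply/negP => h; apply: nB => i.
  have := le_lt_trans (coordinate_le_enorm x i) h.
  by rewrite ltr_norml => /andP[h1 h2]; apply/andP; split; lra.
have exB x : exists j, x \in B j.
  have [j hj] := @exists_exprn_ge R 2 (enorm x + 1) ltac:(lra).
  exists j; apply/mem_set; apply: contrapT => /notB; move: hj; lra.
pose z : R := 2 ^- n.+1.
pose u j x : \bar R := ((z ^+ j) * \1_(B j.+1) x)%:E.
have z0 : 0 < z by rewrite invr_gt0.
have u0 j x : (0 <= u j x)%E.
  by rewrite lee_fin mulr_ge0 ?exprn_ge0 ?(ltW z0)// indicE.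
have mu_ j : measurable_fun setT (u j).
  apply/measurable_EFinP; apply: (measurable_funM (measurable_cst _)).
  exact: measurable_indic.
have pt x : ((decay x)%:E <= (\1_(B 0%N) x)%:E + \sum_(j <oo) u j x)%E.
  have ex := exB x; case: (ex_minnP ex) => -[|j] hj jmin.
    apply: (@le_trans _ _ 1%E); first by rewrite lee_fin decay_le1.
    by rewrite indicE hj leeDl// nneseries_ge0.
  apply: (@le_trans _ _ (u j x)); last first.
    apply: le_trans (nneseries_ge_term j (u0^~ x)) _.
    by rewrite leeDr// lee_fin indicE.
  rewrite /u indicE hj mulr1 lee_fin.
  have nB : ~ B j x by move=> /mem_set/jmin; rewrite ltnn.
  have h : ln (2 ^+ j) <= logmod x.
    rewrite ler_ln ?posrE//; last by rewrite ltr_pwDl ?expR_gt0 ?enorm_ge0.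
    by apply: le_trans (notB _ _ nB) _; rewrite lerDr expR_ge0.
  have -> : z ^+ j = expR (- n.+1%:R * ln (2 ^+ j)).
    rewrite mulNr expRN expRM_natl lnK ?posrE// /z exprVn -!exprM.
    by rewrite mulnC.
  by rewrite ler_expR; have : 0 <= n.+1%:R :> R by []; nra.
pose C := 2 ^+ n + 4 ^+ n * 2 : R.
exists C; first by rewrite addr_gt0 ?mulr_gt0 ?exprn_gt0.
apply: (@le_trans _ _ (\int[mu]_x ((\1_(B 0%N) x)%:E + \sum_(j <oo) u j x))%E).
  by apply: ge0_le_integralW => x _; rewrite ?lee_fin ?(ltW (decay_gt0 _)).
have m1 j : measurable_fun setT (fun x => (\1_(B j) x)%:E : \bar R).
  by apply/measurable_EFinP; exact: measurable_indic.
have mS : measurable_fun setT (fun x => \sum_(j <oo) u j x)%E.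
  by apply: ge0_emeasurable_sum => [k x _ _|k _]; [exact: u0|exact: mu_].
have i0 x : setT x -> (0 <= (\1_(B 0%N) x)%:E :> \bar R)%E.
  by rewrite lee_fin indicE.
have S0 x : setT x -> (0 <= \sum_(j <oo) u j x)%E.
  by move=> _; apply: nneseries_ge0 => k _ _; exact: u0.
rewrite (ge0_integralD mu measurableT i0 (m1 0%N) S0 mS).
rewrite integral_indic// setIT integral_nneseries//.
rewrite /C EFinD; apply: leeD; first by rewrite [leLHS]muB expr0 mulr1.
apply: nneseries_ub => [j|k]; first by apply: integral_ge0.
apply: (@le_trans _ _ (\sum_(0 <= i < k) (4 ^+ n * (1 / 2) ^+ i)%:E)%E).
  apply: lee_sum => i _; have mi : measurable_fun setT (\1_(B i.+1) : T -> R).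
    exact: measurable_indic.
  have i1 x : 0 <= \1_(B i.+1) x :> R by rewrite indicE.
  rewrite /u (ge0_integralZ_EFin mu measurableT mi i1 (exprn_ge0 i (ltW z0))).
  rewrite integral_indic// setIT [X in (_ * X)%E]muB -EFinM lee_fin.
  have -> : z ^+ i * (2 * 2 ^+ i.+1) ^+ n = 4 ^+ n * (1 / 2) ^+ i.
    have X0 : 2 ^+ i != 0 :> R by rewrite gt_eqF.
    have -> : z ^+ i = ((2 ^+ i) ^+ n.+1)^-1 by rewrite /z exprVn -!exprM mulnC.
    rewrite [2 ^+ i.+1]exprS mulrA exprMn div1r exprVn (_ : 2 * 2 = 4 :> R); last by ring.
    rewrite exprS; move: (2 ^+ i) X0 => X X0; move: (4 ^+ n) => Y.
    have Xn0 : X ^+ n != 0 by rewrite expf_neq0.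
    by move: (X ^+ n) Xn0 => Z Z0; field; rewrite X0 Z0.
  by [].
rewrite sumEFin lee_fin -mulr_sumr ler_wpM2l ?exprn_ge0//.
apply: le_trans (geometric_partial_le k _) _; first by lra.
by rewrite le_eqVlt; apply/orP; left; apply/eqP; field.
Qed.

(* Uniform version of log-Hoelder continuity, with the constants merged. *)
Definition exponent_class (lo hi D ainf : R) (q : T -> R) : Prop :=
  [/\ measurable_fun setT q, forall x, lo <= q x <= hi, lo <= ainf <= hi,
   forall b s x y, 0 < s <= 2 -> hcube b s x -> hcube b s y ->
     `|q x - q y| * (1 + `|ln s|) <= D &
   forall x, `|q x - ainf| * logmod x <= D].

Definition conjugate_exponent (a : R) : R := a / (a - 1).

Lemma conjugate_exponent_dist (lo a b : R) : 1 < lo -> lo <= a -> lo <= b ->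
  `|conjugate_exponent a - conjugate_exponent b| <= `|a - b| / (lo - 1) ^+ 2.
Proof.
move=> l1 la lb; have a1 : 0 < a - 1 by lra.
have b1 : 0 < b - 1 by lra.
have -> : conjugate_exponent a - conjugate_exponent b =
    - ((a - b) / ((a - 1) * (b - 1))).
  by rewrite /conjugate_exponent; field; rewrite !gt_eqF.
rewrite normrN normrM ler_wpM2l// ger0_norm ?invr_ge0 ?mulr_ge0 ?(ltW a1) ?(ltW b1)//.
have h1 : 0 < (a - 1) * (b - 1) by rewrite mulr_gt0.
have h2 : 0 < (lo - 1) ^+ 2 by rewrite exprn_gt0//; lra.
rewrite lef_pV2 ?posrE//.
by rewrite expr2 ler_pM//; lra.
Qed.

Lemma conjugate_exponent_itv (lo hi a : R) : 1 < lo -> lo <= a <= hi ->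
  conjugate_exponent hi <= conjugate_exponent a <= conjugate_exponent lo.
Proof.
move=> l1 /andP[la ah].
have E c : 1 < c -> conjugate_exponent c = 1 + (c - 1)^-1.
  by move=> c1; rewrite /conjugate_exponent; field; rewrite gt_eqF; lra.
rewrite !E; [|lra..]; rewrite !lerD2l !lef_pV2 ?posrE; lra.
Qed.

Lemma conjugate_exponent_gt1 (a : R) : 1 < a -> 1 < conjugate_exponent a.
Proof. by move=> a1; rewrite /conjugate_exponent ltr_pdivlMr; lra. Qed.

Lemma exponent_class_conjugate (lo hi D ainf : R) q : 1 < lo ->
  exponent_class lo hi D ainf q ->
  exponent_class (conjugate_exponent hi) (conjugate_exponent lo)
    (D / (lo - 1) ^+ 2) (conjugate_exponent ainf) (conjugate_exponent \o q).
Proof.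
move=> l1 [mq qb ab loc inf]; split.
- apply: (measurable_funM mq); apply: measurable_inv_fun.
    exact: (measurable_funB mq (measurable_cst _)).
  by move=> x; have := qb x => /andP[h _]; lra.
- by move=> x; apply: conjugate_exponent_itv.
- exact: conjugate_exponent_itv.
- move=> b s x y s02 Hx Hy.
  have /andP[qx _] := qb x; have /andP[qy _] := qb y.
  have := conjugate_exponent_dist l1 qx qy => h.
  rewrite ler_pdivlMr; last by rewrite exprn_gt0; lra.
  apply: le_trans (loc b s x y s02 Hx Hy); rewrite mulrAC ler_wpM2r//.
  by rewrite -ler_pdivlMr// exprn_gt0; lra.
- move=> x; have /andP[qx _] := qb x; have /andP[qy _] := ab.
  have := conjugate_exponent_dist l1 qx qy => h.
  rewrite ler_pdivlMr; last by rewrite exprn_gt0; lra.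
  apply: le_trans (inf x); rewrite mulrAC ler_wpM2r//.
    exact: ltW (logmod_gt0 x).
  by rewrite -ler_pdivlMr// exprn_gt0; lra.
Qed.

End exponents.

(** * Uniform constants from log-Hoelder continuity, and means of reciprocal exponents *)

Section log_hoelder.
Context {R : realType} {n : nat}.
Local Notation T := (euclid R n).
Local Notation edist := Defs.edist.
Local Notation mu := (lebesgue R n).
Implicit Types (x y : T) (b : 'I_n -> R) (s : R).
Hypothesis n0 : (0 < n)%N.

Lemma integral_cst_hcube b s (c : R) : 0 <= s ->
  (\int[mu]_(x in hcube b s) c%:E = (c * s ^+ n)%:E)%E.
Proof.
move=> s0; rewrite integral_cst; last exact: measurable_hcube.
by rewrite [X in (_ * X)%E]lebesgue_hcube.
Qed.

Lemma log_hoelder_local (C0 Cinf rinf : R) :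
  exists2 s0 : R, 0 < s0 <= expR (- 1) &
  forall r b s x y, log_hoelder C0 Cinf rinf r -> 0 < s <= s0 ->
    hcube b s x -> hcube b s y -> `|r x - r y| * - ln s <= 2 * `|C0|.
Proof.
pose N : R := n%:R.
have N1 : 1 <= N by rewrite ler1n.
(* In a cube of side [s] distances are at most [N * s]. The factor [4 * N ^+ 2] gives
   [N * s <= 1 / 4], inside the range of the local condition, and [s * N ^+ 2 <= 1], which says
   [ln (N * s) <= ln s / 2]. The factor [expR (- 1)] makes $1+|\ln s|\le2|\ln s|$ for later use. *)
pose s0 := (4 * N ^+ 2)^-1 * expR (- 1).
have N2 : 0 < 4 * N ^+ 2 by rewrite mulr_gt0// exprn_gt0//; lra.
have e0 : 0 < expR (- 1) :> R by exact: expR_gt0.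
have s00 : 0 < s0 by rewrite mulr_gt0// invr_gt0.
have N41 : 1 <= 4 * N ^+ 2 by rewrite expr2; nra.
exists s0.
  by rewrite s00/= /s0 ler_piMl ?(ltW e0)// invf_le1.
move=> r b s x y [hr _] /andP[s0' ss0] Hx Hy.
have e1 : expR (- 1) <= 1 :> R by rewrite -[leRHS]expR0 ler_expR; lra.
have hs : s * (4 * N ^+ 2) <= 1.
  apply: le_trans e1; rewrite -ler_pdivlMr// mulrC; exact: ss0.
have [->|/eqP xy] := eqVneq x y; first by rewrite subrr normr0 mul0r mulr_ge0.
have ed0 := edist_gt0 xy.
have ed1 := hcube_edist (ltW s0') Hx Hy.
have Ns : N * s <= 1 / 4.
  have : 0 <= s * N * (N - 1) by rewrite !mulr_ge0 ?(ltW s0')//; lra.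
  by rewrite expr2 in hs; lra.
have ed2 : edist x y < 2^-1 by apply: le_lt_trans ed1 _; rewrite -/N; lra.
have h1 := hr x y ed2.
have lns : ln s < 0 by rewrite ln_lt0// s0'; nra.
have lNs : ln (edist x y) <= ln s / 2.
  apply: (@le_trans _ _ (ln (N * s))).
    by rewrite ler_ln ?posrE ?mulr_gt0//; lra.
  rewrite lnM ?posrE//; last by lra.
  have : ln (s * N ^+ 2) <= 0.
    by apply: ln_le0; have : 0 <= s * N ^+ 2; [rewrite mulr_ge0 ?sqr_ge0 ?(ltW s0')|lra].
  rewrite lnM ?posrE ?exprn_gt0//; [|lra..].
  by rewrite lnXn; [rewrite mulr2n => h; lra|lra].
have l0 : 0 < - ln (edist x y) by lra.
apply: (@le_trans _ _ (`|C0| / - ln (edist x y) * - ln s)).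
  rewrite ler_wpM2r//; first by lra.
  by apply: le_trans h1 _; rewrite ler_wpM2r ?invr_ge0 ?(ltW l0)// ler_norm.
by rewrite mulrAC ler_pdivrMr//; have := normr_ge0 C0; nra.
Qed.

Lemma hcube_self x s : 0 < s -> hcube (coordinate x) s x.
Proof. by move=> s0 i; rewrite lexx/= ltrDl. Qed.

Lemma ae_hcube (P : T -> Prop) b s : (\forall x \ae mu, P x) -> 0 < s ->
  exists2 x, hcube b s x & P x.
Proof.
move=> [N [mN N0 sN]] s0; apply: contrapT => h.
have HN : hcube b s `<=` N.
  by move=> x Hx; apply: sN => /= Px; apply: h; exists x.
have : (mu (hcube b s) <= mu N)%E.
  by apply: le_measure; rewrite ?inE//; exact: measurable_hcube.
rewrite N0 [X in (X <= _)%E]lebesgue_hcube ?(ltW s0)// lee_fin.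
by rewrite leNgt exprn_gt0.
Qed.

(** Log-Hoelder continuity turns almost everywhere bounds into bounds at every point: each cube with
    corner [x], however small, contains a point where they hold. *)
Lemma log_hoelder_bounds (C0 Cinf rinf lo hi : R) r :
  log_hoelder C0 Cinf rinf r ->
  ess_inf mu (EFin \o r) = lo%:E -> ess_sup mu (EFin \o r) = hi%:E ->
  forall x, lo <= r x <= hi.
Proof.
move=> hr hlo hhi x.
have [s0 /andP[s00 _] Hs] := log_hoelder_local C0 Cinf rinf.
have near M : 0 < M -> exists2 y, lo <= r y <= hi & `|r x - r y| * M <= 2 * `|C0|.
  move=> M0; pose s := Num.min s0 (expR (- M)).
  have s_gt0 : 0 < s by rewrite lt_min s00 expR_gt0.
  have ae : \forall x \ae mu, (lo%:E <= (r x)%:E)%E /\ ((r x)%:E <= hi%:E)%E.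
    have /ess_infP A1 : (lo%:E <= ess_inf mu (EFin \o r))%E by rewrite hlo.
    have /ess_supP A2 : (ess_sup mu (EFin \o r) <= hi%:E)%E by rewrite hhi.
    exact: filterI A1 A2.
  have [y Hy [h1 h2]] := ae_hcube (coordinate x) ae s_gt0.
  exists y; first by rewrite -!lee_fin h1 h2.
  apply: le_trans (Hs r (coordinate x) s x y hr _ _ _) => //.
  - rewrite ler_wpM2l// lerNr -[leRHS]expRK ler_ln ?posrE ?expR_gt0//.
    by rewrite ge_min lexx orbT.
  - by rewrite s_gt0 ge_min lexx.
  - exact: hcube_self.
apply/andP; split; rewrite leNgt; apply/negP => hx.
- have d0 : 0 < lo - r x by lra.
  have M0 : 0 < (2 * `|C0| + 1) / (lo - r x) by rewrite divr_gt0// ltr_wpDl ?mulr_ge0.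
  have [y /andP[h1 h2]] := near _ M0; rewrite mulrA ler_pdivrMr// => h.
  have h3 : lo - r x <= `|r x - r y| by rewrite distrC; apply: le_trans (ler_norm _); lra.
  have := normr_ge0 C0; nra.
- have d0 : 0 < r x - hi by lra.
  have M0 : 0 < (2 * `|C0| + 1) / (r x - hi) by rewrite divr_gt0// ltr_wpDl ?mulr_ge0.
  have [y /andP[h1 h2]] := near _ M0; rewrite mulrA ler_pdivrMr// => h.
  have h3 : r x - hi <= `|r x - r y| by apply: le_trans (ler_norm _); lra.
  have := normr_ge0 C0; nra.
Qed.

(** [rinf] is the limit of [r] at infinity; [n0] provides a direction in which to go there. *)
Lemma log_hoelder_inf_bounds (C0 Cinf rinf lo hi : R) r :
  log_hoelder C0 Cinf rinf r -> (forall x, lo <= r x <= hi) -> lo <= rinf <= hi.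
Proof.
move=> [_ hr] hb.
have near M : exists2 x, `|r x - rinf| * logmod x <= `|Cinf| & M <= logmod x.
  pose x := @point R n (fun=> expR M); exists x.
    rewrite -ler_pdivlMr ?logmod_gt0//; apply: le_trans (hr x) _.
    by rewrite ler_wpM2r ?ler_norm// invr_ge0 ltW// logmod_gt0.
  rewrite -[leLHS]expRK ler_ln ?posrE ?expR_gt0//; last first.
    by rewrite ltr_pwDl ?expR_gt0 ?enorm_ge0.
  apply: (@le_trans _ _ (enorm x)); last by rewrite lerDr expR_ge0.
  apply: le_trans (coordinate_le_enorm x (Ordinal n0)).
  by rewrite coordinate_point ler_norm.
apply/andP; split; rewrite leNgt; apply/negP => hx.
- have d0 : 0 < lo - rinf by lra.
  have [x h] := near ((`|Cinf| + 1) / (lo - rinf)).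
  rewrite ler_pdivrMr// => h2; have /andP[h3 h4] := hb x.
  have h5 : lo - rinf <= `|r x - rinf| by apply: le_trans (ler_norm _); lra.
  have := logmod_gt0 x; nra.
- have d0 : 0 < rinf - hi by lra.
  have [x h] := near ((`|Cinf| + 1) / (rinf - hi)).
  rewrite ler_pdivrMr// => h2; have /andP[h3 h4] := hb x.
  have h5 : rinf - hi <= `|r x - rinf|.
    by rewrite distrC; apply: le_trans (ler_norm _); lra.
  have := logmod_gt0 x; nra.
Qed.

Lemma log_hoelder_class (C0 Cinf rinf lo hi : R) : exists D : R,
  forall r, is_exponent (EFin \o r) -> log_hoelder C0 Cinf rinf r ->
  ess_inf mu (EFin \o r) = lo%:E -> ess_sup mu (EFin \o r) = hi%:E ->
  exponent_class lo hi D rinf r.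
Proof.
have [s0 /andP[s00 s01] Hs] := log_hoelder_local C0 Cinf rinf.
(* Covers the sides between [s0] and 2, where $1+|\ln s|$ is at most $2+|\ln s_0|$ and the
   oscillation is at most [hi - lo]. *)
pose D1 := (hi - lo) * (2 + `|ln s0|).
exists (Num.max D1 (Num.max (4 * `|C0|) `|Cinf|)) => r [mr _] hr hlo hhi.
have hb := log_hoelder_bounds hr hlo hhi.
split => //; first exact/measurable_EFinP.
- exact: log_hoelder_inf_bounds hr hb.
- move=> b s x y /andP[s_gt0 s2] Hx Hy; rewrite !le_max.
  have [ss|ss] := leP s s0.
    apply/orP; right; apply/orP; left.
    have := Hs r b s x y hr _ Hx Hy; rewrite s_gt0 ss => /(_ isT) h.
    have l1 : ln s <= - 1.
      rewrite -[leRHS]expRK ler_ln ?posrE ?expR_gt0//; exact: le_trans ss s01.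
    rewrite [`|ln s|]ler0_norm; last by lra.
    by have := normr_ge0 (r x - r y); nra.
  apply/orP; left.
  have l1 : `|ln s| <= 1 + `|ln s0|.
    have h0 := normr_ge0 (ln s0).
    have h1 : ln s <= 1 by have := @le_ln1Dx R (s - 1) ltac:(lra); rewrite subrKC; lra.
    have h2 : ln s0 <= ln s by rewrite ler_ln ?posrE ?(ltW ss).
    have h3 : - ln s0 <= `|ln s0| by rewrite -normrN ler_norm.
    by rewrite ler_norml; apply/andP; split; lra.
  have h1 : `|r x - r y| <= hi - lo.
    have /andP[? ?] := hb x; have /andP[? ?] := hb y.
    by rewrite ler_norml; apply/andP; split; lra.
  by apply: ler_pM => //; lra.
- move=> x; rewrite !le_max; apply/orP; right; apply/orP; right.
  case: hr => _ /(_ x) h; rewrite -ler_pdivlMr ?logmod_gt0//.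
  apply: le_trans h _.
  by rewrite ler_wpM2r ?ler_norm// invr_ge0 ltW// logmod_gt0.
Qed.

Section recip_mean.
Variables (lo hi D ainf : R) (q : T -> R).
Hypotheses (lo1 : 1 < lo) (Hq : exponent_class lo hi D ainf q).

Let mq : measurable_fun setT q. Proof. by case: Hq. Qed.
Let qlo x : lo <= q x. Proof. by case: Hq => _ /(_ x)/andP[]. Qed.
Let q1 x : 1 < q x. Proof. exact: lt_le_trans (qlo x). Qed.
Let qhi x : q x <= hi. Proof. by case: Hq => _ /(_ x)/andP[]. Qed.
Let ainf1 : 1 < ainf.
Proof. by case: Hq => _ _ /andP[h _] _ _; exact: lt_le_trans h. Qed.

Lemma inv_dist (a b : R) : 1 < a -> 1 < b -> `|a^-1 - b^-1| <= `|a - b| :> R.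
Proof.
move=> a1 b1; have -> : a^-1 - b^-1 = - ((a - b) / (a * b)).
  by field; rewrite !gt_eqF; lra.
rewrite normrN normrM ler_piMr// ger0_norm; last by rewrite invr_ge0; nra.
by rewrite invf_le1; nra.
Qed.

(** Averages a pointwise majorant of $|1/q-c|\,l$. On small cubes [h] will be constant; on large
    ones it includes a multiple of [decay], of which only the integral is small. *)
Lemma recip_mean_dist (a : T) s (c l V : R) (h : T -> R) : 0 < s -> 0 <= c ->
  0 <= l -> measurable_fun setT h -> (forall x, 0 <= h x) ->
  (forall x, hcube (coordinate a) s x -> `|(q x)^-1 - c| * l <= h x) ->
  (\int[mu]_(x in hcube (coordinate a) s) (h x)%:E <= (V * s ^+ n)%:E)%E ->
  `|recip_mean (EFin \o q) (cube a s) - c| * l <= V.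
Proof.
move=> s0 c0 l0 mh h0 hh hV.
set H := hcube (coordinate a) s.
have mH : measurable H by exact: measurable_hcube.
have sn0 : 0 < s ^+ n by rewrite exprn_gt0.
have u0 x : 0 <= (q x)^-1 by rewrite invr_ge0; have := q1 x; lra.
have mu_ : measurable_fun setT (fun x => (q x)^-1).
  by apply: measurable_inv_fun => // x; have := q1 x; lra.
have uf : (\int[mu]_(x in H) ((q x)^-1)%:E <= (s ^+ n)%:E)%E.
  rewrite -[s ^+ n]mul1r -(integral_cst_hcube (coordinate a) 1 (ltW s0)).
  apply: ge0_le_integralW => x _.
    by rewrite lee_fin.
  by rewrite lee_fin invf_le1; have := q1 x; lra.
pose U := fine (\int[mu]_(x in H) ((q x)^-1)%:E)%E.
have UE : (\int[mu]_(x in H) ((q x)^-1)%:E = U%:E)%E.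
  rewrite fineK// ge0_fin_numE; first exact: le_lt_trans uf (ltry _).
  by apply: integral_ge0 => x _; rewrite lee_fin.
have -> : recip_mean (EFin \o q) (cube a s) = U / s ^+ n.
  rewrite /recip_mean /vol /Rintegral.
  rewrite [X in fine X](_ : _ = (s ^+ n)%:E); last exact: lebesgue_cube (ltW s0).
  rewrite mulrC; congr (_ / _); rewrite /U /H.
  rewrite -(@ge0_integral_cube R n a s (fun x => ((q x)^-1)%:E) (ltW s0)).
  - by congr fine; apply: eq_integral => x _ /=; rewrite inver gt_eqF//; have := q1 x; lra.
  - exact/measurable_EFinP.
  - by move=> x; rewrite lee_fin.
have I1 : (\int[mu]_(x in H) (l * (q x)^-1)%:E = (l * U)%:E)%E.
  by rewrite (ge0_integralZ_EFin mu mH mu_ u0 l0) UE.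
have I2 : (\int[mu]_(x in H) (l * c)%:E = (l * c * s ^+ n)%:E)%E.
  exact: integral_cst_hcube (ltW s0).
have mc : measurable_fun setT (fun _ : T => l * c) by exact: measurable_cst.
have lc0 (x : T) : 0 <= l * c by rewrite mulr_ge0.
have mlu : measurable_fun setT (fun x => l * (q x)^-1).
  exact: (measurable_funM (measurable_cst _) mu_).
have lu0 x : 0 <= l * (q x)^-1 by rewrite mulr_ge0.
have A1 : l * U <= l * c * s ^+ n + V * s ^+ n.
  rewrite -lee_fin -I1 EFinD -I2; apply: (@le_trans _ _
    (\int[mu]_(x in H) (l * c)%:E + \int[mu]_(x in H) (h x)%:E)%E); last first.
    by rewrite leeD2l.
  rewrite -(ge0_integralD_EFin mu mH mc lc0 mh h0).
  apply: ge0_le_integralW => x Hx; rewrite lee_fin//.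
  have := hh x Hx; have := ler_norm ((q x)^-1 - c); clear lc0; nra.
clear lc0 mc.
have lc0 : 0 <= l * c by rewrite mulr_ge0.
have A2 : l * c * s ^+ n <= l * U + V * s ^+ n.
  rewrite -lee_fin -I2 EFinD -I1; apply: (@le_trans _ _
    (\int[mu]_(x in H) (l * (q x)^-1)%:E + \int[mu]_(x in H) (h x)%:E)%E); last first.
    by rewrite leeD2l.
  rewrite -(ge0_integralD_EFin mu mH mlu lu0 mh h0).
  apply: ge0_le_integralW => x Hx; rewrite lee_fin//.
  have := hh x Hx; have := ler_norm (c - (q x)^-1); rewrite distrC; nra.
rewrite [X in `|X|](_ : _ = (U - c * s ^+ n) / s ^+ n); last first.
  by field; rewrite gt_eqF.
rewrite normrM [X in _ * X * _]ger0_norm ?invr_ge0 ?(ltW sn0)//.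
rewrite mulrAC ler_pdivrMr//.
have [hc|hc] := leP 0 (U - c * s ^+ n); [rewrite ger0_norm//|rewrite ltr0_norm//]; nra.
Qed.

Lemma recip_mean_local (a : T) s x : 0 < s <= 2 -> hcube (coordinate a) s x ->
  `|recip_mean (EFin \o q) (cube a s) - (q x)^-1| * `|ln s| <= D.
Proof.
move=> /andP[s0 s2] Hx.
have D0 : 0 <= D.
  case: Hq => _ _ _ _ /(_ x); apply: le_trans.
  by rewrite mulr_ge0// ltW// logmod_gt0.
apply: (@recip_mean_dist a s _ _ D (fun=> D)) => //.
- by rewrite invr_ge0; have := q1 x; lra.
- move=> y Hy; have := inv_dist (q1 y) (q1 x) => h.
  case: Hq => _ _ _ /(_ (coordinate a) s y x) + _.
  rewrite s0 s2 => /(_ isT Hy Hx); apply: le_trans.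
  by apply: ler_pM => //; rewrite lerDr.
- by rewrite integral_cst_hcube ?(ltW s0).
Qed.

(** Where [ln s <= 2 * (n + 1) * logmod x], the condition of [q] at infinity applies directly.
    Elsewhere [decay x] exceeds $s^{-1/2}$, so $s^n$ times [decay x] dominates [ln s / 2]; averaging
    over the cube cancels $s^n$ and leaves the integral of [decay]. *)
Lemma recip_mean_inf (C : R) (a : T) s :
  (\int[mu]_x (decay x)%:E <= C%:E)%E -> 1 <= s ->
  `|recip_mean (EFin \o q) (cube a s) - ainf^-1| * ln s <=
    D * (2 * n.+1%:R + 2 * C).
Proof.
move=> hC s1; have s0 : 0 < s by lra.
have ls0 : 0 <= ln s by rewrite ln_ge0.
have D0 : 0 <= D.
  case: Hq => _ _ _ _ /(_ a); apply: le_trans.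
  by rewrite mulr_ge0// ltW// logmod_gt0.
have C0 : 0 <= C.
  rewrite -lee_fin; apply: le_trans hC; apply: integral_ge0 => x _.
  by rewrite lee_fin ltW// decay_gt0.
have sn0 : 0 < s ^+ n by rewrite exprn_gt0.
pose m : R := n.+1%:R.
pose h1 (x : T) := 2 * m.
pose h2 x := 2 * s ^+ n * decay x.
have mh2 : measurable_fun setT h2.
  exact: (measurable_funM (measurable_cst _) measurable_decay).
have mh1 : measurable_fun setT h1 by exact: measurable_cst.
have h10 x : 0 <= h1 x by rewrite mulr_ge0.
have h20 x : 0 <= h2 x by rewrite !mulr_ge0 ?(ltW sn0) ?(ltW (decay_gt0 x)).
have mh : measurable_fun setT (fun x => h1 x + h2 x).
  exact: measurable_funD.
have mH : measurable (hcube (coordinate a) s) by exact: measurable_hcube.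
apply: (@recip_mean_dist a s _ _ _ (fun x => D * (h1 x + h2 x)) s0).
- by rewrite invr_ge0; have := ainf1; lra.
- exact: ls0.
- exact: (measurable_funM (measurable_cst _) mh).
- by move=> x; rewrite mulr_ge0// addr_ge0.
- move=> x Hx; have := inv_dist (q1 x) ainf1 => h.
  have L0 := logmod_gt0 x.
  have hL : ln s <= logmod x * (h1 x + h2 x).
    have L1 := logmod_ge1 x.
    have [hl|hl] := leP (ln s) (2 * m * logmod x).
      by have := h20 x; rewrite /h1; nra.
    have : ln s / 2 <= s ^+ n * decay x.
      rewrite -{2}(lnK (_ : s \is Num.pos)) ?posrE// -expRM_natl -expRD.
      apply: (@le_trans _ _ (expR (ln s / 2))).
        by have := expR_ge1Dx (ln s / 2); lra.
      rewrite ler_expR -/m; have n1 : 0 <= (n%:R - 1) * ln s.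
        by rewrite mulr_ge0// subr_ge0 ler1n.
      by lra.
    by have := h10 x; rewrite /h2; nra.
  apply: (@le_trans _ _ (`|q x - ainf| * ln s)); first exact: ler_wpM2r.
  apply: (@le_trans _ _ (`|q x - ainf| * (logmod x * (h1 x + h2 x)))).
    exact: ler_wpM2l.
  by rewrite mulrA ler_wpM2r ?addr_ge0//; case: Hq.
- have h0 x : 0 <= h1 x + h2 x by rewrite addr_ge0.
  rewrite (ge0_integralZ_EFin mu mH mh h0 D0).
  rewrite (ge0_integralD_EFin mu mH mh1 h10 mh2 h20).
  rewrite [leRHS](_ : _ = D%:E * ((2 * m + 2 * C) * s ^+ n)%:E)%E; last first.
    by rewrite -EFinM mulrA.
  apply: lee_wpmul2l; first by rewrite lee_fin.
  rewrite mulrDl EFinD; apply: leeD.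
    by rewrite (integral_cst_hcube _ _ (ltW s0)).
  have d0 x : 0 <= decay x by rewrite ltW// decay_gt0.
  rewrite (ge0_integralZ_EFin mu mH measurable_decay d0); last first.
    by rewrite mulr_ge0// ltW.
  apply: (@le_trans _ _ ((2 * s ^+ n)%:E * C%:E)%E); last first.
    by rewrite -EFinM lee_fin le_eqVlt; apply/orP; left; apply/eqP; ring.
  apply: lee_wpmul2l; first by rewrite lee_fin mulr_ge0// ltW.
  apply: le_trans hC.
  apply: (ge0_subset_integral mu mH measurableT _ _ (@subsetT _ _)).
    by apply/measurable_EFinP; exact: measurable_decay.
  by move=> x _; rewrite lee_fin.
Qed.

End recip_mean.

End log_hoelder.

(** * Scalar weights with variable exponent *)

Section weights.
Context {R : realType} {n : nat}.
Local Notation T := (euclid R n).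
Local Notation mu := (lebesgue R n).
Implicit Types (x y : T) (u v : @node R n) (q w : T -> R) (A B E : set T).

Definition wmod q w (N : R) x : R := (w x / N) `^ q x.

Lemma wmod_ge0 q w N x : 0 <= wmod q w N x. Proof. exact: powR_ge0. Qed.

Lemma measurable_wmod q w N : measurable_fun setT q -> measurable_fun setT w ->
  measurable_fun setT (wmod q w N).
Proof.
move=> mq mw.
exact: (measurable_powR_fun (measurable_funM mw (measurable_cst _)) mq).
Qed.

(* The last condition is the A_q condition in the form
   N |E| <= kappa |Q| ||w||_{L^q(E)} whenever N <= ||w||_{L^q(Q)}. *)
Definition weight_class (kappa : R) q w : Prop :=
  [/\ measurable_fun setT w, forall x, 0 < w x,
    forall b s, 0 < s -> (\int[mu]_(x in hcube b s) (wmod q w 1 x)%:E < +oo)%E &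
    forall b s E N m, 0 < s -> measurable E -> E `<=` hcube b s -> 0 < N ->
      (1 <= \int[mu]_(x in hcube b s) (wmod q w N x)%:E)%E ->
      0 < m -> (m%:E <= mu E)%E ->
      (1 <= \int[mu]_(x in E) (wmod q w (N * m / (kappa * s ^+ n)) x)%:E)%E].

Lemma integral_gt0 A (f : T -> R) : measurable A -> (0 < mu A)%E ->
  measurable_fun setT f -> (forall x, 0 < f x) ->
  (0 < \int[mu]_(x in A) (f x)%:E)%E.
Proof.
move=> mA A0 mf f0; rewrite lt0e; apply/andP; split; last first.
  by apply: integral_ge0 => x _; rewrite lee_fin ltW.
apply/eqP => I0.
have mf' : measurable_fun A (EFin \o f) by exact/measurable_funTS/measurable_EFinP.
have : (\int[mu]_(x in A) `|(EFin \o f) x| = 0)%E.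
  by rewrite -[RHS]I0; apply: eq_integral => x _; rewrite gee0_abs// lee_fin ltW.
move=> /(ae_eq_integral_abs mu mA mf')[N [mN N0 sN]].
have AN : A `<=` N.
  by move=> x Ax; apply: sN => /= /(_ Ax)/eqP; rewrite eqe gt_eqF.
have : (mu A <= mu N)%E by apply: le_measure; rewrite ?inE.
by rewrite N0 leNgt A0.
Qed.

Section fixed_weight.
Variables (lo hi : R) (q w : T -> R).
Hypotheses (lo1 : 1 < lo) (mq : measurable_fun setT q)
  (qb : forall x, lo <= q x <= hi)
  (mw : measurable_fun setT w) (w0 : forall x, 0 < w x).

Let qlo x : lo <= q x. Proof. by have /andP[] := qb x. Qed.
Let qhi x : q x <= hi. Proof. by have /andP[] := qb x. Qed.
Let q1 x : 1 < q x. Proof. exact: lt_le_trans (qlo x). Qed.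
Let hi1 : 1 <= hi. Proof.
pose x0 := @point R n (fun=> 0).
by have := qlo x0; have := qhi x0; have := lo1; lra.
Qed.

Lemma wmod_gt0 N x : 0 < N -> 0 < wmod q w N x.
Proof. by move=> N0; apply: powR_gt0; exact: divr_gt0. Qed.

Lemma wmod_scale_ub N c x : 0 < N -> 1 <= c ->
  wmod q w (N / c) x <= c `^ hi * wmod q w N x.
Proof.
move=> N0 c1; rewrite /wmod.
have -> : w x / (N / c) = c * (w x / N).
  by field; rewrite !gt_eqF//; lra.
by apply: powR_scale_le => //; rewrite divr_ge0// ltW.
Qed.

Lemma wmod_scale_lb N c x : 0 < N -> 1 <= c ->
  c * wmod q w N x <= wmod q w (N / c) x.
Proof.
move=> N0 c1; rewrite /wmod.
have -> : w x / (N / c) = c * (w x / N).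
  by field; rewrite !gt_eqF//; lra.
by apply: le1r_powRZ => //; [rewrite divr_ge0// ltW|exact: ltW (q1 x)].
Qed.

Lemma integral_wmod_ub N c A : measurable A -> 0 < N -> 1 <= c ->
  (\int[mu]_(x in A) (wmod q w (N / c) x)%:E <=
   (c `^ hi)%:E * \int[mu]_(x in A) (wmod q w N x)%:E)%E.
Proof.
move=> mA N0 c1.
rewrite -(ge0_integralZ_EFin mu mA (measurable_wmod N mq mw) (wmod_ge0 q w N)
  (powR_ge0 _ _)).
apply: ge0_le_integralW => x _; rewrite lee_fin; first exact: wmod_ge0.
exact: wmod_scale_ub.
Qed.

Lemma integral_wmod_lb N c A : measurable A -> 0 < N -> 1 <= c ->
  (c%:E * \int[mu]_(x in A) (wmod q w N x)%:E <=
   \int[mu]_(x in A) (wmod q w (N / c) x)%:E)%E.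
Proof.
move=> mA N0 c1.
have c0 : 0 <= c by lra.
rewrite -(ge0_integralZ_EFin mu mA (measurable_wmod N mq mw) (wmod_ge0 q w N) c0).
apply: ge0_le_integralW => x _; rewrite lee_fin.
  by rewrite mulr_ge0// wmod_ge0.
exact: wmod_scale_lb.
Qed.

Lemma le_integral_wmod N A B : measurable A -> measurable B -> A `<=` B ->
  (\int[mu]_(x in A) (wmod q w N x)%:E <= \int[mu]_(x in B) (wmod q w N x)%:E)%E.
Proof.
move=> mA mB AB; apply: (ge0_subset_integral mu mA mB _ _ AB).
  apply/measurable_funTS/measurable_EFinP; exact: measurable_wmod.
by move=> x _; rewrite lee_fin wmod_ge0.
Qed.

(** In place of an infimum, a norm of a scalar weight is a value at which the modular equals 1, and
    this is the monotonicity of norms in that form. If [N > N'], scaling makes the modular at [N']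
    on [A] at least [N / N' > 1]. *)
Lemma unit_norm_le A B N N' : measurable A -> measurable B -> A `<=` B ->
  0 < N -> 0 < N' ->
  (1 <= \int[mu]_(x in A) (wmod q w N x)%:E)%E ->
  (\int[mu]_(x in B) (wmod q w N' x)%:E <= 1)%E -> N <= N'.
Proof.
move=> mA mB AB N0 N'0 hA hB; rewrite leNgt; apply/negP => NN'.
have c1 : 1 < N / N' by rewrite ltr_pdivlMr// mul1r.
have := integral_wmod_lb mA N0 (ltW c1).
have -> : N / (N / N') = N' by field; rewrite !gt_eqF.
move=> h; have := le_trans h (le_trans (le_integral_wmod N' mA mB AB) hB).
apply/negP; rewrite -ltNge; apply: (@lt_le_trans _ _ (N / N')%:E).
  by rewrite lte_fin.
rewrite -[leLHS]mule1; apply: lee_wpmul2l; last exact: hA.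
by rewrite lee_fin ltW// divr_gt0.
Qed.

Lemma unit_norm_exists b s : 0 < s ->
  (\int[mu]_(x in hcube b s) (wmod q w 1 x)%:E < +oo)%E ->
  exists2 N, 0 < N & (\int[mu]_(x in hcube b s) (wmod q w N x)%:E = 1)%E.
Proof.
move=> s0 fin1; have mH : measurable (hcube b s) by exact: measurable_hcube.
have I0 N : (0 <= \int[mu]_(x in hcube b s) (wmod q w N x)%:E)%E.
  by apply: integral_ge0 => x _; rewrite lee_fin wmod_ge0.
have finN N : 0 < N -> (\int[mu]_(x in hcube b s) (wmod q w N x)%:E < +oo)%E.
  move=> N0; have [N1|N1] := leP N 1.
    have c1 : 1 <= N^-1 by rewrite invf_ge1.
    have := integral_wmod_ub mH ltr01 c1; rewrite invrK mul1r => h.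
    apply: le_lt_trans h _; rewrite lte_mul_pinfty// ?lee_fin ?powR_ge0//.
  have := integral_wmod_lb mH N0 (ltW N1); have -> : N / N = 1 by rewrite divff// gt_eqF.
  move=> h; apply: le_lt_trans fin1; apply: le_trans h.
  rewrite -[leLHS]mul1e; apply: lee_wpmul2r => //.
  by rewrite lee_fin ltW.
pose J N := fine (\int[mu]_(x in hcube b s) (wmod q w N x)%:E)%E.
have JE N : 0 < N -> (\int[mu]_(x in hcube b s) (wmod q w N x)%:E = (J N)%:E)%E.
  by move=> N0; rewrite fineK// ge0_fin_numE ?finN.
have muH : (0 < mu (hcube b s))%E.
  by rewrite lebesgue_hcube ?(ltW s0)// lte_fin exprn_gt0.
have [N N0 JN] : exists2 N, 0 < N & J N = 1.
  apply: (@unit_scale R J hi hi1) => [N N0||N c N0 c1|N c N0 c1].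
  - exact: fine_ge0.
  - rewrite -lte_fin -(JE _ ltr01).
    apply: (integral_gt0 mH muH (measurable_wmod _ mq mw)) => x.
    by apply: wmod_gt0.
  - have Nc : 0 < N / c by rewrite divr_gt0//; lra.
    by rewrite -lee_fin EFinM -(JE _ Nc) -(JE _ N0); exact: (integral_wmod_ub mH N0 c1).
  - have Nc : 0 < N / c by rewrite divr_gt0//; lra.
    by rewrite -lee_fin EFinM -(JE _ Nc) -(JE _ N0); exact: (integral_wmod_lb mH N0 c1).
by exists N => //; rewrite JE// JN.
Qed.

End fixed_weight.
End weights.

(** * Cells of a fixed depth below a node *)

Section cells.
Context {R : realType} {n : nat}.
Local Notation T := (euclid R n).
Local Notation mu := (lebesgue R n).
Implicit Types (x y : T) (u v : @node R n) (q w : T -> R) (A B E : set T).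

Fixpoint at_depth (J : nat) v u : Prop :=
  match J with
  | 0 => u = v
  | J'.+1 => exists e, at_depth J' (node_child v e) u
  end.

Lemma at_depth_side J v u : at_depth J v u -> u.2 = v.2 / 2 ^+ J.
Proof.
elim: J v => [|J IH] v /=; first by move=> ->; rewrite expr0 divr1.
by move=> [e /IH ->] /=; rewrite exprS invfM mulrA.
Qed.

Lemma at_depth_sub J v u : 0 <= v.2 -> at_depth J v u -> node_set u `<=` node_set v.
Proof.
elim: J v => [|J IH] v v0 /=; first by move=> ->.
move=> [e] /IH h; have v20 : 0 <= (node_child v e).2 by rewrite /= divr_ge0.
by move=> x /(h v20); exact: node_child_sub.
Qed.

Lemma at_depth_trans J K v u t : at_depth J v u -> at_depth K u t ->
  at_depth (J + K) v t.
Proof.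
by elim: J v => [|J IH] v /= => [->//|[e h] h']; exists e; exact: IH h h'.
Qed.

Lemma at_depth_split J K v t : at_depth (J + K) v t ->
  exists2 u, at_depth J v u & at_depth K u t.
Proof.
elim: J v => [|J IH] v /=; first by exists v.
by move=> [e /IH[u h1 h2]]; exists u => //; exists e.
Qed.

Lemma descendant_at_depth v u : descendant v u -> exists J, at_depth J v u.
Proof.
elim=> [|{}u e _ [J IH]]; first by exists 0%N.
by exists (J + 1)%N; apply: at_depth_trans IH _; exists e.
Qed.

Lemma tree_le (A B : @node R n -> \bar R) J v : 0 <= v.2 ->
  (forall u, (0 <= u.2)%R -> A u <= \sum_e A (node_child u e))%E ->
  (forall u, (0 <= u.2)%R -> \sum_e B (node_child u e) <= B u)%E ->
  (forall u, at_depth J v u -> A u <= B u)%E -> (A v <= B v)%E.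
Proof.
move=> v0 hA hB; elim: J v v0 => [|J IH] v v0 H; first exact: H.
apply: le_trans (hA v v0) _; apply: le_trans (hB v v0).
apply: lee_sum => e _; apply: IH; first by rewrite /= divr_ge0.
by move=> u hu; apply: H; exists e.
Qed.

Lemma tree_le_integral (f g : T -> R) J v : 0 <= v.2 ->
  measurable_fun setT f -> (forall x, 0 <= f x) ->
  measurable_fun setT g -> (forall x, 0 <= g x) ->
  (forall u, at_depth J v u ->
    \int[mu]_(x in node_set u) (f x)%:E <= \int[mu]_(x in node_set u) (g x)%:E)%E ->
  (\int[mu]_(x in node_set v) (f x)%:E <= \int[mu]_(x in node_set v) (g x)%:E)%E.
Proof.
move=> v0 mf f0 mg g0.
have add (h : T -> R) : measurable_fun setT h -> (forall x, 0 <= h x) ->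
    forall u, 0 <= u.2 -> (\int[mu]_(x in node_set u) (h x)%:E =
      \sum_e \int[mu]_(x in node_set (node_child u e)) (h x)%:E)%E.
  move=> mh h0 u u0.
  have mh' : measurable_fun setT (EFin \o h) by exact/measurable_EFinP.
  have h0' x : (0 <= (EFin \o h) x)%E by rewrite lee_fin.
  have := ge0_integral_node u0 (@measurableT _ T) mh' h0'.
  by rewrite setTI => ->; apply: eq_bigr => e _; rewrite setTI.
apply: (@tree_le (fun u => \int[mu]_(x in node_set u) (f x)%:E)%E
  (fun u => \int[mu]_(x in node_set u) (g x)%:E)%E) => // u u0.
  by rewrite (add f).
by rewrite (add g).
Qed.

(* The function that equals F u on every node u of depth J below v. *)
Fixpoint cellsum (F : @node R n -> T -> R) (J : nat) v x : R :=
  match J with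
  | 0 => \1_(node_set v) x * F v x
  | J'.+1 => \sum_e cellsum F J' (node_child v e) x
  end.

Lemma measurable_cellsum F J v : (forall u, measurable_fun setT (F u)) ->
  measurable_fun setT (cellsum F J v).
Proof.
move=> mF; elim: J v => [|J IH] v /=.
  apply: (measurable_funM _ (mF v)).
  by apply: measurable_indic; exact: measurable_hcube.
by apply: measurable_sum => e; exact: IH.
Qed.

Lemma cellsum_ge0 F J v x : (forall u x, 0 <= F u x) -> 0 <= cellsum F J v x.
Proof.
move=> F0; elim: J v => [|J IH] v /=; first by rewrite mulr_ge0// indicE.
by apply: sumr_ge0.
Qed.

Lemma cellsum_out F J v x : 0 <= v.2 -> ~ node_set v x -> cellsum F J v x = 0.
Proof.
elim: J v => [|J IH] v v0 /= nvx.
  by rewrite indicE memNset// mul0r.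
rewrite big1// => e _; apply: IH; first by rewrite /= divr_ge0.
by move=> h; apply: nvx; exact: node_child_sub h.
Qed.

Lemma cellsumE F J v u x : 0 <= v.2 -> at_depth J v u -> node_set u x ->
  cellsum F J v x = F u x.
Proof.
elim: J v => [|J IH] v v0 /=.
  by move=> -> vx; rewrite indicE mem_set// mul1r.
have v20 e : 0 <= (node_child v e).2 by rewrite /= divr_ge0.
move=> [e he] ux; rewrite (bigD1 e)//= (IH _ (v20 e) he ux) big1 ?addr0//.
move=> e' ee'; apply: cellsum_out; first exact: v20.
move=> h; have h' : node_set (node_child v e) x by exact: at_depth_sub he _ ux.
have : (node_set (node_child v e') `&` node_set (node_child v e)) x by [].
by rewrite node_child_disj.
Qed.

End cells.

(** * Densities and their A_infinity property *)

Section A_infinity.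
Context {R : realType} {n : nat}.
Local Notation T := (euclid R n).
Local Notation mu := (lebesgue R n).
Implicit Types (x y : T) (u v : @node R n) (q w : T -> R) (A B E : set T).

Lemma at_depth_cover J v x : node_set v x ->
  exists2 u, at_depth J v u & node_set u x.
Proof.
elim: J v => [|J IH] v vx; first by exists v.
have [e ex] := node_child_cover vx; have [u h1 h2] := IH _ ex.
by exists u => //; exists e.
Qed.

Lemma cellsum_sub F J K v u x : 0 <= v.2 -> at_depth J v u -> node_set u x ->
  cellsum F (J + K) v x = cellsum F K u x.
Proof.
move=> v0 hu ux; have [t h1 h2] := at_depth_cover K ux.
have u0 : 0 <= u.2 by rewrite (at_depth_side hu) divr_ge0 ?exprn_ge0.
rewrite (cellsumE F v0 (at_depth_trans hu h1) h2).
by rewrite (cellsumE F u0 h1 h2).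
Qed.

Lemma node_set_corner v : 0 < v.2 -> node_set v (point v.1).
Proof. by move=> v0 i; rewrite coordinate_point lexx/= ltrDl. Qed.

Lemma measurable_node v : measurable (node_set v).
Proof. exact: measurable_hcube. Qed.

Definition is_norm q w (Nrm : @node R n -> R) := forall u, 0 < u.2 ->
  0 < Nrm u /\ (\int[mu]_(x in node_set u) (wmod q w (Nrm u) x)%:E = 1)%E.

(* Above unit scale this replaces w^q: on the cells of depth J the weight is
   normalized by its variable-exponent norm, and the total mass of a cell u is
   Nrm u to the constant power qinf. *)
Definition density q w (qinf : R) (Nrm : @node R n -> R) :=
  cellsum (fun u x => Nrm u `^ qinf * wmod q w (Nrm u) x).

Section constants.
Variables (lo hi D qinf kappa : R).
Hypotheses (n0 : (0 < n)%N) (lo1 : 1 < lo) (kappa1 : 1 <= kappa).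

Section fixed.
Variables (q w : T -> R).
Hypotheses (Hq : exponent_class lo hi D qinf q) (Hw : weight_class kappa q w).

Let mq : measurable_fun setT q. Proof. by case: Hq. Qed.
Let qb x : lo <= q x <= hi. Proof. by case: Hq. Qed.
Let qinf1 : 1 <= qinf.
Proof. by have l1 := lo1; case: Hq => _ _ /andP[h _] _ _; lra. Qed.
Let mw : measurable_fun setT w. Proof. by case: Hw. Qed.
Let w0 x : 0 < w x. Proof. by case: Hw. Qed.
Let mwm N : measurable_fun setT (wmod q w N).
Proof. exact: measurable_wmod. Qed.

Let c1 := ((2 * kappa) `^ hi)^-1.

Let c1_gt0 : 0 < c1.
Proof. by have k1 := kappa1; rewrite invr_gt0 powR_gt0//; lra. Qed.

(** On a set of half the measure the $A_q$ condition lowers the norm by a factor of at most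
    [2 * kappa], hence the modular by at most its power [hi], which is [c1^-1]. *)
Lemma weight_half v N E : 0 < v.2 -> 0 < N ->
  (1 <= \int[mu]_(x in node_set v) (wmod q w N x)%:E)%E ->
  measurable E -> E `<=` node_set v ->
  ((v.2 ^+ n / 2)%:E <= mu E)%E ->
  (c1%:E <= \int[mu]_(x in E) (wmod q w N x)%:E)%E.
Proof.
move=> v0 N0 hN mE Ev hE; have k1 := kappa1.
case: Hw => _ _ _ HA.
have vn0 : 0 < v.2 ^+ n by rewrite exprn_gt0.
have m0 : 0 < v.2 ^+ n / 2 by rewrite divr_gt0.
have := HA v.1 v.2 E N _ v0 mE Ev N0 hN m0 hE.
have -> : N * (v.2 ^+ n / 2) / (kappa * v.2 ^+ n) = N / (2 * kappa).
  by field; rewrite !gt_eqF//; lra.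
move=> h; have k2 : 1 <= 2 * kappa by lra.
have := le_trans h (integral_wmod_ub mq qb mw w0 mE N0 k2).
have kp : 0 < (2 * kappa) `^ hi by rewrite powR_gt0//; lra.
by rewrite -(lee_pdivrMl _ _ kp) mule1.
Qed.

(** The ratio [NP / N] is at most 1, and the $A_q$ condition with [E] the smaller node bounds it
    below by [v.2 ^+ n / (kappa * r.2 ^+ n)]. Its logarithm is thus of order $1+|\ln v.2|$, exactly
    what the oscillation of [q] on [v] compensates. *)
Lemma small_compare (r v : @node R n) N NP : 0 < r.2 <= 2 -> 0 < v.2 <= r.2 ->
  node_set v `<=` node_set r -> 0 < N -> 0 < NP ->
  (\int[mu]_(x in node_set r) (wmod q w N x)%:E = 1)%E ->
  (\int[mu]_(x in node_set v) (wmod q w NP x)%:E = 1)%E ->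
  forall x y, node_set v x -> node_set v y ->
    (NP / N) `^ q x <= expR (D * (ln kappa + n%:R)) * (NP / N) `^ q y.
Proof.
move=> /andP[r0 r2] /andP[v0 vr] sub N0 NP0 hN hNP x y vx vy.
have k1 := kappa1.
have rn0 : 0 < r.2 ^+ n by rewrite exprn_gt0.
have vn0 : 0 < v.2 ^+ n by rewrite exprn_gt0.
have t0 : 0 < NP / N by rewrite divr_gt0.
have NPN : NP <= N.
  apply: (unit_norm_le lo1 mq qb mw w0 (measurable_node v) (measurable_node r)
    sub NP0 N0); first by rewrite hNP.
  by rewrite hN.
have lb : N * v.2 ^+ n / (kappa * r.2 ^+ n) <= NP.
  apply: (unit_norm_le lo1 mq qb mw w0 (measurable_node v) (measurable_node v)
    (@subset_refl _ _) _ NP0); last by rewrite hNP.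
    by rewrite divr_gt0 ?mulr_gt0//; lra.
  case: Hw => _ _ _ HA; apply: (HA r.1 r.2) => //.
  - exact: measurable_node.
  - by rewrite -/(node_set r) hN.
  - by rewrite lebesgue_hcube// ltW.
have lk : 0 <= ln kappa by rewrite ln_ge0.
apply: powR_compare => //.
have lnt : `|ln (NP / N)| <= (ln kappa + n%:R) * (1 + `|ln v.2|).
  rewrite ler0_norm; last by apply: ln_le0; rewrite ler_pdivrMr// mul1r.
  have h : ln (v.2 ^+ n / (kappa * r.2 ^+ n)) <= ln (NP / N).
    rewrite ler_ln ?posrE ?divr_gt0 ?mulr_gt0//; last by lra.
    by rewrite ler_pdivlMr// mulrC mulrA.
  move: h; rewrite lnM ?posrE ?invr_gt0 ?mulr_gt0//; last by lra.
  rewrite lnV ?posrE ?mulr_gt0//; last by lra.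
  rewrite lnM ?posrE//; last by lra.
  rewrite !lnXn// -[ln v.2 *+ n]mulr_natl -[ln r.2 *+ n]mulr_natl => h.
  have h1 : ln r.2 <= 1 by have := @le_ln1Dx R (r.2 - 1) ltac:(lra); rewrite subrKC; lra.
  have h2 : - ln v.2 <= `|ln v.2| by rewrite -normrN ler_norm.
  have h3 : n%:R * ln r.2 <= n%:R by rewrite ler_piMr.
  have h4 : n%:R * - ln v.2 <= n%:R * `|ln v.2| by rewrite ler_wpM2l.
  have h5 : 0 <= ln kappa * `|ln v.2| by rewrite mulr_ge0.
  by lra.
case: Hq => _ _ _ /(_ v.1 v.2 x y) + _.
rewrite v0 (le_trans vr r2) => /(_ isT vx vy) h.
apply: le_trans (ler_wpM2l (normr_ge0 _) lnt) _.
rewrite mulrCA mulrC ler_wpM2r// addr_ge0//.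
Qed.

Lemma wmod_change N NP x : 0 < N -> 0 < NP ->
  wmod q w N x = (NP / N) `^ q x * wmod q w NP x.
Proof.
move=> N0 NP0; rewrite /wmod -powRM; last 2 first.
- by rewrite divr_ge0// ltW.
- by rewrite divr_ge0// ltW.
by congr (_ `^ _); field; rewrite !gt_eqF.
Qed.

Let e2 := expR (D * (ln kappa + n%:R)).

(** By [wmod_change] and [small_compare], on [v] the modular density at scale [N] is, up to [e2], a
    constant times the one at the norm [NP] of [v] itself. For the latter [weight_half] applies;
    [e2] is lost twice, once for the upper and once for the lower bound. *)
Lemma small_A_infinity (r v : @node R n) N E : 0 < r.2 <= 2 -> 0 < v.2 <= r.2 ->
  node_set v `<=` node_set r -> 0 < N ->
  (\int[mu]_(x in node_set r) (wmod q w N x)%:E = 1)%E ->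
  measurable E -> E `<=` node_set v -> ((v.2 ^+ n / 2)%:E <= mu E)%E ->
  ((c1 / e2 ^+ 2)%:E * \int[mu]_(x in node_set v) (wmod q w N x)%:E <=
   \int[mu]_(x in E) (wmod q w N x)%:E)%E.
Proof.
move=> r02 vr sub N0 hN mE Ev hE.
have /andP[v0 _] := vr.
have [NP NP0 hNP] := unit_norm_exists lo1 mq qb mw w0 v0
  (let: And4 _ _ h _ := Hw in h v.1 v.2 v0).
rewrite -/(node_set v) in hNP.
have comp := small_compare r02 vr sub N0 NP0 hN hNP.
set x0 := @point R n v.1; have vx0 : node_set v x0 by exact: node_set_corner.
set tau := (NP / N) `^ q x0.
have t0 : 0 < tau by rewrite powR_gt0// divr_gt0.
have e20 : 0 < e2 by exact: expR_gt0.
have ub : (\int[mu]_(x in node_set v) (wmod q w N x)%:E <= (e2 * tau)%:E)%E.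
  rewrite -[leRHS]mule1 -hNP.
  rewrite -(ge0_integralZ_EFin mu (measurable_node v) (mwm NP) (wmod_ge0 q w NP)
    (mulr_ge0 (ltW e20) (ltW t0))).
  apply: ge0_le_integralW => x vx; rewrite lee_fin; first exact: wmod_ge0.
  by rewrite (wmod_change x N0 NP0) ler_wpM2r ?wmod_ge0 ?comp.
have lb : ((tau / e2 * c1)%:E <= \int[mu]_(x in E) (wmod q w N x)%:E)%E.
  have half := weight_half v0 NP0 _ mE Ev hE.
  apply: (@le_trans _ _ ((tau / e2)%:E *
     \int[mu]_(x in E) (wmod q w NP x)%:E)%E).
    rewrite EFinM lee_wpmul2l ?half ?hNP//.
    by rewrite lee_fin divr_ge0// ltW.
  have te0 : 0 <= tau / e2 by rewrite divr_ge0// ltW.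
  rewrite -(ge0_integralZ_EFin mu mE (mwm NP) (wmod_ge0 q w NP) te0).
  apply: ge0_le_integralW => x Ex; rewrite lee_fin.
    by rewrite mulr_ge0 ?wmod_ge0.
  rewrite (wmod_change x N0 NP0) ler_wpM2r ?wmod_ge0//.
  by rewrite ler_pdivrMr// mulrC; apply: comp => //; exact: Ev.
apply: le_trans lb; apply: (@le_trans _ _ ((c1 / e2 ^+ 2)%:E * (e2 * tau)%:E)%E).
  apply: lee_wpmul2l => //; rewrite lee_fin divr_ge0 ?exprn_ge0 ?(ltW e20)//.
  exact: ltW c1_gt0.
rewrite -EFinM lee_fin le_eqVlt; apply/orP; left; apply/eqP.
by field; rewrite gt_eqF.
Qed.

Variables (C2 C3 eps Ceps : R).
Let M := n.+1%:R ^+ n.+1 : R.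
Hypotheses (intdecay : (\int[mu]_x (decay x)%:E <= C2%:E)%E)
  (cmp1 : forall x a b (t : R), `|a - b| * logmod x <= D -> 1 <= a -> 0 <= t <= 1 ->
    t `^ a <= C3 * t `^ b + 1 * decay x)
  (cmpe : forall x a b (t : R), `|a - b| * logmod x <= D -> 1 <= a -> 0 <= t <= 1 ->
    t `^ a <= Ceps * t `^ b + eps * decay x)
  (epsE : eps * (M ^+ 2 * C2) <= c1 / 2) (eps0 : 0 <= eps) (C31 : 1 <= C3)
  (Ceps1 : 1 <= Ceps).

Variables (Nrm : @node R n -> R) (v : @node R n) (J : nat) (NP : R).
Hypotheses (HNrm : is_norm q w Nrm) (v0 : 0 < v.2)
  (side : 1 <= v.2 / 2 ^+ J <= 2) (NP0 : 0 < NP)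
  (hNP : (\int[mu]_(x in node_set v) (wmod q w NP x)%:E = 1)%E).

Let g := cellsum (fun u x => wmod q w (Nrm u) x) J v.
Let sg := density q w qinf Nrm J v.

Let mg : measurable_fun setT g.
Proof. by apply: measurable_cellsum => u; exact: mwm. Qed.

Let g0 x : 0 <= g x.
Proof. by apply: cellsum_ge0 => u y; exact: wmod_ge0. Qed.

Lemma measurable_density : measurable_fun setT sg.
Proof.
by apply: measurable_cellsum => u; exact: (measurable_funM (measurable_cst _) (mwm _)).
Qed.

Lemma density_ge0 x : 0 <= sg x.
Proof. by apply: cellsum_ge0 => u y; rewrite mulr_ge0 ?powR_ge0 ?wmod_ge0. Qed.

Let mgd : measurable_fun setT (fun x => decay x * g x).
Proof. exact: (measurable_funM measurable_decay mg). Qed.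

Let decay0 x : 0 <= decay x. Proof. exact: ltW (decay_gt0 x). Qed.

Let gd0 x : 0 <= decay x * g x. Proof. by rewrite mulr_ge0. Qed.

Let gE u x : at_depth J v u -> node_set u x -> g x = wmod q w (Nrm u) x.
Proof. by move=> hu ux; rewrite /g (cellsumE _ (ltW v0) hu ux). Qed.

Let M0 : 0 < M. Proof. by rewrite exprn_gt0. Qed.

(** On each cell [g] has integral 1 and [decay] varies at most by the factor [M]. One [M] pulls
    [decay] out of the integral against [g], the other puts it back under an integral over the cell,
    whose volume is at least 1. *)
Lemma integral_decay_cell : (\int[mu]_(x in node_set v) (decay x * g x)%:E
  <= (M ^+ 2 * C2)%:E)%E.
Proof.
have mM : measurable_fun setT (fun x : T => M ^+ 2 * decay x).
  exact: (measurable_funM (measurable_cst _) measurable_decay).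
have M20 : 0 <= M ^+ 2 by exact: sqr_ge0.
apply: (@le_trans _ _ (\int[mu]_(x in node_set v) (M ^+ 2 * decay x)%:E)%E).
  apply: (tree_le_integral (J := J) (ltW v0) mgd gd0 mM) => [x|u hu].
    by rewrite mulr_ge0.
  have us : u.2 = v.2 / 2 ^+ J by exact: at_depth_side hu.
  have /andP[u1 u2] : 1 <= u.2 <= 2 by rewrite us.
  have u0 : 0 < u.2 by lra.
  have [Nu0 hNu] := HNrm u0.
  set x0 := @point R n u.1; have ux0 : node_set u x0 by exact: node_set_corner.
  apply: (@le_trans _ _ (M * decay x0)%:E).
    rewrite -[leRHS]mule1 -hNu.
    rewrite -(ge0_integralZ_EFin mu (measurable_node u) (mwm _) (wmod_ge0 q w _)
      (mulr_ge0 (ltW M0) (decay0 x0))).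
    apply: ge0_le_integralW => x ux; rewrite lee_fin; first exact: gd0.
    by rewrite (gE hu ux) ler_wpM2r ?wmod_ge0// (decay_hcube u2 ux ux0).
  rewrite (ge0_integralZ_EFin mu (measurable_node u) measurable_decay decay0 M20).
  rewrite expr2 !EFinM -muleA; apply: lee_wpmul2l.
    by rewrite lee_fin (ltW M0).
  rewrite -(ge0_integralZ_EFin mu (measurable_node u) measurable_decay decay0 (ltW M0)).
  apply: (@le_trans _ _ (\int[mu]_(x in node_set u) (decay x0)%:E)%E).
    rewrite (integral_cst_hcube u.1 _ (ltW u0)) lee_fin ler_peMr//.
    exact: exprn_ege1.
  apply: ge0_le_integralW => x ux; rewrite lee_fin//.
  exact: (decay_hcube u2 ux0 ux).
rewrite (ge0_integralZ_EFin mu (measurable_node v) measurable_decay decay0 M20).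
rewrite [(M ^+ 2 * C2)%:E]EFinM; apply: lee_wpmul2l; first by rewrite lee_fin.
apply: le_trans intdecay; apply: (ge0_subset_integral mu (measurable_node v)
  measurableT _ _ (@subsetT _ _)).
- by apply/measurable_EFinP; exact: measurable_decay.
- by move=> x _; rewrite lee_fin.
Qed.

Let k := (NP `^ qinf)^-1.
Let k0 : 0 < k. Proof. by rewrite invr_gt0 powR_gt0. Qed.

(** With [t] the ratio of the norms of the cell and of [v], the normalized density and the weight
    differ only in the exponent, [qinf] against [q x], of a number between 0 and 1. This is the
    situation of [powR_compare_decay]. *)
Let pointwise x : node_set v x -> exists t : R,
  [/\ 0 <= t <= 1, k * sg x = t `^ qinf * g x & wmod q w NP x = t `^ q x * g x].
Proof.
move=> vx; have [u hu ux] := at_depth_cover J vx.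
have us : u.2 = v.2 / 2 ^+ J by exact: at_depth_side hu.
have /andP[s1 s2] := side.
have u0 : 0 < u.2 by rewrite us; lra.
have [Nu0 hNu] := HNrm u0.
have NuNP : Nrm u <= NP.
  apply: (unit_norm_le lo1 mq qb mw w0 (measurable_node u) (measurable_node v)
    (at_depth_sub (ltW v0) hu) Nu0 NP0); first by rewrite hNu.
  by rewrite hNP.
exists (Nrm u / NP); split.
- by rewrite divr_ge0 ?(ltW Nu0) ?(ltW NP0)//= ler_pdivrMr// mul1r.
- rewrite /sg /density (cellsumE _ (ltW v0) hu ux) (gE hu ux).
  rewrite mulrA; congr (_ * _).
  rewrite (powRM _ (ltW Nu0)) ?invr_ge0 ?(ltW NP0)// powR_inv//.
  by rewrite mulrC.
- by rewrite (gE hu ux) (wmod_change x NP0 Nu0).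
Qed.

Let qinf_dist x : `|q x - qinf| * logmod x <= D.
Proof. by case: Hq. Qed.

Let qinf_dist' x : `|qinf - q x| * logmod x <= D.
Proof. by rewrite distrC; case: Hq. Qed.

Let mksg : measurable_fun setT (fun x => k * sg x).
Proof. exact: (measurable_funM (measurable_cst _) measurable_density). Qed.

Let ksg0 x : 0 <= k * sg x.
Proof. by rewrite mulr_ge0 ?density_ge0 ?(ltW k0). Qed.

Lemma density_ub : (k%:E * \int[mu]_(x in node_set v) (sg x)%:E <=
  (C3 + M ^+ 2 * C2)%:E)%E.
Proof.
have c30 : 0 <= C3 by have := C31; lra.
rewrite -(ge0_integralZ_EFin mu (measurable_node v) measurable_density
  density_ge0 (ltW k0)).
have m3 : measurable_fun setT (fun x => C3 * wmod q w NP x).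
  exact: (measurable_funM (measurable_cst _) (mwm _)).
have p3 x : 0 <= C3 * wmod q w NP x by rewrite mulr_ge0 ?wmod_ge0.
apply: (@le_trans _ _ (\int[mu]_(x in node_set v)
    (C3 * wmod q w NP x + decay x * g x)%:E)%E).
  apply: ge0_le_integralW => x vx; rewrite lee_fin; first exact: ksg0.
  have [t [t01 -> ->]] := pointwise vx.
  have := cmp1 (qinf_dist' x) qinf1 t01; rewrite mul1r => h.
  by rewrite mulrA -mulrDl ler_wpM2r.
rewrite (ge0_integralD_EFin mu (measurable_node v) m3 p3 mgd gd0) EFinD.
apply: leeD; last exact: integral_decay_cell.
rewrite (ge0_integralZ_EFin mu (measurable_node v) (mwm _) (wmod_ge0 q w _) c30).
by rewrite hNP mule1.
Qed.

(** [weight_half] gives [E] the mass [c1]; by [epsE] the additive error takes at most half of it,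
    and the rest must come from the density. *)
Lemma density_lb E : measurable E -> E `<=` node_set v ->
  ((v.2 ^+ n / 2)%:E <= mu E)%E ->
  ((c1 / 2 / Ceps)%:E <= k%:E * \int[mu]_(x in E) (sg x)%:E)%E.
Proof.
move=> mE Ev hE.
have ce0 : 0 < Ceps by have := Ceps1; lra.
have half := weight_half v0 NP0 _ mE Ev hE.
rewrite -(ge0_integralZ_EFin mu mE measurable_density density_ge0 (ltW k0)).
have m3 : measurable_fun setT (fun x => Ceps * (k * sg x)).
  exact: (measurable_funM (measurable_cst _) mksg).
have p3 x : 0 <= Ceps * (k * sg x) by rewrite mulr_ge0 ?ksg0 ?(ltW ce0).
have m4 : measurable_fun setT (fun x => eps * (decay x * g x)).
  exact: (measurable_funM (measurable_cst _) mgd).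
have p4 x : 0 <= eps * (decay x * g x) by rewrite mulr_ge0.
have h1 : (c1%:E <= \int[mu]_(x in E) (Ceps * (k * sg x))%:E +
    \int[mu]_(x in E) (eps * (decay x * g x))%:E)%E.
  apply: le_trans (half _) _; first by rewrite hNP.
  rewrite -(ge0_integralD_EFin mu mE m3 p3 m4 p4).
  apply: ge0_le_integralW => x Ex; rewrite lee_fin; first exact: wmod_ge0.
  have [t [t01 -> ->]] := pointwise (Ev x Ex).
  have qx1 : 1 <= q x by have := qb x; have := lo1; lra.
  have h := cmpe (qinf_dist x) qx1 t01.
  by rewrite !mulrA -mulrDl ler_wpM2r.
have h2 : (\int[mu]_(x in E) (eps * (decay x * g x))%:E <= (c1 / 2)%:E)%E.
  rewrite (ge0_integralZ_EFin mu mE mgd gd0 eps0).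
  apply: (@le_trans _ _ (eps%:E * (M ^+ 2 * C2)%:E)%E).
    apply: lee_wpmul2l; first by rewrite lee_fin.
    apply: le_trans integral_decay_cell.
    apply: (ge0_subset_integral mu mE (measurable_node v) _ _ Ev).
      by apply/measurable_funTS/measurable_EFinP; exact: mgd.
    by move=> x _; rewrite lee_fin.
  by rewrite -EFinM lee_fin.
move: h1; rewrite (ge0_integralZ_EFin mu mE mksg ksg0 (ltW ce0)).
set I := (\int[mu]_(x in E) (k * sg x)%:E)%E => h1.
have h3 := le_trans h1 (leeD (lexx (Ceps%:E * I)%E) h2).
have : ((c1 / 2)%:E <= Ceps%:E * I)%E.
  have -> : c1 / 2 = c1 - c1 / 2 by field.
  by rewrite EFinB leeBlDr.
by rewrite -lee_pdivrMl// -EFinM mulrC.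
Qed.

End fixed.
End constants.
End A_infinity.

(** * Reverse Hoelder inequality for the density, uniformly in the scale *)

Section density_reverse_holder.
Context {R : realType} {n : nat}.
Local Notation T := (euclid R n).
Local Notation mu := (lebesgue R n).
Implicit Types (x y : T) (u v : @node R n) (q w : T -> R) (A B E : set T).

Variables (lo hi D qinf kappa : R).
Hypotheses (n0 : (0 < n)%N) (lo1 : 1 < lo) (kappa1 : 1 <= kappa) (D0 : 0 <= D).

Lemma big_density : exists beta, exists2 C1, 0 < beta /\ 0 < C1 &
  forall q w (Nrm : @node R n -> R) v J,
    exponent_class lo hi D qinf q -> weight_class kappa q w ->
    is_norm q w Nrm -> 0 < v.2 -> 1 <= v.2 / 2 ^+ J <= 2 ->
    (\int[mu]_(x in node_set v) (density q w qinf Nrm J v x)%:E <=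
      (C1 * Nrm v `^ qinf)%:E)%E /\
    forall E, measurable E -> E `<=` node_set v -> ((v.2 ^+ n / 2)%:E <= mu E)%E ->
      (beta%:E * \int[mu]_(x in node_set v) (density q w qinf Nrm J v x)%:E <=
       \int[mu]_(x in E) (density q w qinf Nrm J v x)%:E)%E.
Proof.
have [C2 C20 hC2] := @integral_decay_fin R n.
have k1 := kappa1.
pose c1 := ((2 * kappa) `^ hi)^-1.
have c10 : 0 < c1 by rewrite invr_gt0 powR_gt0//; lra.
pose M : R := n.+1%:R ^+ n.+1.
have M0 : 0 < M by rewrite exprn_gt0.
have MC : 0 < M ^+ 2 * C2 by rewrite mulr_gt0// exprn_gt0.
(* The decay error over a node, whatever its size, is at most [eps * (M ^+ 2 * C2)]; this choice
   keeps it at most half of [c1]. *)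
pose eps := Num.min 1 (c1 / 2 / (M ^+ 2 * C2)).
have eps0 : 0 < eps by rewrite lt_min ltr01 !divr_gt0.
have eps01 : 0 < eps <= 1 by rewrite eps0 ge_min lexx.
have epsE : eps * (M ^+ 2 * C2) <= c1 / 2.
  by rewrite -ler_pdivlMr// ge_min lexx orbT.
have [C3 C31 cmp1] := @powR_compare_decay R n D 1 D0 ltac:(by rewrite ltr01 lexx).
have [Ce Ce1 cmpe] := @powR_compare_decay R n D eps D0 eps01.
have ce0 : 0 < Ce by lra.
pose C1 := C3 + M ^+ 2 * C2.
have C10 : 0 < C1 by rewrite /C1; lra.
exists (c1 / 2 / Ce / C1), C1; first by rewrite !divr_gt0.
move=> q w Nrm v J Hq Hw HN v0 side.
have [NP0 hNP] := HN v v0.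
set sg := density q w qinf Nrm J v.
pose k := (Nrm v `^ qinf)^-1.
have k0 : 0 < k by rewrite invr_gt0 powR_gt0.
have ub : (k%:E * \int[mu]_(x in node_set v) (sg x)%:E <= C1%:E)%E.
  exact: (density_ub lo1 Hq Hw hC2 cmp1 C31 HN v0 side NP0 hNP).
have ub' : (\int[mu]_(x in node_set v) (sg x)%:E <= (C1 * Nrm v `^ qinf)%:E)%E.
  by move: ub; rewrite -lee_pdivlMl// /k invrK -EFinM mulrC.
split; first exact: ub'.
move=> E mE Ev hE.
have lb : ((c1 / 2 / Ce)%:E <= k%:E * \int[mu]_(x in E) (sg x)%:E)%E.
  exact: (density_lb lo1 kappa1 Hq Hw hC2 cmpe epsE (ltW eps0) Ce1 HN v0
    side NP0 hNP mE Ev hE).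
have kE : k^-1 = Nrm v `^ qinf by rewrite /k invrK.
move: lb; rewrite -lee_pdivrMl// -EFinM => lb; apply: le_trans lb.
apply: le_trans (lee_wpmul2l _ ub') _.
  by rewrite lee_fin !divr_ge0// ltW.
rewrite -EFinM lee_fin kE le_eqVlt; apply/orP; left; apply/eqP.
by field; rewrite !gt_eqF.
Qed.

Lemma density_cell q w Nrm J v u x : 0 <= v.2 -> at_depth J v u -> node_set u x ->
  density q w qinf Nrm J v x = Nrm u `^ qinf * wmod q w (Nrm u) x.
Proof. by move=> v0 hu ux; rewrite /density (cellsumE _ v0 hu ux). Qed.

Lemma eq_integral_set A (f g : T -> R) : (forall x, A x -> f x = g x) ->
  (\int[mu]_(x in A) (f x)%:E = \int[mu]_(x in A) (g x)%:E)%E.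
Proof. by move=> fg; apply: eq_integral => x /set_mem/fg ->. Qed.

(** A descendant of depth at least [J] lies in one cell, where the density is a multiple of the
    modular density and [small_A_infinity] applies. A shallower one is a union of cells, on which
    the density is its own density at depth [J - j], the case of [big_density]. A small [v] takes
    [J = 0], where only the first case occurs. *)
Lemma density_A_infinity : exists2 beta, 0 < beta <= 1 &
  forall q w (Nrm : @node R n -> R) v J,
    exponent_class lo hi D qinf q -> weight_class kappa q w ->
    is_norm q w Nrm -> 0 < v.2 -> v.2 / 2 ^+ J <= 2 ->
    J = 0%N \/ 1 <= v.2 / 2 ^+ J ->
    forall u E, descendant v u ->
      measurable E -> E `<=` node_set u -> ((u.2 ^+ n / 2)%:E <= mu E)%E ->
      (beta%:E * \int[mu]_(x in node_set u) (density q w qinf Nrm J v x)%:E <=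
       \int[mu]_(x in E) (density q w qinf Nrm J v x)%:E)%E.
Proof.
have [b2 [C1 [b20 _] Hbig]] := big_density.
have k1 := kappa1.
pose b1 := ((2 * kappa) `^ hi)^-1 / expR (D * (ln kappa + n%:R)) ^+ 2.
have b10 : 0 < b1.
  by rewrite divr_gt0 ?exprn_gt0 ?expR_gt0// invr_gt0 powR_gt0//; lra.
exists (Num.min 1 (Num.min b1 b2)); first by rewrite !lt_min ltr01 b10 b20 ge_min lexx.
move=> q w Nrm v J Hq Hw HN v0 side2 side1 u E du mE Eu hE.
have mq : measurable_fun setT q by case: Hq.
have mw : measurable_fun setT w by case: Hw.
have u0 := descendant_gt0 v0 du.
have v0' := ltW v0.
have I0 A : (0 <= \int[mu]_(x in A) (density q w qinf Nrm J v x)%:E)%E.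
  apply: integral_ge0 => x _; rewrite lee_fin; apply: cellsum_ge0 => t y.
  by rewrite mulr_ge0 ?powR_ge0 ?wmod_ge0.
have [j hj] := descendant_at_depth du.
have [Jj|jJ] := leqP J j.
- apply: (@le_trans _ _ (b1%:E *
    \int[mu]_(x in node_set u) (density q w qinf Nrm J v x)%:E)%E).
    by apply: lee_wpmul2r => //; rewrite lee_fin !ge_min lexx orbT.
  have [r hr hu] : exists2 r, at_depth J v r & at_depth (j - J) r u.
    by apply: at_depth_split; rewrite subnKC.
  have rs := at_depth_side hr; have us := at_depth_side hu.
  have r0 : 0 < r.2 by rewrite rs divr_gt0 ?exprn_gt0.
  have [Nr0 hNr] := HN r r0.
  have ur := at_depth_sub (ltW r0) hu.
  have dE x : node_set u x -> density q w qinf Nrm J v x =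
      Nrm r `^ qinf * wmod q w (Nrm r) x.
    by move=> /ur; exact: density_cell.
  rewrite (eq_integral_set dE) (@eq_integral_set E _ _ (fun x Ex => dE x (Eu x Ex))).
  rewrite !(ge0_integralZ_EFin mu _ (measurable_wmod (Nrm r) mq mw)
    (wmod_ge0 q w (Nrm r)) (powR_ge0 _ _))//; last exact: measurable_node.
  rewrite muleCA; apply: lee_wpmul2l; first by rewrite lee_fin powR_ge0.
  apply: (small_A_infinity lo1 kappa1 Hq Hw _ _ ur Nr0 hNr mE Eu hE).
    by rewrite r0 rs.
  rewrite u0 us ler_pdivrMr ?exprn_gt0// ler_peMr ?(ltW r0)//.
  by rewrite exprn_ege1//; lra.
- apply: (@le_trans _ _ (b2%:E *
    \int[mu]_(x in node_set u) (density q w qinf Nrm J v x)%:E)%E).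
    by apply: lee_wpmul2r => //; rewrite lee_fin !ge_min lexx !orbT.
  pose K := (J - j)%N.
  have JE : J = (j + K)%N by rewrite /K subnKC// ltnW.
  have dE x : node_set u x -> density q w qinf Nrm J v x = density q w qinf Nrm K u x.
    by move=> ux; rewrite /density JE; apply: cellsum_sub.
  rewrite (eq_integral_set dE) (@eq_integral_set E _ _ (fun x Ex => dE x (Eu x Ex))).
  have us : u.2 / 2 ^+ K = v.2 / 2 ^+ J.
    by rewrite (at_depth_side hj) JE exprD invfM mulrA.
  have side : 1 <= u.2 / 2 ^+ K <= 2.
    by rewrite us side2 andbT; case: side1 => // J0; rewrite J0 in jJ.
  by have [_] := Hbig q w Nrm u K Hq Hw HN u0 side; apply.
Qed.

Lemma density_reverse_holder : exists delta, exists2 c, 0 < delta /\ 0 < c &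
  forall q w (Nrm : @node R n -> R) v J S,
    exponent_class lo hi D qinf q -> weight_class kappa q w ->
    is_norm q w Nrm -> 0 < v.2 -> v.2 / 2 ^+ J <= 2 ->
    J = 0%N \/ 1 <= v.2 / 2 ^+ J -> 0 < S ->
    (\int[mu]_(x in node_set v) (density q w qinf Nrm J v x)%:E = S%:E)%E ->
    (\int[mu]_(x in node_set v) (density q w qinf Nrm J v x `^ (1 + delta))%:E <=
      (c * (S / v.2 ^+ n) `^ delta * S)%:E)%E.
Proof.
have [beta /andP[b0 b1] HA] := density_A_infinity.
(* If [E] fills at most half of a node, the complement fills at least half and keeps the fraction
   [beta] of the mass, so [E] has at most [1 - beta] of it. *)
have g01 : 0 <= 1 - beta < 1 by apply/andP; split; lra.
have [delta [c dc H]] := @node_reverse_holder R n _ n0 g01.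
exists delta, c => // q w Nrm v J S Hq Hw HN v0 side2 side1 S0 hS.
have mq : measurable_fun setT q by case: Hq.
have mw : measurable_fun setT w by case: Hw.
pose sg := density q w qinf Nrm J v.
have msg : measurable_fun setT sg.
  apply: measurable_cellsum => u.
  exact: (measurable_funM (measurable_cst _) (measurable_wmod _ mq mw)).
have sg0 x : 0 <= sg x.
  by apply: cellsum_ge0 => u y; rewrite mulr_ge0 ?powR_ge0 ?wmod_ge0.
apply: (H v sg S v0 msg sg0 hS S0) => u E du mE hE.
have u0 := descendant_gt0 v0 du.
have mu_ := measurable_node u.
have mEu : measurable (E `&` node_set u) by exact: measurableI.
have mD : measurable (node_set u `\` E) by exact: measurableD.
have muu : mu (node_set u) = (u.2 ^+ n)%:E by exact: lebesgue_hcube (ltW u0).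
have uE : node_set u = (E `&` node_set u) `|` (node_set u `\` E).
  apply/seteqP; split => [x ux|x [[]//|[]//]].
  by have [Ex|nE] := pselect (E x); [left|right].
have hD : ((u.2 ^+ n / 2)%:E <= mu (node_set u `\` E))%E.
  have : mu (node_set u) = (mu (E `&` node_set u) + mu (node_set u `\` E))%E.
    rewrite -[LHS]integral_cst1// -[X in (X + _)%E]integral_cst1//.
    rewrite -[X in (_ + X)%E]integral_cst1//.
    rewrite -(@ge0_integralU_EFin _ _ _ mu _ _ (fun=> 1))//.
    - by rewrite -uE.
    - by rewrite -subset0 => x [[Ex _] [_ nEx]].
  move: hE; rewrite muu => hE muE.
  have := leeD hE (lexx (mu (node_set u `\` E))).
  rewrite -muE -EFinM => h.
  have : ((u.2 ^+ n)%:E - (1 / 2 * u.2 ^+ n)%:E <= mu (node_set u `\` E))%E.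
    by rewrite leeBlDl.
  by apply: le_trans; rewrite -EFinB lee_fin; lra.
have sub : node_set u `\` E `<=` node_set u by move=> x [].
have := HA q w Nrm v J Hq Hw HN v0 side2 side1 u _ du mD sub hD.
rewrite -/sg.
have split_int : (\int[mu]_(x in node_set u) (sg x)%:E =
    \int[mu]_(x in E `&` node_set u) (sg x)%:E +
    \int[mu]_(x in node_set u `\` E) (sg x)%:E)%E.
  rewrite -ge0_integralU_EFin//.
  - by rewrite -uE.
  - by rewrite -subset0 => x [[Ex _] [_ nEx]].
have Iu : (\int[mu]_(x in node_set u) (sg x)%:E <= S%:E)%E.
  rewrite -hS; apply: (ge0_subset_integral mu mu_ (measurable_node v) _ _
    (descendant_sub v0 du)).
    exact/measurable_funTS/measurable_EFinP.
  by move=> x _; rewrite lee_fin.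
have I0 A : (0 <= \int[mu]_(x in A) (sg x)%:E)%E.
  by apply: integral_ge0 => x _; rewrite lee_fin.
have fin A : (\int[mu]_(x in A) (sg x)%:E <= \int[mu]_(x in node_set u) (sg x)%:E)%E ->
    exists2 a, 0 <= a & (\int[mu]_(x in A) (sg x)%:E = a%:E)%E.
  move=> h; exists (fine (\int[mu]_(x in A) (sg x)%:E)); first exact: fine_ge0.
  rewrite fineK// ge0_fin_numE//; apply: le_lt_trans h _.
  exact: le_lt_trans Iu (ltry _).
have [a a0 aE] := fin (E `&` node_set u) ltac:(by rewrite split_int leeDl).
have [b b0' bE] := fin (node_set u `\` E) ltac:(by rewrite split_int leeDr).
rewrite split_int aE bE -EFinD -!EFinM !lee_fin => h.
by lra.
Qed.

End density_reverse_holder.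

(** * Pointwise bound for averages *)

Section pointwise.
Context {R : realType} {n : nat}.
Local Notation T := (euclid R n).
Local Notation mu := (lebesgue R n).
Local Notation conj := conjugate_exponent.
Implicit Types (x y : T) (u v : @node R n) (p q w f : T -> R) (A B E : set T).

Lemma norm_exists (lo hi : R) q w kappa : 1 < lo -> measurable_fun setT q ->
  (forall x, lo <= q x <= hi) -> weight_class kappa q w ->
  exists Nrm, is_norm q w Nrm.
Proof.
move=> lo1 mq qb [mw w0 wf _].
have H u : exists N, 0 < u.2 ->
    0 < N /\ (\int[mu]_(x in node_set u) (wmod q w N x)%:E = 1)%E.
  have [u0|u0] := ltP 0 u.2; last by exists 1.
  by have [N N0 hN] := unit_norm_exists lo1 mq qb mw w0 u0 (wf u.1 u.2 u0); exists N.
by have [Nrm HN] := choice H; exists Nrm.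
Qed.

(** The number [s] under [p] satisfies [s * (1 + delta) = 1 + delta * lo]. The conjugate of [p / s]
    is [p / (p - s)], and it is at most [(1 + delta) * p / (p - 1)] because this reduces to
    [delta * (p - lo) >= 0]; one [s] thus serves all [p >= lo]. The term 1 absorbs the increase of
    the exponent. *)
Lemma young_improved (delta lo p a b : R) : 0 < delta -> 1 < lo -> lo <= p ->
  0 <= a -> 0 <= b ->
  a * b <= 1 + (a `^ conj p) `^ (1 + delta)
             + b `^ (p / ((1 + delta * lo) / (1 + delta))).
Proof.
move=> d0 l1 lp a0 b0; set s := (1 + delta * lo) / (1 + delta).
have d1 : 0 < 1 + delta by lra.
have sE : s * (1 + delta) = 1 + delta * lo by rewrite /s divfK// gt_eqF.
have s1 : 1 < s by rewrite /s ltr_pdivlMr//; nra.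
have slo : s < lo by rewrite /s ltr_pdivrMr//; nra.
have s0 : 0 < s by lra.
have t1 : 1 < p / s by rewrite ltr_pdivlMr//; lra.
have := young b0 a0 t1 erefl.
have -> : p / s / (p / s - 1) = p / (p - s).
  by field; rewrite !gt_eqF//; lra.
rewrite mulrC => h; apply: le_trans h _.
rewrite addrC lerD2r -powRrM; apply: powR_le1D => //; apply/andP; split.
  by rewrite divr_ge0//; lra.
rewrite /conjugate_exponent ler_pdivrMr; last by lra.
have -> : p / (p - 1) * (1 + delta) * (p - s) =
    p * ((1 + delta) * (p - s) / (p - 1)) by field; rewrite gt_eqF//; lra.
rewrite ler_peMr//; first by lra.
have dp : 0 <= delta * (p - lo) by rewrite mulr_ge0//; lra.
by rewrite ler_pdivlMr; lra.
Qed.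

Section constants.
Variables (lo hi D pinf kappa delta : R).
Hypotheses (n0 : (0 < n)%N) (lo1 : 1 < lo) (delta0 : 0 < delta).
Let s := (1 + delta * lo) / (1 + delta).

Let s1 : 1 < s.
Proof.
have d0 := delta0; have l1 := lo1; have d1 : 0 < 1 + delta by lra.
by rewrite /s ltr_pdivlMr//; nra.
Qed.
Let s0 : 0 < s. Proof. by have := s1; lra. Qed.
Let slo : s < lo.
Proof.
have d0 := delta0; have l1 := lo1; have d1 : 0 < 1 + delta by lra.
by rewrite /s ltr_pdivrMr//; nra.
Qed.

Section fixed.
Variables (p w f : T -> R).
Hypotheses (Hp : exponent_class lo hi D pinf p)
  (Hw : weight_class kappa (conj \o p) w)
  (mf : measurable_fun setT f) (f0 : forall x, 0 <= f x)
  (fp : (\int[mu]_x (f x `^ p x)%:E <= 1)%E).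
Let q := conj \o p.

Let mp : measurable_fun setT p. Proof. by case: Hp. Qed.
Let plo x : lo <= p x. Proof. by case: Hp => _ /(_ x)/andP[]. Qed.
Let phi x : p x <= hi. Proof. by case: Hp => _ /(_ x)/andP[]. Qed.
Let p1 x : 1 < p x. Proof. exact: lt_le_trans (plo x). Qed.
Let pinfb : lo <= pinf <= hi. Proof. by case: Hp. Qed.
Let pinf1 : 1 < pinf. Proof. by have /andP[h _] := pinfb; exact: lt_le_trans h. Qed.
Let Hq := exponent_class_conjugate lo1 Hp.
Let mq : measurable_fun setT q. Proof. by case: Hq. Qed.
Let mw : measurable_fun setT w. Proof. by case: Hw. Qed.
Let w0 x : 0 < w x. Proof. by case: Hw. Qed.
Let D0 : 0 <= D.
Proof.
case: Hp => _ _ _ _ /(_ (@point R n (fun=> 0))); apply: le_trans.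
by rewrite mulr_ge0// ltW// logmod_gt0.
Qed.

Definition fpow x : R := f x `^ (p x / s).

Lemma measurable_fpow : measurable_fun setT fpow.
Proof. exact: (measurable_powR_fun mf (measurable_funM mp (measurable_cst _))). Qed.

Lemma fpow_ge0 x : 0 <= fpow x. Proof. exact: powR_ge0. Qed.

Definition fdecay x : R := fpow x + decay x.

Let decay0 x : 0 <= decay x. Proof. exact: ltW (decay_gt0 x). Qed.

Lemma measurable_fdecay : measurable_fun setT fdecay.
Proof. exact: (measurable_funD measurable_fpow measurable_decay). Qed.

Lemma fdecay_ge0 x : 0 <= fdecay x. Proof. by rewrite addr_ge0 ?fpow_ge0. Qed.

Lemma fdecay_le x : fdecay x <= 2 + f x `^ p x.
Proof.
have h : fpow x <= 1 + f x `^ p x.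
  apply: powR_le1D => //; have h1 := p1 x; apply/andP; split.
    by rewrite divr_ge0// ?(ltW s0)//; lra.
  rewrite ler_pdivrMr// ler_peMr//; first by lra.
  exact: ltW s1.
by have := decay_le1 x; rewrite /fdecay; lra.
Qed.

Let mfp : measurable_fun setT (fun x => f x `^ p x).
Proof. exact: (measurable_powR_fun mf mp). Qed.

Lemma integral_fdecay_le v : 0 <= v.2 ->
  (\int[mu]_(x in node_set v) (fdecay x)%:E <= (2 * v.2 ^+ n + 1)%:E)%E.
Proof.
move=> v0; apply: (@le_trans _ _ (\int[mu]_(x in node_set v) (2 + f x `^ p x)%:E)%E).
  by apply: ge0_le_integralW => x _; rewrite lee_fin ?fdecay_ge0 ?fdecay_le.
have c0 : forall x : T, 0 <= 2 :> R by [].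
have fp0 x : 0 <= f x `^ p x by exact: powR_ge0.
rewrite (ge0_integralD_EFin mu (measurable_node v) (measurable_cst (2 : R)) c0 mfp fp0).
rewrite [(2 * v.2 ^+ n + 1)%:E]EFinD; apply: leeD.
  by rewrite (integral_cst_hcube v.1 _ v0).
apply: le_trans fp; apply: (ge0_subset_integral mu (measurable_node v)
  measurableT _ _ (@subsetT _ _)).
  by apply/measurable_EFinP; exact: mfp.
by move=> x _; rewrite lee_fin.
Qed.

(* Young's inequality with the improved exponents, after normalizing w by K
   and f by lam. *)
Lemma young_pointwise K lam x : 0 < K -> 0 < lam ->
  w x * f x <= K * lam * (1 + wmod q w K x `^ (1 + delta) + (f x / lam) `^ (p x / s)).
Proof.
move=> K0 l0.
have wK0 : 0 <= w x / K by rewrite divr_ge0 ?(ltW (w0 x)) ?(ltW K0).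
have fl0 : 0 <= f x / lam by rewrite divr_ge0 ?(ltW l0).
have h := young_improved delta0 lo1 (plo x) wK0 fl0.
have -> : w x * f x = K * lam * (w x / K * (f x / lam)).
  by field; rewrite !gt_eqF.
by rewrite ler_wpM2l// mulr_ge0// ltW.
Qed.

Let mwd K : measurable_fun setT (fun x => wmod q w K x `^ (1 + delta)).
Proof.
exact: (measurable_powR_fun (measurable_wmod _ mq mw) (measurable_cst _)).
Qed.

Let wd0 K x : 0 <= wmod q w K x `^ (1 + delta). Proof. exact: powR_ge0. Qed.

(** [lam] is a constant replacing the variable $A^{s/p(y)}$, and [e3] measures the error. Dividing
    [f] by it turns [fpow] into at most [e3 / A * fpow], so that for [A] at least the average of
    [fdecay] the last term stays of the size of the volume. *)
Lemma young_integral v (K lam A e3 : R) : 0 <= v.2 -> 0 < K -> 0 < lam -> 0 < A -> 0 <= e3 ->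
  (forall y, node_set v y -> A <= e3 * lam `^ (p y / s)) ->
  (\int[mu]_(x in node_set v) (w x * f x)%:E <= (K * lam)%:E *
    ((v.2 ^+ n)%:E + \int[mu]_(x in node_set v) (wmod q w K x `^ (1 + delta))%:E
     + (e3 / A)%:E * \int[mu]_(x in node_set v) (fdecay x)%:E))%E.
Proof.
move=> v0 K0 l0 A0 e30 hA.
have Kl0 : 0 <= K * lam by rewrite mulr_ge0 ?(ltW K0) ?(ltW l0).
have eA0 : 0 <= e3 / A by rewrite divr_ge0 ?(ltW A0).
have c0 : forall x : T, 0 <= 1 :> R by [].
have m1 := measurable_funD (measurable_cst (1 : R)) (mwd K).
have p10 x : 0 <= 1 + wmod q w K x `^ (1 + delta) by rewrite addr_ge0.
have m2 : measurable_fun setT (fun x => e3 / A * fdecay x).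
  exact: (measurable_funM (measurable_cst _) measurable_fdecay).
have p20 x : 0 <= e3 / A * fdecay x by rewrite mulr_ge0 ?fdecay_ge0.
have m3 := measurable_funD m1 m2.
have p30 x : 0 <= 1 + wmod q w K x `^ (1 + delta) + e3 / A * fdecay x.
  by rewrite addr_ge0.
have mv := measurable_node v.
rewrite -[(v.2 ^+ n)%:E]/((v.2 ^+ n)%:E) -[v.2 ^+ n]mul1r.
rewrite -(integral_cst_hcube v.1 1 v0) -/(node_set v).
rewrite -(ge0_integralD_EFin mu mv (measurable_cst (1 : R)) c0 (mwd K) (wd0 K)).
rewrite -(ge0_integralZ_EFin mu mv measurable_fdecay fdecay_ge0 eA0).
rewrite -(ge0_integralD_EFin mu mv m1 p10 m2 p20).
rewrite -(ge0_integralZ_EFin mu mv m3 p30 Kl0).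
apply: ge0_le_integralW => x vx; rewrite lee_fin.
  by rewrite mulr_ge0// ltW.
apply: le_trans (young_pointwise x K0 l0) _; rewrite ler_wpM2l//= lerD2l.
rewrite (powRM _ (f0 x)) ?invr_ge0 ?(ltW l0)// powR_inv//.
have lp0 : 0 < lam `^ (p x / s) by exact: powR_gt0.
apply: (@le_trans _ _ (fpow x * (e3 / A))).
  rewrite ler_wpM2l ?fpow_ge0// -[leLHS]mul1r ler_pdivrMr// mulrAC.
  by rewrite ler_pdivlMr// mul1r; exact: hA.
by rewrite mulrC ler_wpM2l// lerDl.
Qed.

Variables (Nrm : @node R n -> R) (c : R).
Hypotheses (HN : is_norm q w Nrm) (c0 : 0 < c)
  (RH : forall v J S, 0 < v.2 -> v.2 / 2 ^+ J <= 2 ->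
    J = 0%N \/ 1 <= v.2 / 2 ^+ J -> 0 < S ->
    (\int[mu]_(x in node_set v) (density q w (conj pinf) Nrm J v x)%:E = S%:E)%E ->
    (\int[mu]_(x in node_set v) (density q w (conj pinf) Nrm J v x `^ (1 + delta))%:E
      <= (c * (S / v.2 ^+ n) `^ delta * S)%:E)%E).

Let d1 : 0 < 1 + delta. Proof. by have := delta0; lra. Qed.

(** At depth 0 the density is [S] times the modular density, and the powers of [S] cancel. *)
Lemma reverse_holder_cell v : 0 < v.2 <= 2 ->
  (\int[mu]_(x in node_set v) (wmod q w (Nrm v) x `^ (1 + delta))%:E <=
    (c * ((v.2 ^+ n) `^ delta)^-1)%:E)%E.
Proof.
move=> /andP[v0 v2]; have [N0 hN] := HN v0.
set S := Nrm v `^ conj pinf.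
have S0 : 0 < S by exact: powR_gt0.
have vn0 : 0 < v.2 ^+ n by rewrite exprn_gt0.
have dE x : node_set v x ->
    density q w (conj pinf) Nrm 0 v x = S * wmod q w (Nrm v) x.
  by move=> vx; rewrite (density_cell _ _ _ _ (ltW v0) (J := 0%N) erefl vx).
have mv := measurable_node v.
have intS : (\int[mu]_(x in node_set v) (density q w (conj pinf) Nrm 0 v x)%:E = S%:E)%E.
  rewrite (eq_integral_set dE) (ge0_integralZ_EFin mu mv (measurable_wmod _ mq mw)
    (wmod_ge0 q w _) (ltW S0)).
  by rewrite hN mule1.
have v2' : v.2 / 2 ^+ 0 <= 2 by rewrite expr0 divr1.
have := RH v0 v2' (or_introl erefl) S0 intS.
have dE' x : node_set v x ->
    density q w (conj pinf) Nrm 0 v x `^ (1 + delta) =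
    S `^ (1 + delta) * wmod q w (Nrm v) x `^ (1 + delta).
  by move=> vx; rewrite (dE x vx) powRM ?(ltW S0) ?wmod_ge0.
rewrite (eq_integral_set dE') (ge0_integralZ_EFin mu mv (mwd _) (wd0 _) (powR_ge0 _ _)).
have SS0 : 0 < S `^ (1 + delta) by exact: powR_gt0.
rewrite -lee_pdivlMl// -EFinM; congr (_ <= _%:E)%E.
rewrite (powRM _ (ltW S0)) ?invr_ge0 ?(ltW vn0)// powR_inv//.
rewrite (powRD (x := S)); last by rewrite gt_eqF ?implybT.
rewrite powRr1 ?(ltW S0)//.
by field; rewrite !gt_eqF ?powR_gt0.
Qed.

Let hi1 : 1 <= hi.
Proof. by have /andP[h1 h2] := pinfb; have := lo1; lra. Qed.

Variables (K : R) (a : T) (l : R).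
Let P := recip_mean (EFin \o p) (cube a l).
Hypotheses (K1 : 1 <= K) (l0 : 0 < l)
  (HB : (\int[mu]_(x in hcube (coordinate a) l)
    (wmod q w (K * (l ^+ n) `^ (1 - P)) x)%:E <= 1)%E).

Let v : @node R n := (coordinate a, l).
Let v0 : 0 < v.2. Proof. exact: l0. Qed.
Let ln0 : 0 < l ^+ n. Proof. by rewrite exprn_gt0. Qed.
Let K0 : 0 < K. Proof. by have := K1; lra. Qed.

(** [HB] says that the norm of [w] on the cube is at most $K|Q|^{1-P}$. The power [b] of $|Q|^{1-P}$
    is near $|Q|$ when [(1 - P) * b] is near 1; [b] will be [q y] on small cubes and the conjugate
    of [pinf] on large ones. *)
Lemma norm_power b m : 0 <= b -> `|(1 - P) * b - 1| * (n%:R * `|ln l|) <= m ->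
  (Nrm v / K) `^ b <= expR m * l ^+ n.
Proof.
move=> b0 hm; have [N0 hN] := HN v0.
have X0 : 0 < (l ^+ n) `^ (1 - P) by exact: powR_gt0.
have NK : Nrm v <= K * (l ^+ n) `^ (1 - P).
  have Hb : forall x, conj hi <= q x <= conj lo by case: Hq.
  apply: (unit_norm_le _ mq Hb mw w0 (measurable_node v) (measurable_node v)
    (@subset_refl _ _) N0 _ _ HB); last by rewrite hN.
    by apply: conjugate_exponent_gt1; have := hi1; have /andP[h1 h2] := pinfb;
      have := lo1; lra.
  exact: mulr_gt0.
apply: (@le_trans _ _ (((l ^+ n) `^ (1 - P)) `^ b)).
  apply: ge0_powR_le => //; first by rewrite divr_ge0 ?(ltW N0) ?(ltW K0).
  by rewrite ler_pdivrMr// mulrC.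
rewrite -powRrM -[X in _ <= _ * X]powRr1 ?(ltW ln0)//.
apply: powR_compare => //; rewrite lnXn// -[ln l *+ n]mulr_natl normrM.
by rewrite [`|n%:R|]ger0_norm.
Qed.

Let m1 : R := conj lo * (n%:R * D).
Let Mn : R := n.+1%:R.
Let m3 : R := D * (3 + n%:R) + Mn * (2 * D + D * ln Mn).

(** The base is at least 1, so after the power [(p x)^-1 >= hi^-1] of the conclusion the power [hi]
    still leaves at least the base. *)
Definition small_const : R :=
  (K * (1 + c * expR (m1 * (1 + delta)) + expR m3)) `^ hi.

(** The exponent is frozen at [x]: [lam] is the power [s / p x] of [A' = Av + decay x]. Replacing
    [p y] by [p x] costs $|p(x)-p(y)|\,|\ln A'|$. The logarithm is at most $3+n|\ln l|$, from the
    size of the cube, plus [n.+1 * logmod x], from the added [decay x]; the local condition absorbs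
    the first part and the condition at infinity the second. *)
Lemma pointwise_small x Av : l <= 1 -> cube a l x ->
  (\int[mu]_(y in node_set v) (fdecay y)%:E = (Av * l ^+ n)%:E)%E ->
  (\int[mu]_(y in node_set v) (w y * f y)%:E <=
    (l ^+ n * (small_const * (Av + decay x) `^ s) `^ (p x)^-1)%:E)%E.
Proof.
move=> l1 ax hAv; have [N0 hN] := HN v0.
have c0' := c0; have K1' := K1; have d1' := d1.
have Hb : forall y, conj hi <= q y <= conj lo by case: Hq.
have Av0 : 0 <= Av.
  have : 0 <= Av * l ^+ n.
    rewrite -lee_fin -hAv; apply: integral_ge0 => y _.
    by rewrite lee_fin fdecay_ge0.
  by rewrite pmulr_lge0.
set A' := Av + decay x.
have A'0 : 0 < A' by rewrite ltr_wpDl ?decay_gt0.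
have Avle : Av * l ^+ n <= 3.
  have := integral_fdecay_le (ltW v0); rewrite hAv lee_fin => h.
  have : l ^+ n <= 1 by rewrite exprn_ile1// ltW.
  by rewrite /= in h; lra.
have lnlD : `|ln l| <= 1 + `|ln (2 * l)|.
  rewrite lnM ?posrE//.
  have h1 : 0 <= ln 2 :> R by rewrite ln_ge0//; lra.
  have h2 : ln 2 <= 1 :> R by have := @le_ln1Dx R 1 ltac:(lra).
  have := ler_norm (- (ln 2 + ln l)); rewrite normrN.
  by rewrite [`|ln l|]ler0_norm ?ln_le0//; lra.
(* [x] may lie on a closed face. The doubled half-open cube contains it together with the whole
   node, and its side is still at most 2. *)
have x2 : hcube (coordinate a) (2 * l) x.
  move=> i; have /andP[h1 h2] := ax i; rewrite h1/=.
  by apply: le_lt_trans h2 _; rewrite ltrD2l; have := l0; lra.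
have sub2 y : node_set v y -> hcube (coordinate a) (2 * l) y.
  move=> vy i; have /andP[h1 h2] := vy i; rewrite h1/=.
  by apply: lt_trans h2 _; rewrite ltrD2l /=; have := l0; lra.
have hPy y : node_set v y -> `|(1 - P) * q y - 1| * (n%:R * `|ln l|) <= m1.
  move=> vy; have p1y := p1 y.
  have -> : (1 - P) * q y - 1 = - (q y * (P - (p y)^-1)).
    by rewrite /q /= /conjugate_exponent; field; rewrite !gt_eqF; lra.
  have l2 : 0 < l <= 2 by rewrite l0; lra.
  have h := recip_mean_local lo1 Hp l2 vy.
  have /andP[q0 qlo] := Hb y.
  have q00 : 0 <= q y by apply: le_trans q0; rewrite divr_ge0//; have := hi1; lra.
  rewrite normrN normrM [`|q y|]ger0_norm//.
  have -> : q y * `|P - (p y)^-1| * (n%:R * `|ln l|) =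
    q y * (n%:R * (`|P - (p y)^-1| * `|ln l|)) by ring.
  by apply: ler_pM => //; rewrite ?mulr_ge0 ?ler_wpM2l.
have wK : (\int[mu]_(y in node_set v) (wmod q w K y `^ (1 + delta))%:E <=
    (c * expR (m1 * (1 + delta)) * l ^+ n)%:E)%E.
  set Z := (expR m1 * l ^+ n) `^ (1 + delta).
  apply: (@le_trans _ _ (\int[mu]_(y in node_set v)
    (Z * wmod q w (Nrm v) y `^ (1 + delta))%:E)%E).
    apply: ge0_le_integralW => y vy; rewrite lee_fin//.
    rewrite (wmod_change Hw y K0 N0) powRM ?powR_ge0 ?wmod_ge0// ler_wpM2r//.
    apply: ge0_powR_le; [exact: ltW|exact: powR_ge0|].
    apply: norm_power; last exact: hPy.
    have /andP[q0 _] := Hb y; apply: le_trans q0.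
    by rewrite divr_ge0//; have := hi1; lra.
  rewrite (ge0_integralZ_EFin mu (measurable_node v) (mwd _) (wd0 _) (powR_ge0 _ _)).
  have v2 : 0 < v.2 <= 2 by rewrite v0 /=; lra.
  apply: le_trans (lee_wpmul2l _ (reverse_holder_cell v2)) _.
    by rewrite lee_fin powR_ge0.
  rewrite -EFinM lee_fin le_eqVlt; apply/orP; left; apply/eqP.
  rewrite /Z powRM ?expR_ge0 ?(ltW ln0)// [expR m1 `^ _]gt0_powRE ?expR_gt0//.
  rewrite expRK [_ * m1]mulrC /=.
  rewrite (powRD (x := l ^+ n)); last by rewrite gt_eqF ?implybT.
  rewrite powRr1 ?(ltW ln0)//.
  by field; rewrite gt_eqF ?powR_gt0.
set lam := A' `^ (s / p x).
have lam0 : 0 < lam by exact: powR_gt0.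
have p1x := p1 x; have s0' := s0.
have hA y : node_set v y -> A' <= expR m3 * lam `^ (p y / s).
  move=> vy; have p1y := p1 y.
  rewrite /lam -powRrM (_ : s / p x * (p y / s) = p y / p x); last first.
    by field; rewrite !gt_eqF//; lra.
  rewrite -[X in X <= _]powRr1 ?(ltW A'0)//; apply: powR_compare => //.
  have y2 := sub2 y vy.
  have h1 : `|1 - p y / p x| <= `|p x - p y|.
    have -> : 1 - p y / p x = (p x - p y) / p x by field; rewrite gt_eqF//; lra.
    rewrite normrM ler_piMr// ger0_norm ?invr_ge0; last by lra.
    by rewrite invf_le1; lra.
  have h2 : `|ln A'| <= 3 + n%:R * `|ln l| + Mn * logmod x.
    have e1 : ln (decay x) <= ln A'.
      by rewrite ler_ln ?posrE ?decay_gt0// lerDr.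
    rewrite ln_decay mulNr -/Mn in e1.
    have e2 : ln A' <= 3 + n%:R * `|ln l|.
      have : A' <= 4 * (l ^+ n)^-1.
        rewrite ler_pdivlMr// mulrDl; have := decay_le1 x; have := decay0 x.
        have : l ^+ n <= 1 by rewrite exprn_ile1// ltW.
        by move=> ? ? ?; have : decay x * l ^+ n <= 1 * 1; [apply: ler_pM => //; exact: ltW|lra].
      move=> h4; have h : ln A' <= ln (4 * (l ^+ n)^-1).
        by rewrite ler_ln ?posrE ?mulr_gt0 ?invr_gt0.
      apply: le_trans h _.
      rewrite lnM ?posrE ?invr_gt0// lnV ?posrE// lnXn// -[ln l *+ n]mulr_natl.
      apply: lerD; first by have := @le_ln1Dx R 3 ltac:(lra); rewrite (_ : 1 + 3 = 4)//; ring.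
      by rewrite -mulrN ler_wpM2l// -normrN ler_norm.
    have e3 : 0 <= Mn * logmod x by rewrite mulr_ge0// ltW// logmod_gt0.
    have e4 : 0 <= n%:R * `|ln l| by rewrite mulr_ge0.
    by rewrite ler_norml; apply/andP; split; lra.
  have [_ _ _ loc inf] := Hp.
  have l22 : 0 < 2 * l <= 2 by apply/andP; split; have := l0; lra.
  have h3 := loc _ _ x y l22 x2 y2.
  have h4 : `|p x - p y| * logmod x <= 2 * D + D * ln Mn.
    have L1 := logmod_ge1 y.
    have g1 := inf x; have g2 := inf y.
    have /andP[_ l2] := l22.
    have g3 := logmod_hcube l2 x2 y2; rewrite -/Mn in g3.
    have lM0 : 0 <= ln Mn by rewrite ln_ge0// ler1n.
    have g4 : `|p y - pinf| <= D.
      by apply: le_trans g2; rewrite ler_peMr.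
    have g5 : `|p x - p y| <= `|p x - pinf| + `|p y - pinf|.
      by rewrite [`|p y - pinf|]distrC; apply: le_trans (ler_normD _ _); rewrite subrKA.
    apply: (@le_trans _ _ ((`|p x - pinf| + `|p y - pinf|) * logmod x)).
      by rewrite ler_wpM2r// ltW// logmod_gt0.
    have g6 : `|p y - pinf| * logmod x <= `|p y - pinf| * (logmod y + ln Mn).
      by rewrite ler_wpM2l.
    have g7 : `|p y - pinf| * ln Mn <= D * ln Mn by rewrite ler_wpM2r.
    by lra.
  apply: le_trans (ler_pM (normr_ge0 _) (normr_ge0 _) h1 h2) _.
  have h5 : `|p x - p y| * (3 + n%:R * `|ln l|) <= D * (3 + n%:R).
    apply: le_trans (ler_wpM2r _ h3); last by rewrite addr_ge0.
    rewrite -mulrA ler_wpM2l//.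
    have : n%:R * `|ln l| <= n%:R * (1 + `|ln (2 * l)|) by rewrite ler_wpM2l.
    have := normr_ge0 (ln (2 * l)).
    by lra.
  have h6 : Mn * (`|p x - p y| * logmod x) <= Mn * (2 * D + D * ln Mn).
    by rewrite ler_wpM2l.
  by rewrite /m3; lra.
have e30 : 0 <= expR m3 by exact: expR_ge0.
have Y := young_integral (ltW v0) K0 lam0 A'0 e30 hA.
have KL0 : (0 <= (K * lam)%:E)%E by rewrite lee_fin mulr_ge0 ?(ltW K0) ?(ltW lam0).
set X := 1 + c * expR (m1 * (1 + delta)) + expR m3.
have X1 : 1 <= X.
  have : 0 <= c * expR (m1 * (1 + delta)) by rewrite mulr_ge0 ?expR_ge0 ?(ltW c0).
  by rewrite /X; lra.
apply: (@le_trans _ _ (K * lam * (l ^+ n * X))%:E).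
  apply: le_trans Y _; rewrite [leRHS]EFinM; apply: lee_wpmul2l => //.
  have -> : (l ^+ n * X)%:E = ((l ^+ n)%:E +
      (c * expR (m1 * (1 + delta)) * l ^+ n)%:E + (expR m3 * l ^+ n)%:E)%E.
    by rewrite -!EFinD; congr EFin; rewrite /X; ring.
  apply: leeD; first by apply: leeD.
  rewrite hAv -EFinM lee_fin mulrA ler_wpM2r ?(ltW ln0)//.
  rewrite mulrAC ler_pdivrMr// ler_wpM2l//.
  by rewrite lerDl.
rewrite lee_fin.
have -> : K * lam * (l ^+ n * X) = l ^+ n * (K * X * lam) by ring.
rewrite ler_wpM2l ?(ltW ln0)//.
have KX1 : 1 <= K * X by nra.
rewrite powRM ?powR_ge0//; apply: ler_pM.
- by lra.
- exact: ltW.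
- rewrite /small_const -/X -powRrM -[leLHS]powRr1; last by lra.
  apply: ler_powR => //; rewrite ler_pdivlMr; last by lra.
  by rewrite mul1r.
- by rewrite -powRrM.
Qed.

Let qi := conj pinf.
Let qi1 : 1 < qi. Proof. exact: conjugate_exponent_gt1. Qed.
Let Mn0 : 0 < Mn. Proof. by rewrite ltr0n. Qed.
Let lnMn0 : 0 <= ln Mn. Proof. by rewrite ln_ge0// ler1n. Qed.

(** A form of Jensen's inequality. Where [h] is at most [(2 * V)^-1] it carries at most half of its
    integral 1, the volume being at most [V]; elsewhere [h] is at most [W] times its power
    [1 + delta]. *)
Lemma density_power_cell J (z u : @node R n) : 0 <= z.2 -> at_depth J z u ->
  0 < u.2 <= 2 ->
  (((Nrm u `^ qi) `^ (1 + delta))%:E <= (2 * (2 * 2 ^+ n) `^ delta)%:E *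
    \int[mu]_(x in node_set u) (density q w qi Nrm J z x `^ (1 + delta))%:E)%E.
Proof.
move=> z0 zu /andP[u0 u2]; have [N0 hN] := HN u0; have dl0 := delta0; have d1' := d1.
set G := Nrm u `^ qi; have G0 : 0 < G by exact: powR_gt0.
set V : R := 2 ^+ n; have V0 : 0 < V by rewrite exprn_gt0.
have mv := measurable_node u.
have uV : u.2 ^+ n <= V by apply: lerXn2r; rewrite ?nnegrE//; exact: ltW.
set h := wmod q w (Nrm u).
have h0 y : 0 <= h y by exact: wmod_ge0.
have mh : measurable_fun setT h by exact: measurable_wmod.
set W := (2 * V) `^ delta.
have W0 : 0 <= W by exact: powR_ge0.
have V20 : 0 <= (2 * V)^-1 by rewrite invr_ge0 mulr_ge0// ltW.
have hle y : h y <= (2 * V)^-1 + W * h y `^ (1 + delta).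
  have [hy|hy] := leP (h y) (2 * V)^-1.
    by rewrite ler_wpDr// mulr_ge0 ?powR_ge0.
  have hy0 : 0 < h y by exact: le_lt_trans hy.
  apply: ler_wpDl => //.
  rewrite (powRD (x := h y)); last by rewrite gt_eqF ?implybT.
  rewrite powRr1// mulrCA /W -powRM ?(ltW hy0) ?mulr_ge0 ?(ltW V0)//.
  rewrite ler_peMr// -[leLHS](powRr0 (2 * V * h y)) ler_powR// ?(ltW dl0)//.
  by rewrite mulrC -ler_pdivrMr ?mulr_gt0// mul1r ltW.
have c00 : forall x : T, 0 <= (2 * V)^-1 :> R by [].
have mhd := mwd (Nrm u); have hd0 := wd0 (Nrm u).
have mW : measurable_fun setT (fun x => W * h x `^ (1 + delta)).
  exact: (measurable_funM (measurable_cst _) mhd).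
have W00 x : 0 <= W * h x `^ (1 + delta) by rewrite mulr_ge0.
set I := (\int[mu]_(x in node_set u) (h x `^ (1 + delta))%:E)%E.
have I0 : (0 <= I)%E by apply: integral_ge0 => y _; rewrite lee_fin.
have half : (1 <= (2 * W)%:E * I)%E.
  have : (1 <= (2^-1)%:E + W%:E * I)%E.
    rewrite -{1}hN; apply: (@le_trans _ _ (\int[mu]_(x in node_set u)
        ((2 * V)^-1 + W * h x `^ (1 + delta))%:E)%E).
      by apply: ge0_le_integralW => y _; rewrite lee_fin ?h0 ?hle.
    rewrite (ge0_integralD_EFin mu mv (measurable_cst _) c00 mW W00).
    rewrite (ge0_integralZ_EFin mu mv mhd hd0 W0) leeD2r//.
    rewrite (integral_cst_hcube u.1 _ (ltW u0)) lee_fin.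
    by rewrite mulrC ler_pdivrMr ?mulr_gt0// mulrA mulVf// mul1r.
  case: I I0 => [r r0| _ _|//].
    by rewrite -!EFinM -EFinD !lee_fin => h1; clear c00; lra.
  rewrite gt0_muley ?leey// lte_fin mulr_gt0// powR_gt0// mulr_gt0//.
have dE x : node_set u x -> density q w qi Nrm J z x `^ (1 + delta) =
    G `^ (1 + delta) * h x `^ (1 + delta).
  by move=> ux; rewrite (density_cell _ _ _ _ z0 zu ux) powRM ?(ltW G0) ?h0.
rewrite (eq_integral_set dE) (ge0_integralZ_EFin mu mv mhd hd0 (powR_ge0 _ _)).
rewrite muleCA -[leLHS]mule1; apply: lee_wpmul2l half.
by rewrite lee_fin powR_ge0.
Qed.

Let e4 : R := D * (2 * 2 ^+ n + 1 + Mn * ln Mn) + Mn * D.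
Let K6 : R := 2 ^+ n + c + expR e4.

(** On a cell of side about 1 the exponent is frozen at [pinf]. [Au] is bounded above and, thanks to
    the decay term of [fdecay], bounded below by a multiple of [decay y], so $|\ln Au|$ is of order
    [logmod y] and the condition of [p] at infinity applies. *)
Lemma weighted_cell (u : @node R n) (Au : R) : 1 <= u.2 <= 2 ->
  (\int[mu]_(y in node_set u) (fdecay y)%:E = Au%:E)%E ->
  0 < Au /\ (\int[mu]_(y in node_set u) (w y * f y)%:E <=
    (K6 * (Nrm u * Au `^ (s / pinf)))%:E)%E.
Proof.
move=> /andP[u1 u2] hAu; have u0 : 0 < u.2 by exact: lt_le_trans u1.
have [N0 hN] := HN u0; have s0' := s0; have pinf1' := pinf1.
have un1 : 1 <= u.2 ^+ n by rewrite exprn_ege1.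
have un2 : u.2 ^+ n <= 2 ^+ n by apply: lerXn2r; rewrite ?nnegrE//; exact: ltW.
have mv := measurable_node u.
have V0 : 0 < 2 ^+ n :> R by rewrite exprn_gt0.
have Aule : Au <= 2 * 2 ^+ n + 1.
  have := integral_fdecay_le (ltW u0); rewrite hAu lee_fin => h.
  by apply: le_trans h _; rewrite lerD2r ler_pM2l.
have Aulb y : node_set u y -> decay y / Mn ^+ n.+1 <= Au.
  move=> uy; have dM0 : 0 <= decay y / Mn ^+ n.+1.
    by rewrite divr_ge0 ?decay0// exprn_ge0// ltW.
  rewrite -lee_fin -hAu; apply: (@le_trans _ _
      (\int[mu]_(x in node_set u) (decay y / Mn ^+ n.+1)%:E)%E).
    by rewrite (integral_cst_hcube u.1 _ (ltW u0)) lee_fin ler_peMr.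
  apply: ge0_le_integralW => z uz; rewrite lee_fin//.
  apply: ler_wpDl; first exact: fpow_ge0.
  rewrite ler_pdivrMr ?exprn_gt0// mulrC.
  exact: (decay_hcube u2 uy uz).
have Au0 : 0 < Au.
  apply: lt_le_trans (Aulb _ (node_set_corner u0)).
  by rewrite divr_gt0 ?decay_gt0 ?exprn_gt0.
split => //.
set lam := Au `^ (s / pinf); have lam0 : 0 < lam by exact: powR_gt0.
have hA y : node_set u y -> Au <= expR e4 * lam `^ (p y / s).
  move=> uy; have p1y := p1 y.
  rewrite /lam -powRrM (_ : s / pinf * (p y / s) = p y / pinf); last first.
    by field; rewrite !gt_eqF//; lra.
  rewrite -[X in X <= _]powRr1 ?(ltW Au0)//; apply: powR_compare => //.
  have h1 : `|1 - p y / pinf| <= `|p y - pinf|.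
    have -> : 1 - p y / pinf = (pinf - p y) / pinf.
      by field; rewrite gt_eqF//; lra.
    rewrite normrM distrC ler_piMr// ger0_norm ?invr_ge0; last by lra.
    by rewrite invf_le1; lra.
  have h2 : `|ln Au| <= 2 * 2 ^+ n + 1 + Mn * ln Mn + Mn * logmod y.
    have g1 : ln (decay y / Mn ^+ n.+1) <= ln Au.
      rewrite ler_ln ?posrE ?Aulb//.
      by rewrite divr_gt0 ?decay_gt0 ?exprn_gt0.
    rewrite ln_div ?posrE ?decay_gt0 ?exprn_gt0// ln_decay mulNr -/Mn in g1.
    rewrite lnXn// -[ln Mn *+ _]mulr_natl -/Mn in g1.
    have g2 : ln Au <= 2 * 2 ^+ n + 1.
      have h : ln Au <= Au - 1.
        have := @le_ln1Dx R (Au - 1).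
        by rewrite (_ : 1 + (Au - 1) = Au); [apply; lra|ring].
      by lra.
    have g3 : 0 <= Mn * logmod y by rewrite mulr_ge0// ltW// logmod_gt0.
    have g4 : 0 <= Mn * ln Mn by rewrite mulr_ge0// ltW.
    by rewrite ler_norml; apply/andP; split; lra.
  apply: le_trans (ler_pM (normr_ge0 _) (normr_ge0 _) h1 h2) _.
  have [_ _ _ _ inf] := Hp.
  have h3 := inf y; have L1 := logmod_ge1 y.
  have h4 : `|p y - pinf| <= D by apply: le_trans h3; rewrite ler_peMr.
  rewrite mulrDr /e4 mulrCA; apply: lerD.
    by rewrite ler_wpM2r// !addr_ge0 ?mulr_ge0 ?(ltW V0) ?(ltW Mn0).
  by rewrite ler_wpM2l ?(ltW Mn0).
apply: le_trans (young_integral (ltW u0) N0 lam0 Au0 (expR_ge0 e4) hA) _.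
rewrite [K6 * _]mulrC [leRHS]EFinM; apply: lee_wpmul2l.
  by rewrite lee_fin mulr_ge0 ?(ltW N0) ?(ltW lam0).
rewrite /K6 [(_ + expR _)%:E]EFinD [(_ + c)%:E]EFinD; apply: leeD.
  apply: leeD; first by rewrite lee_fin.
  apply: le_trans (@reverse_holder_cell u _) _; first by rewrite u0.
  rewrite lee_fin ler_piMr ?(ltW c0)// invf_le1 ?powR_gt0 ?exprn_gt0//.
  by rewrite -[leLHS](powRr0 (u.2 ^+ n)) ler_powR// ltW.
by rewrite hAu -EFinM lee_fin divfK// gt_eqF.
Qed.

Variables (C1 C2 : R).
Hypotheses (C10 : 0 < C1) (C20 : 0 < C2)
  (HC1 : forall v J, 0 < v.2 -> 1 <= v.2 / 2 ^+ J <= 2 ->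
    (\int[mu]_(x in node_set v) (density q w qi Nrm J v x)%:E <=
      (C1 * Nrm v `^ qi)%:E)%E)
  (HC2 : (\int[mu]_x (decay x)%:E <= C2%:E)%E).

Let m5 : R := conj lo * (n%:R * (D * (2 * Mn + 2 * C2))).
(** [C4 * l ^+ n] bounds the mass of the density, [C5 * l ^+ n] its power integral from the reverse
    Hoelder inequality, and [W5] is the constant of [density_power_cell]. *)
Let C4 : R := C1 * (K `^ conj lo * expR m5).
Let C5 : R := c * C4 `^ delta * C4.
Let W5 : R := 2 * (2 * 2 ^+ n) `^ delta.
Let K7 : R := K6 * (2 + W5 * C5).

Definition large_const : R := (K7 * expR (hi * (D * (3 + Mn)))) `^ hi.

Let qilo : qi <= conj lo.
Proof. by case: Hq => _ _ /andP[_]. Qed.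

Lemma norm_power_large : 1 <= l -> Nrm v `^ qi <= K `^ conj lo * expR m5 * l ^+ n.
Proof.
move=> l1; have [N0 _] := HN v0; have q1' := qi1; have K1' := K1.
have pinf1' := pinf1.
have -> : Nrm v `^ qi = K `^ qi * (Nrm v / K) `^ qi.
  rewrite -powRM ?(ltW K0) ?divr_ge0 ?(ltW N0) ?(ltW K0)//.
  by rewrite mulrC divfK// gt_eqF.
rewrite -mulrA; apply: ler_pM; rewrite ?powR_ge0//.
  exact: ler_powR.
apply: norm_power; first by lra.
have -> : (1 - P) * qi - 1 = - (qi * (P - pinf^-1)).
  by rewrite /qi /conjugate_exponent; field; rewrite !gt_eqF//; lra.
rewrite normrN normrM [`|qi|]ger0_norm; last by lra.
rewrite [`|ln l|]ger0_norm ?ln_ge0//.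
have -> : qi * `|P - pinf^-1| * (n%:R * ln l) =
  qi * (n%:R * (`|P - pinf^-1| * ln l)) by ring.
rewrite /m5; apply: ler_pM => //; first by lra.
  by rewrite mulr_ge0// mulr_ge0// ln_ge0.
by rewrite ler_wpM2l// (recip_mean_inf n0 lo1 Hp a HC2 l1).
Qed.

(** Adding [decay x] to the average bounds the logarithm by a multiple of [logmod x], which pays for
    exchanging [pinf] for [p x]. *)
Let avg_power_bound x Av : 0 < Av <= 3 ->
  Av `^ (s / pinf) <= expR (hi * (D * (3 + Mn))) * (Av + decay x) `^ (s / p x).
Proof.
move=> /andP[Av0 Av3]; have pinf1' := pinf1; have s0' := s0; have p1x := p1 x.
have shi : s < hi.
  by have := slo; have /andP[h1 h2] := pinfb; have := lo1; lra.
set A' := Av + decay x; have A'0 : 0 < A' by rewrite ltr_wpDl ?decay_gt0 ?(ltW Av0).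
apply: (@le_trans _ _ (A' `^ (s / pinf))).
  apply: ge0_powR_le; rewrite ?(ltW Av0) ?lerDl//.
  by rewrite divr_ge0//; lra.
apply: powR_compare => //.
have [_ _ _ _ inf] := Hp; have h3 := inf x; have L1 := logmod_ge1 x.
have h1 : `|s / pinf - s / p x| <= hi * `|p x - pinf|.
  have -> : s / pinf - s / p x = s * ((p x - pinf) / (p x * pinf)).
    by field; rewrite !gt_eqF//; lra.
  rewrite normrM [`|s|]gtr0_norm//; apply: ler_pM => //; rewrite ?(ltW s0) ?(ltW shi)//.
  rewrite normrM ler_piMr// ger0_norm ?invr_ge0; last by nra.
  by rewrite invf_le1; nra.
have h2 : `|ln A'| <= 3 + Mn * logmod x.
  have g1 : ln (decay x) <= ln A'.
    by rewrite ler_ln ?posrE ?decay_gt0// lerDr ltW.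
  rewrite ln_decay mulNr -/Mn in g1.
  have g2 : ln A' <= 3.
    have : ln A' <= A' - 1.
      have := @le_ln1Dx R (A' - 1).
      by rewrite (_ : 1 + (A' - 1) = A'); [apply; lra|ring].
    by have := decay_le1 x; rewrite /A'; lra.
  have g3 : 0 <= Mn * logmod x by rewrite mulr_ge0// ltW// logmod_gt0.
  by rewrite ler_norml; apply/andP; split; lra.
apply: le_trans (ler_pM (normr_ge0 _) (normr_ge0 _) h1 h2) _.
rewrite -mulrA; apply: ler_wpM2l; first by lra.
have h4 : `|p x - pinf| <= D by apply: le_trans h3; rewrite ler_peMr.
rewrite mulrDr [leRHS]mulrDr; apply: lerD; first by rewrite ler_wpM2r.
by rewrite mulrCA [leRHS]mulrC ler_wpM2l// ltW.
Qed.

Let K71 : 1 <= K7.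
Proof.
have K61 : 1 <= K6.
  have h1 := expR_ge0 e4; have h2 : 1 <= 2 ^+ n :> R by rewrite exprn_ege1//; lra.
  by have := c0; rewrite /K6; lra.
have C40 : 0 < C4 by rewrite /C4 !mulr_gt0 ?expR_gt0 ?powR_gt0.
have W5C : 0 <= W5 * C5.
  rewrite mulr_ge0//; first by rewrite /W5 mulr_ge0// powR_ge0.
  by rewrite /C5 mulr_ge0 ?(ltW C40)// mulr_ge0 ?(ltW c0)// powR_ge0.
by rewrite /K7; nra.
Qed.

Let large_const_ge x : K7 * expR (hi * (D * (3 + Mn))) <= large_const `^ (p x)^-1.
Proof.
have K71' := K71; have p1x := p1 x.
set E := expR _.
have E1 : 1 <= E.
  rewrite -[leLHS](expR0 R) ler_expR !mulr_ge0//.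
    by have := hi1; lra.
  by rewrite addr_ge0// ltW.
have KE1 : 1 <= K7 * E by nra.
rewrite /large_const -/E -powRrM -[leLHS]powRr1; last by lra.
by apply: ler_powR => //; rewrite ler_pdivlMr ?mul1r//; lra.
Qed.

(** Young's inequality is used twice. Inside a cell [t], [weighted_cell] leaves the product of
    [Nrm t] and a power of the integral [At]. Across the cells, with the constant exponent [pinf],
    the sum is bounded by the total volume, the power integral of the density and the sum of
    [At / Av], each at most a constant times [l ^+ n]. *)
Lemma pointwise_large x Av : 1 <= l ->
  (\int[mu]_(y in node_set v) (fdecay y)%:E = (Av * l ^+ n)%:E)%E ->
  (\int[mu]_(y in node_set v) (w y * f y)%:E <=
    (l ^+ n * (large_const * (Av + decay x) `^ s) `^ (p x)^-1)%:E)%E.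
Proof.
move=> l1 hAv.
have pinf1' := pinf1; have s0' := s0; have s1' := s1; have dl0 := delta0.
have d1' := d1; have K1' := K1; have c0' := c0; have qi1' := qi1.
have C10' := C10; have p1x := p1 x.
have spE : s / pinf * (pinf / s) = 1.
  by field; rewrite !gt_eqF//; lra.
have [J HJ J1] : exists2 J, 1 <= l / 2 ^+ J <= 2 & J = 0%N \/ 1 <= l / 2 ^+ J.
  have [l2|l2] := leP l 1.
    by exists 0%N; [rewrite expr0 divr1 l1/=; lra|left].
  have [J /andP[J1 J2]] := @exists_exprn_between R 2 l ltac:(lra) l2.
  have H : 1 <= l / 2 ^+ J <= 2.
    rewrite ler_pdivlMr ?exprn_gt0// mul1r ler_pdivrMr ?exprn_gt0//.
    by rewrite (ltW J1)/= -exprS.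
  by exists J => //; right; case/andP: H.
have /andP[_ HJ2] := HJ.
have mv := measurable_node v.
have K60 : 0 < K6 by rewrite /K6 !addr_gt0 ?expR_gt0 ?exprn_gt0.
set sg := density q w qi Nrm J v.
have sg0 y : 0 <= sg y by exact: density_ge0.
have msg : measurable_fun setT sg by exact: (measurable_density Hq Hw).
have C40 : 0 < C4 by rewrite /C4 !mulr_gt0 ?expR_gt0 ?powR_gt0.
have C50 : 0 < C5 by rewrite /C5 mulr_gt0// mulr_gt0// powR_gt0.
have W50 : 0 <= W5 by rewrite /W5 mulr_ge0// powR_ge0.
have sgle : (\int[mu]_(y in node_set v) (sg y)%:E <= (C4 * l ^+ n)%:E)%E.
  apply: le_trans (HC1 v0 HJ) _; rewrite lee_fin /C4 -mulrA ler_pM2l//.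
  exact: norm_power_large.
have [u vu _] := at_depth_cover J (node_set_corner v0).
have u0 : 0 < u.2 by rewrite (at_depth_side vu) divr_gt0 ?exprn_gt0.
have [Nu0 hNu] := HN u0.
have intu : (\int[mu]_(y in node_set u) (sg y)%:E = (Nrm u `^ qi)%:E)%E.
  rewrite (eq_integral_set (fun y uy => density_cell qi q w Nrm (ltW v0) vu uy)).
  rewrite (ge0_integralZ_EFin mu (measurable_node u) (measurable_wmod _ mq mw)
    (wmod_ge0 q w _) (powR_ge0 _ _)).
  by rewrite hNu mule1.
have usub := at_depth_sub (ltW v0) vu.
have sgpos : ((Nrm u `^ qi)%:E <= \int[mu]_(y in node_set v) (sg y)%:E)%E.
  rewrite -intu; apply: (ge0_subset_integral mu (measurable_node u) mv _ _ usub).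
    by apply/measurable_EFinP; exact: (measurable_funTS msg).
  by move=> y _; rewrite lee_fin.
have [S intS] : exists S, (\int[mu]_(y in node_set v) (sg y)%:E = S%:E)%E.
  move: sgle sgpos; case: (\int[mu]_(y in node_set v) (sg y)%:E)%E => [r _ _|//|//].
  by exists r.
rewrite intS !lee_fin in sgle sgpos.
have S0 : 0 < S by apply: lt_le_trans sgpos; exact: powR_gt0.
have rh := RH v0 HJ2 J1 S0 intS.
have msgd : measurable_fun setT (fun y => sg y `^ (1 + delta)).
  exact: (measurable_powR_fun msg (measurable_cst _)).
have sgd0 y : 0 <= sg y `^ (1 + delta) by exact: powR_ge0.
have rh5 : (\int[mu]_(y in node_set v) (sg y `^ (1 + delta))%:E <=
    (C5 * l ^+ n)%:E)%E.
  apply: le_trans rh _; rewrite lee_fin /C5 -[X in _ <= X]mulrA.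
  apply: ler_pM => //.
  - by rewrite mulr_ge0 ?powR_ge0// ltW.
  - exact: ltW.
  - rewrite ler_pM2l//; apply: ge0_powR_le; first exact: ltW.
      by rewrite divr_ge0 ?(ltW S0)// ltW.
    by rewrite ler_pdivrMr.
have Av0 : 0 < Av.
  have : (0 < \int[mu]_(y in node_set v) (fdecay y)%:E)%E.
    apply: (integral_gt0 mv); last 2 first.
    - exact: measurable_fdecay.
    - by move=> y; rewrite ltr_wpDl ?fpow_ge0 ?decay_gt0.
    by rewrite /node_set lebesgue_hcube ?(ltW v0)// lte_fin.
  by rewrite hAv lte_fin pmulr_lgt0.
have ln1 : 1 <= l ^+ n by rewrite exprn_ege1.
have K70 : 0 <= K7 by apply: le_trans K71.
have Av3 : Av <= 3.
  have := integral_fdecay_le (ltW v0); rewrite hAv lee_fin /= => h.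
  by rewrite -(ler_pM2r ln0); lra.
set B := Av `^ (s / pinf); have B0 : 0 < B by exact: powR_gt0.
have KB0 : 0 <= K6 * B by rewrite mulr_ge0// ltW.
have m1' : measurable_fun setT (fun y => W5 * sg y `^ (1 + delta)).
  exact: (measurable_funM (measurable_cst _) msgd).
have W50' y : 0 <= W5 * sg y `^ (1 + delta) by rewrite mulr_ge0.
have m2' := measurable_funD (measurable_cst (1 : R)) m1'.
have p2' y : 0 <= 1 + W5 * sg y `^ (1 + delta) by rewrite addr_ge0.
have m3' : measurable_fun setT (fun y => Av^-1 * fdecay y).
  exact: (measurable_funM (measurable_cst _) measurable_fdecay).
have p3' y : 0 <= Av^-1 * fdecay y.
  by rewrite mulr_ge0 ?fdecay_ge0// invr_ge0 ltW.
have m4' := measurable_funD m2' m3'.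
have p4' y : 0 <= 1 + W5 * sg y `^ (1 + delta) + Av^-1 * fdecay y.
  by rewrite addr_ge0.
have Avi0 : 0 <= Av^-1 by rewrite invr_ge0 ltW.
have gE (t : @node R n) : 0 <= t.2 -> (\int[mu]_(y in node_set t)
      (K6 * B * (1 + W5 * sg y `^ (1 + delta) + Av^-1 * fdecay y))%:E =
    (K6 * B)%:E * ((t.2 ^+ n)%:E
      + W5%:E * \int[mu]_(y in node_set t) (sg y `^ (1 + delta))%:E
      + (Av^-1)%:E * \int[mu]_(y in node_set t) (fdecay y)%:E))%E.
  move=> t0; have mt := measurable_node t.
  have c10 (y : T) : 0 <= 1 :> R by [].
  rewrite (ge0_integralZ_EFin mu mt m4' p4' KB0).
  rewrite (ge0_integralD_EFin mu mt m2' p2' m3' p3').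
  rewrite (ge0_integralD_EFin mu mt (measurable_cst _) c10 m1' W50').
  rewrite (ge0_integralZ_EFin mu mt msgd sgd0 W50).
  rewrite (ge0_integralZ_EFin mu mt measurable_fdecay fdecay_ge0 Avi0).
  by rewrite (integral_cst_hcube t.1 _ t0) mul1r.
have cell (t : @node R n) : at_depth J v t ->
    (\int[mu]_(y in node_set t) (w y * f y)%:E <= \int[mu]_(y in node_set t)
      (K6 * B * (1 + W5 * sg y `^ (1 + delta) + Av^-1 * fdecay y))%:E)%E.
  move=> vt; have tE := at_depth_side vt.
  have t12 : 1 <= t.2 <= 2 by rewrite tE.
  have /andP[t1 t2] := t12; have t0 : 0 < t.2 by exact: lt_le_trans t1.
  have [Nt0 _] := HN t0.
  have [At hAt] : exists At, (\int[mu]_(y in node_set t) (fdecay y)%:E = At%:E)%E.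
    have := integral_fdecay_le (ltW t0).
    have : (0 <= \int[mu]_(y in node_set t) (fdecay y)%:E)%E.
      by apply: integral_ge0 => y _; rewrite lee_fin fdecay_ge0.
    case: (\int[mu]_(y in node_set t) (fdecay y)%:E)%E => [r _ _|//|//].
    by exists r.
  have [At0 bt] := weighted_cell t12 hAt.
  apply: le_trans bt _; rewrite (gE _ (ltW t0)).
  have AA0 : 0 <= At / Av by rewrite divr_ge0 ?(ltW At0) ?(ltW Av0).
  (* The exponent [s / pinf] is such that the power [pinf / s] of the second factor is just
     [At / Av], which adds up over the cells. *)
  have y1 := young_improved delta0 lo1 (proj1 (andP pinfb)) (ltW Nt0)
    (powR_ge0 (At / Av) (s / pinf)).
  rewrite -/s -[(_ `^ (s / pinf)) `^ _]powRrM spE in y1.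
  rewrite powRr1// in y1.
  have Bt : Nrm t * At `^ (s / pinf) = B * (Nrm t * (At / Av) `^ (s / pinf)).
    rewrite /B mulrCA -powRM ?(ltW Av0)//; congr (_ * _ `^ _).
    by rewrite mulrC divfK// gt_eqF.
  rewrite hAt Bt mulrA.
  rewrite [(K6 * B * _)%:E]EFinM; apply: lee_wpmul2l; first by rewrite lee_fin.
  apply: (@le_trans _ _ (1 + (Nrm t `^ qi) `^ (1 + delta) + At / Av)%:E).
    by rewrite lee_fin.
  rewrite [(_ + At / Av)%:E]EFinD [(1 + _)%:E]EFinD; apply: leeD; last first.
    by rewrite -EFinM lee_fin mulrC.
  apply: leeD; first by rewrite lee_fin exprn_ege1.
  by apply: (density_power_cell (ltW v0) vt _); rewrite t0.
have wf0 y : 0 <= w y * f y by rewrite mulr_ge0// ltW.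
have KBg0 y : 0 <= K6 * B * (1 + W5 * sg y `^ (1 + delta) + Av^-1 * fdecay y).
  exact: mulr_ge0.
apply: le_trans (tree_le_integral (J := J) (ltW v0) (measurable_funM mw mf) wf0
  (measurable_funM (measurable_cst _) m4') KBg0 cell) _.
rewrite (gE _ (ltW v0)).
apply: (@le_trans _ _ (K7 * B * l ^+ n)%:E).
  have -> : K7 * B * l ^+ n = K6 * B * (l ^+ n + W5 * (C5 * l ^+ n) + l ^+ n).
    by rewrite /K7; ring.
  rewrite [leRHS]EFinM; apply: lee_wpmul2l; first by rewrite lee_fin.
  rewrite [(_ + _ + l ^+ n)%:E]EFinD [(l ^+ n + _)%:E]EFinD; apply: leeD.
    apply: leeD => //; rewrite EFinM; apply: lee_wpmul2l rh5.
    by rewrite lee_fin.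
  by rewrite hAv -EFinM lee_fin mulKf// gt_eqF.
rewrite lee_fin mulrC ler_wpM2l ?(ltW ln0)//.
have Av03 : 0 < Av <= 3 by rewrite Av0.
have hB := avg_power_bound x Av03.
set E := expR _ in hB.
rewrite powRM ?powR_ge0//; apply: le_trans (ler_wpM2l K70 hB) _.
rewrite mulrA -powRrM; apply: ler_wpM2r; first exact: powR_ge0.
exact: large_const_ge.
Qed.

End fixed.
End constants.
End pointwise.

Section pointwise_bound.
Context {R : realType} {n : nat}.
Local Notation T := (euclid R n).
Local Notation mu := (lebesgue R n).
Local Notation conj := conjugate_exponent.

(** [s] and [C] come before [p], [w] and [f], which keeps the final constant uniform. Conjugation
    reverses the bounds, so the weights are handled between [conj hi] and [conj lo]; small and large
    cubes have their own constants, added up in [C]. *)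
Lemma pointwise_bound (lo hi D pinf kappa K : R) : (0 < n)%N -> 1 < lo ->
  lo <= hi -> 0 <= D -> 1 <= kappa -> 1 <= K ->
  exists s, exists2 C, 1 < s < lo /\ 0 < C &
    forall (p w f : T -> R) (a x : T) (l Av : R),
    exponent_class lo hi D pinf p -> weight_class kappa (conj \o p) w ->
    measurable_fun setT f -> (forall y, 0 <= f y) ->
    (\int[mu]_y (f y `^ p y)%:E <= 1)%E -> 0 < l ->
    (\int[mu]_(y in hcube (coordinate a) l) (wmod (conj \o p) w
      (K * (l ^+ n) `^ (1 - recip_mean (EFin \o p) (cube a l))) y)%:E <= 1)%E ->
    cube a l x ->
    (\int[mu]_(y in hcube (coordinate a) l) (f y `^ (p y / s) + decay y)%:E =
      (Av * l ^+ n)%:E)%E ->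
    (\int[mu]_(y in hcube (coordinate a) l) (w y * f y)%:E <=
      (l ^+ n * (C * (Av + decay x) `^ s) `^ (p x)^-1)%:E)%E.
Proof.
move=> n0 lo1 lohi D0 kappa1 K1.
have hi1 : 1 < hi by exact: lt_le_trans lohi.
have chi1 : 1 < conj hi by exact: conjugate_exponent_gt1.
have DD0 : 0 <= D / (lo - 1) ^+ 2 by rewrite divr_ge0// sqr_ge0.
have [delta [c [d0 c0] RH]] := @density_reverse_holder R n (conj hi) (conj lo)
  (D / (lo - 1) ^+ 2) (conj pinf) kappa n0 chi1 kappa1 DD0.
have [beta [C1 [_ C10] HC1]] := @big_density R n (conj hi) (conj lo)
  (D / (lo - 1) ^+ 2) (conj pinf) kappa chi1 kappa1 DD0.
have [C2 C20 HC2] := @integral_decay_fin R n.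
pose s := (1 + delta * lo) / (1 + delta).
have d1 : 0 < 1 + delta by lra.
have slo : 1 < s < lo.
  by apply/andP; split; [rewrite ltr_pdivlMr//; nra|rewrite ltr_pdivrMr//; nra].
pose Cs := @small_const R n lo hi D delta c K.
pose Cl := @large_const R n lo hi D delta c K C1 C2.
have CsE : 0 <= Cs by exact: powR_ge0.
have ClE : 0 <= Cl by exact: powR_ge0.
have CC0 : 0 < 1 + Cs + Cl by lra.
have CsW : 0 <= Cs <= 1 + Cs + Cl by rewrite CsE/=; lra.
have ClW : 0 <= Cl <= 1 + Cs + Cl by rewrite ClE/=; lra.
exists s, (1 + Cs + Cl); first by split.
move=> p w f a x l Av Hp Hw mf f0 fp l0 HB ax hAv.
have [mp plohi _ _ _] := Hp.
have Hq := exponent_class_conjugate lo1 Hp.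
have [mq qb _ _ _] := Hq.
have [Nrm HN] := norm_exists chi1 mq qb Hw.
have RH' v J S := RH _ _ Nrm v J S Hq Hw HN.
have HC1' v J (v0 : 0 < v.2) hJ := (HC1 _ _ Nrm v J Hq Hw HN v0 hJ).1.
have px1 : 1 < p x by have /andP[h _] := plohi x; exact: lt_le_trans h.
have widen (C : R) : 0 <= C <= 1 + Cs + Cl ->
    ((l ^+ n * (C * (Av + decay x) `^ s) `^ (p x)^-1)%:E <=
    (l ^+ n * ((1 + Cs + Cl) * (Av + decay x) `^ s) `^ (p x)^-1)%:E)%E.
  move=> /andP[C0 CC]; rewrite lee_fin ler_wpM2l ?exprn_ge0 ?(ltW l0)//.
  apply: ge0_powR_le; first by rewrite invr_ge0 (le_trans ler01 (ltW px1)).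
    by rewrite mulr_ge0 ?powR_ge0.
  by rewrite ler_wpM2r ?powR_ge0.
have [l1|l1] := leP l 1.
  apply: le_trans (widen Cs CsW).
  exact: (pointwise_small lo1 d0 Hp Hw mf f0 fp HN c0 RH' K1 l0 HB l1 ax hAv).
apply: le_trans (widen Cl ClW).
exact: (pointwise_large n0 lo1 d0 Hp Hw mf f0 fp HN c0 RH' K1 l0 HB C10 HC1' HC2
  x (ltW l1) hAv).
Qed.

End pointwise_bound.

(** * The Hardy-Littlewood maximal function *)

Section strong_type.
Context {R : realType}.

(** The induction carries the second bound [beta ^+ N / beta], valid whichever levels are active. It
    lets an active level [N] dominate all earlier ones, and [hz] compares that level with [z]. *)
Lemma geometric_levels_le (beta z y : R) N : 1 < beta -> (forall j, 2 ^+ j < y -> beta ^+ j <= z) ->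
  0 <= z ->
  (\sum_(0 <= j < N) beta ^+ j * (2 ^+ j < y)%R%:R) * (1 - beta^-1) <= z.
Proof.
move=> b1 hz z0; have b0 : 0 < beta by lra.
have bi : beta^-1 < 1 by rewrite invf_lt1.
have bi0 : 0 < beta^-1 by rewrite invr_gt0.
suff : (\sum_(0 <= j < N) beta ^+ j * (2 ^+ j < y)%R%:R) * (1 - beta^-1) <= z /\
  (\sum_(0 <= j < N) beta ^+ j * (2 ^+ j < y)%R%:R) * (1 - beta^-1) <= beta ^+ N * beta^-1.
  by case.
elim: N => [|N [IH1 IH2]].
  by rewrite big_geq// mul0r; split => //; rewrite mulr_ge0 ?exprn_ge0 ?ltW.
rewrite big_nat_recr//= exprSr mulfK ?gt_eqF//.
have bN : 0 < beta ^+ N by rewrite exprn_gt0.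
case: (ltP (2 ^+ N) y) => hy; last first.
  rewrite mulr0 addr0; split => //; apply: le_trans IH2 _.
  by rewrite ler_piMr// ltW.
rewrite mulr1 mulrDl.
have h : (\sum_(0 <= j < N) beta ^+ j * (2 ^+ j < y)%R%:R) * (1 - beta^-1)
    + beta ^+ N * (1 - beta^-1) <= beta ^+ N by lra.
by split => //; apply: le_trans h _; exact: hz.
Qed.

(* Layer cake over the levels eps * 2^j: the tail sets of M are controlled by
   the part of F above half the level, and the resulting sum over j is
   geometric. *)
Lemma strong_type (A s : R) : 0 < A -> 1 < s -> exists2 C, 0 < C &
  forall d (T : measurableType d) (mu : {measure set T -> \bar R}) (M F : T -> R)
    (eps : R), measurable_fun setT M -> measurable_fun setT F ->
    (forall x, 0 <= F x) -> 0 < eps -> (forall x, M x = 0 \/ eps < M x) ->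
    (forall t, (0 < t)%R -> mu [set x | (t < M x)%R] <=
      (A / t)%:E * \int[mu]_(x in [set x | (t < 2 * F x)%R]) (F x)%:E)%E ->
    (\int[mu]_x (M x `^ s)%:E <= C%:E * \int[mu]_x (F x `^ s)%:E)%E.
Proof.
move=> A0 s1.
set beta : R := 2 `^ (s - 1).
have ln2 : 0 < ln 2 :> R by rewrite ln_gt0//; lra.
have b1 : 1 < beta by rewrite /beta gt0_powRE// expR_gt1 mulr_gt0//; lra.
have b0 : 0 < beta by lra.
have bi : 0 < 1 - beta^-1 by rewrite subr_gt0 invf_lt1.
have s2 : 0 < 2 `^ s :> R by exact: powR_gt0.
pose C := A * 2 `^ s * beta / (1 - beta^-1).
have C0 : 0 < C by rewrite /C divr_gt0// !mulr_gt0.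
exists C => // d T mu M F eps mM mF F0 e0 hM weak.
have es0 : 0 < eps `^ s by exact: powR_gt0.
have mlev (g : T -> R) t : measurable_fun setT g -> measurable [set x | t < g x].
  move=> mg; rewrite [X in measurable X](_ : _ = g @^-1` `]t, +oo[%classic).
    by rewrite -[X in measurable X]setTI; exact: mg.
  by apply/seteqP; split => x /=; rewrite in_itv/= andbT.
pose E j := [set x | eps * 2 ^+ j < M x].
have mE j : measurable (E j) by exact: mlev.
have p2 j : 0 < 2 ^+ j :> R by rewrite exprn_gt0.
have e2 j : 0 < eps * 2 ^+ j by rewrite mulr_gt0.
pose G j := [set x | eps * 2 ^+ j < 2 * F x].
have mG j : measurable (G j) by apply: mlev; exact: (measurable_funM (measurable_cst _) mF).
pose u j x := (eps `^ s * (2 `^ s) ^+ j.+1 * \1_(E j) x).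
have k0 j : 0 <= eps `^ s * (2 `^ s) ^+ j.+1.
  by rewrite mulr_ge0 ?exprn_ge0// ltW.
have u0 j x : 0 <= u j x by rewrite /u mulr_ge0// indicE.
have mu_ j : measurable_fun setT (u j).
  by apply: (measurable_funM (measurable_cst _)); exact: measurable_indic.
have pt x : ((M x `^ s)%:E <= \sum_(j <oo) (u j x)%:E)%E.
  have [-> |hx] := hM x.
    rewrite powR0; last by rewrite gt_eqF//; lra.
    by apply: nneseries_ge0 => j _ _; rewrite lee_fin.
  have y1 : 1 < M x / eps by rewrite ltr_pdivlMr// mul1r.
  have [j /andP[j1 j2]] := @exists_exprn_between R 2 (M x / eps) ltac:(lra) y1.
  apply: (@le_trans _ _ (u j x)%:E); last first.
    by apply: (@nneseries_ge_term R (fun j => (u j x)%:E)) => i; rewrite lee_fin.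
  have Ex : x \in E j by apply/mem_set; rewrite /E /= mulrC -ltr_pdivlMr.
  rewrite lee_fin /u indicE Ex mulr1.
  have -> : M x = eps * (M x / eps) by field; rewrite gt_eqF.
  have y0 : 0 <= M x / eps by lra.
  rewrite powRM ?(ltW e0)// ler_pM2l// -powR_mulrn ?(ltW s2)// -powRrM [s * _]mulrC powRrM.
  rewrite powR_mulrn//; apply: ge0_powR_le => //; lra.
apply: (@le_trans _ _ (\int[mu]_x (\sum_(j <oo) (u j x)%:E)))%E.
  by apply: ge0_le_integralW => x _; rewrite ?lee_fin ?powR_ge0.
rewrite integral_nneseries//; last 2 first.
- by move=> j; apply/measurable_EFinP.
- by move=> j x _; rewrite lee_fin.
pose v j x := (eps `^ s * (2 `^ s) ^+ j.+1 * (A / (eps * 2 ^+ j))) * (\1_(G j) x * F x).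
have kv j : 0 <= eps `^ s * (2 `^ s) ^+ j.+1 * (A / (eps * 2 ^+ j)).
  by rewrite mulr_ge0// divr_ge0 ?(ltW A0)// ltW.
have mGF j : measurable_fun setT (fun x => \1_(G j) x * F x).
  by apply: measurable_funM => //; exact: measurable_indic.
have GF0 j x : 0 <= \1_(G j) x * F x by rewrite mulr_ge0// indicE.
have v0 j x : 0 <= v j x by rewrite /v mulr_ge0.
have mv j : measurable_fun setT (v j) by exact: (measurable_funM (measurable_cst _) (mGF j)).
have uv j : (\int[mu]_x (u j x)%:E <= \int[mu]_x (v j x)%:E)%E.
  have mI : measurable_fun setT (\1_(E j) : T -> R) by exact: measurable_indic.
  have I0 x : 0 <= \1_(E j) x :> R by rewrite indicE.
  rewrite (ge0_integralZ_EFin mu measurableT mI I0 (k0 j)).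
  rewrite (ge0_integralZ_EFin mu measurableT (mGF j) (GF0 j) (kv j)).
  rewrite integral_indic// setIT [in leRHS]EFinM -muleA; apply: lee_wpmul2l.
    by rewrite lee_fin.
  apply: le_trans (weak _ (e2 j)) _; apply: lee_wpmul2l.
    by rewrite lee_fin divr_ge0 ?(ltW A0)// ltW.
  rewrite integral_mkcond; apply: ge0_le_integralW => x _.
    by rewrite patchE; case: ifP => _; rewrite ?lee_fin.
  rewrite patchE -/(G j) indicE; case: ifP => _; rewrite ?mul1r ?mul0r//.
apply: nneseries_ub => [j|N]; first by apply: integral_ge0 => x _; rewrite lee_fin.
apply: (@le_trans _ _ (\sum_(0 <= j < N) \int[mu]_x (v j x)%:E))%E.
  by apply: lee_sum => j _; exact: uv.
rewrite -ge0_integral_sum//; last 2 first.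
- by move=> j; apply/measurable_EFinP.
- by move=> j x _; rewrite lee_fin.
have mFs : measurable_fun setT (fun x => F x `^ s).
  exact: (measurable_powR_fun mF (measurable_cst _)).
have Fs0 x : 0 <= F x `^ s by exact: powR_ge0.
rewrite -(ge0_integralZ_EFin mu measurableT mFs Fs0 (ltW C0)).
apply: ge0_le_integralW => x _; first by rewrite sumEFin lee_fin; apply: sumr_ge0.
rewrite sumEFin lee_fin.
have [Fx0|Fx0] := eqVneq (F x) 0.
  rewrite big1; first by rewrite mulr_ge0 ?(ltW C0).
  by move=> j _; rewrite /v Fx0 !mulr0.
have Fx : 0 < F x by rewrite lt_neqAle eq_sym Fx0/=.
set y := 2 * F x / eps.
have y0 : 0 < y by rewrite /y divr_gt0// mulr_gt0.
have hy j : 2 ^+ j < y -> beta ^+ j <= y `^ (s - 1).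
  move=> jy; rewrite -powR_mulrn ?(ltW b0)// /beta -powRrM mulrC powRrM powR_mulrn//.
  apply: ge0_powR_le; [lra|exact: ltW|exact: ltW].
have := geometric_levels_le N b1 hy (powR_ge0 _ _).
rewrite -ler_pdivlMr// => h.
have -> : \sum_(0 <= j < N) v j x =
    (eps `^ (s - 1) * A * 2 `^ s * F x) * \sum_(0 <= j < N) beta ^+ j * (2 ^+ j < y)%R%:R.
  rewrite mulr_sumr; apply: eq_bigr => j _.
  have -> : (2 ^+ j < y) = (x \in G j).
    rewrite /y ltr_pdivlMr// mulrC; apply/idP/idP => [h1|/set_mem//].
    exact/mem_set.
  rewrite /v indicE.
  have -> : eps `^ s = eps * eps `^ (s - 1) by rewrite mulr_powRB1//; lra.
  have -> : beta ^+ j = (2 `^ s) ^+ j / 2 ^+ j.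
    rewrite /beta powRB; last by rewrite gt_eqF// implybT.
    by rewrite powRr1// expr_div_n.
  by rewrite exprS; field; rewrite !gt_eqF.
apply: le_trans (ler_wpM2l _ h) _.
  by rewrite !mulr_ge0 ?powR_ge0// ltW.
rewrite le_eqVlt; apply/orP; left; apply/eqP.
have -> : F x `^ s = F x * F x `^ (s - 1) by rewrite mulr_powRB1//; lra.
have -> : y `^ (s - 1) = beta * F x `^ (s - 1) / eps `^ (s - 1).
  rewrite /y powRM ?mulr_ge0 ?invr_ge0 ?(ltW e0)// powRM// powR_inv//.
rewrite /C; field.
by rewrite !gt_eqF ?powR_gt0//; lra.
Qed.

End strong_type.

(** * A Vitali covering estimate for finitely many cubes *)

Section covering.
Context {R : realType} {n : nat}.
Local Notation T := (euclid R n).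
Local Notation mu := (lebesgue R n).
Implicit Types (x y : T) (v : @node R n) (F G : T -> R).

Definition node_union (N : nat -> @node R n) (r : seq nat) : set T :=
  \bigcup_(k in [set` r]) node_set (N k).

Lemma measurable_node_union N r : measurable (node_union N r).
Proof. by apply: bigcup_measurable => k _; exact: measurable_node. Qed.

Lemma exists_max_side (N : nat -> @node R n) (r : seq nat) : r != [::] ->
  exists2 k, k \in r & forall i, i \in r -> (N i).2 <= (N k).2.
Proof.
elim: r => [//|k [|j r] IH] _.
  by exists k; rewrite ?mem_head// => i; rewrite inE => /eqP ->.
have [m mr hm] := IH isT.
have [h|h] := leP (N m).2 (N k).2.
  exists k; first exact: mem_head.
  move=> i; rewrite inE => /predU1P[-> //|ir].
  exact: le_trans (hm _ ir) h.
exists m; first by rewrite inE mr orbT.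
by move=> i; rewrite inE => /predU1P[->|ir]; [exact: ltW|exact: hm].
Qed.

Definition node_triple v : @node R n := (fun i => v.1 i - v.2, 3 * v.2).

Lemma node_sub_triple v u : u.2 <= v.2 -> node_set u `&` node_set v !=set0 ->
  node_set u `<=` node_set (node_triple v).
Proof.
move=> uv [z [zu zv]] x xu i.
have /andP[h1 h2] := zu i; have /andP[h3 h4] := zv i; have /andP[h5 h6] := xu i.
by rewrite /=; apply/andP; split; lra.
Qed.

(** A largest cube is selected, the cubes meeting it lie in its triple and are discarded, and
    induction treats the others. These are disjoint from the selected cube, so the two integrals add
    up inside the whole union. *)
Lemma vitali_measure (N : nat -> @node R n) G (t : R) : 0 <= t ->
  (forall k, 0 < (N k).2) -> measurable_fun setT G -> (forall x, 0 <= G x) ->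
  forall r, (forall k, k \in r ->
    ((t * (N k).2 ^+ n)%:E <= \int[mu]_(x in node_set (N k)) (G x)%:E)%E) ->
  (t%:E * mu (node_union N r) <=
    (3 ^+ n)%:E * \int[mu]_(x in node_union N r) (G x)%:E)%E.
Proof.
move=> t0 N0 mG G0 r.
have int0 A : (0 <= \int[mu]_(x in A) (G x)%:E)%E.
  by apply: integral_ge0 => x _; rewrite lee_fin.
have [m] := ubnP (size r); elim: m r => [//|m IH] r rm hr.
have [->|rn] := eqVneq r [::].
  rewrite [X in mu X](_ : _ = set0) ?measure0 ?mule0 ?mule_ge0//.
  by apply/seteqP; split => x // [k /=]; rewrite in_nil.
have [k0 k0r hk0] := exists_max_side N rn.
pose P k := `[< node_set (N k) `&` node_set (N k0) !=set0 >].
pose r1 := [seq k <- r | ~~ P k].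
have Pk0 : P k0.
  apply/asboolP; exists (point (N k0).1); rewrite setIid.
  exact: node_set_corner.
have sr1 : (size r1 < m)%N.
  rewrite -ltnS; apply: leq_trans rm; rewrite ltnS size_filter.
  rewrite -(count_predC (fun k => ~~ P k)) /= -addn1 leq_add2l -has_count.
  by apply/hasP; exists k0 => //=; rewrite negbK.
have hr1 k : k \in r1 -> k \in r by rewrite mem_filter => /andP[].
have IH1 := IH r1 sr1 (fun k kr => hr k (hr1 k kr)).
set U1 := node_union N r1; set B := node_set (N k0).
set U := node_union N r; set B3 := node_set (node_triple (N k0)).
have mU1 : measurable U1 by exact: measurable_node_union.
have mU : measurable U by exact: measurable_node_union.
have mB : measurable B by exact: measurable_node.
have mB3 : measurable B3 by exact: measurable_node.
have UB : U `<=` B3 `|` U1.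
  move=> x [k /= kr kx]; have [pk|pk] := boolP (P k).
    left; apply: (node_sub_triple (hk0 _ kr) _ kx).
    exact/asboolP.
  by right; exists k => //=; rewrite mem_filter pk.
have B1 : B `&` U1 = set0.
  rewrite -subset0 => x [Bx [k /=]]; rewrite mem_filter => /andP[/asboolPn pk _] kx.
  by apply: pk; exists x.
have B1U : B `|` U1 `<=` U.
  move=> x [Bx|[k kr kx]]; first by exists k0.
  by exists k => //=; apply: hr1.
have muB3 : mu B3 = ((3 ^+ n) * (N k0).2 ^+ n)%:E.
  rewrite lebesgue_hcube -?exprMn// mulr_ge0// ltW//.
have n3 : (0 <= (3 ^+ n)%:E :> \bar R)%E by rewrite lee_fin exprn_ge0.
apply: (@le_trans _ _ (t%:E * (mu B3 + mu U1))%E).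
  apply: lee_wpmul2l; first by rewrite lee_fin.
  apply: le_trans _ (measureU2 mu mB3 mU1).
  by apply: le_measure => //; rewrite inE//; exact: measurableU.
rewrite muleDr; last 2 first.
- by [].
- by apply: ge0_adde_def; rewrite inE.
apply: (@le_trans _ _ ((3 ^+ n)%:E * (\int[mu]_(x in B) (G x)%:E
    + \int[mu]_(x in U1) (G x)%:E))%E).
  rewrite ge0_muleDr//; apply: leeD => //.
  rewrite muB3 -EFinM mulrCA EFinM; apply: lee_wpmul2l => //.
  exact: hr.
apply: lee_wpmul2l => //; rewrite -(ge0_integralU_EFin mu mB mU1 mG G0 B1).
have mGU : measurable_fun U (EFin \o G).
  by apply/measurable_EFinP; exact: (measurable_funTS mG).
apply: (ge0_subset_integral mu (measurableU _ _ mB mU1) mU mGU _ B1U) => x _.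
by rewrite lee_fin.
Qed.

End covering.

(** * The maximal function over a countable grid *)

Section grid.
Context {R : realType} {n : nat}.
Local Notation T := (euclid R n).
Local Notation mu := (lebesgue R n).
Implicit Types (x y : T) (F G : T -> R).

(* Countably many half-open cubes of dyadic sides 2h with corners on the grid
   h Z^n; any cube of side at most h lies in one of them. *)
Definition grid_node (k : nat) : @node R n :=
  if unpickle k is Some (j1, j2, z) then
    let h := 2 ^+ j1 / 2 ^+ j2 in
    (fun i => h * ((z : {ffun 'I_n -> int}) i)%:~R, 2 * h)
  else (fun=> 0, 1).

Lemma grid_node_gt0 k : 0 < (grid_node k).2.
Proof.
rewrite /grid_node; case: unpickle => [[[j1 j2] z]|]//=.
Qed.

Lemma dyadic_between (l : R) : 0 < l -> exists j1 j2 : nat,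
  l <= 2 ^+ j1 / 2 ^+ j2 <= 2 * l.
Proof.
move=> l0; have [l1|l1|->] := ltgtP l 1.
- have [m /andP[m1 m2]] := @exists_exprn_between R 2 l^-1 ltac:(lra)
    ltac:(by rewrite invf_gt1).
  exists 0%N, m; rewrite expr0 mul1r; apply/andP; split.
    rewrite -[leLHS]invrK lef_pV2 ?posrE ?exprn_gt0 ?invr_gt0//; exact: ltW.
  rewrite -(invrK (2 * l)) lef_pV2 ?posrE ?exprn_gt0 ?invr_gt0 ?mulr_gt0//.
  by rewrite invfM mulrC ler_pdivrMr// mulrC -exprS.
- have [m /andP[m1 m2]] := @exists_exprn_between R 2 l ltac:(lra) l1.
  exists m.+1, 0%N; rewrite expr0 divr1 m2 exprS ler_pM2l//; exact: ltW.
- by exists 0%N, 0%N; rewrite !expr0 divr1 lexx/=; lra.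
Qed.

Lemma grid_cover (a x : T) (l : R) : 0 < l -> cube a l x ->
  exists k, [/\ node_set (grid_node k) x,
    hcube (coordinate a) l `<=` node_set (grid_node k) &
    (grid_node k).2 <= 4 * l].
Proof.
move=> l0 ax; have [j1 [j2 /andP[h1 h2]]] := dyadic_between l0.
set h := 2 ^+ j1 / 2 ^+ j2 in h1 h2.
have h0 : 0 < h by lra.
pose z : {ffun 'I_n -> int} := [ffun i => Num.floor (coordinate a i / h)].
exists (pickle (j1, j2, z)).
have zb i : h * (z i)%:~R <= coordinate a i < h * (z i)%:~R + h.
  rewrite ffunE; have /andP[f1 f2] := floor_itv (coordinate a i / h).
  rewrite ler_pdivlMr// in f1; rewrite ltr_pdivrMr// intrD in f2.
  by apply/andP; split; lra.
rewrite /grid_node pickleK /= -/h; split; last by lra.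
  move=> i; have /andP[z1 z2] := zb i; have /andP[x1 x2] := ax i.
  by rewrite /= -/h; apply/andP; split; lra.
move=> y hy i; have /andP[z1 z2] := zb i; have /andP[x1 x2] := hy i.
by rewrite /= -/h; apply/andP; split; lra.
Qed.

Section maximal.
Variables (F : T -> R) (avg : nat -> R).
Hypotheses (mF : measurable_fun setT F) (F0 : forall x, 0 <= F x)
  (avgE : forall k, (\int[mu]_(x in node_set (grid_node k)) (F x)%:E =
    (avg k * (grid_node k).2 ^+ n)%:E)%E).

Let avg0 k : 0 <= avg k.
Proof.
have : (0 <= (avg k * (grid_node k).2 ^+ n)%:E)%E.
  by rewrite -avgE; apply: integral_ge0 => x _; rewrite lee_fin.
by rewrite lee_fin pmulr_lge0// exprn_gt0// grid_node_gt0.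
Qed.

Fixpoint grid_max (J : nat) x : R :=
  if J is J'.+1 then
    Num.max (grid_max J' x) (avg J' * \1_(node_set (grid_node J')) x)
  else 0.

Lemma measurable_grid_max J : measurable_fun setT (grid_max J).
Proof.
elim: J => [|J IH] /=; first exact: measurable_cst.
apply: measurable_maxr IH _; apply: measurable_funM; first exact: measurable_cst.
exact: (measurable_indic (measurable_node _)).
Qed.

Lemma grid_max_ge0 J x : 0 <= grid_max J x.
Proof. by elim: J => [|J IH] //=; rewrite le_max IH. Qed.

Lemma grid_max_nondecreasing x : nondecreasing_seq (grid_max ^~ x).
Proof. by apply/nondecreasing_seqP => J /=; rewrite le_max lexx. Qed.

Lemma grid_max_ge k x : node_set (grid_node k) x -> avg k <= grid_max k.+1 x.
Proof.
by move=> kx; rewrite /= le_max indicE mem_set// mulr1 lexx orbT.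
Qed.

(** [strong_type] needs a lowest level, which a maximum of finitely many values has; its constant
    does not involve [eps], so the gap may shrink as [J] grows. *)
Lemma grid_max_gap J : exists2 eps, 0 < eps &
  forall x, grid_max J x = 0 \/ eps < grid_max J x.
Proof.
elim: J => [|J [e e0 IH]] /=; first by exists 1 => // x; left.
have [aJ|aJ] := eqVneq (avg J) 0.
  by exists e => // x; rewrite aJ mul0r max_l ?grid_max_ge0.
have aJ0 : 0 < avg J by rewrite lt_neqAle eq_sym aJ avg0.
exists (Num.min e (avg J / 2)); first by rewrite lt_min e0 divr_gt0.
move=> x; have [h|h] := IH x; last first.
  by right; rewrite lt_max gt_min; apply/orP; left; apply/orP; left.
rewrite h indicE; case: (x \in _); last by left; rewrite mulr0 maxxx.
right; rewrite mulr1 lt_max; apply/orP; right; rewrite gt_min; apply/orP; right; lra.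
Qed.

Lemma grid_max_level J t : 0 <= t -> [set x | t < grid_max J x] =
  node_union grid_node [seq k <- iota 0 J | t < avg k].
Proof.
move=> t0; elim: J => [|J IH].
  apply/seteqP; split => x /=; first by move=> /lt_geF; rewrite t0.
  by move=> [k /=]; rewrite in_nil.
rewrite -addn1 iotaD add0n filter_cat /node_union.
apply/seteqP; split => x /=.
  rewrite addn1 /= lt_max => /orP[h|].
    have : [set x | t < grid_max J x] x by [].
    rewrite IH => -[k /= kr kx]; exists k => //=.
    by rewrite mem_cat kr.
  rewrite indicE; case: (boolP (x \in _)) => [xJ|_]; last first.
    by rewrite mulr0 => /lt_geF; rewrite t0.
  rewrite mulr1 => tJ; exists J; last exact/set_mem.
  by rewrite /= mem_cat tJ mem_head orbT.
move=> [k /=]; rewrite mem_cat addn1 /= lt_max => /orP[kr kx|].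
  have : node_union grid_node [seq k <- iota 0 J | t < avg k] x by exists k.
  by rewrite -IH /= => ->.
case: ifP => // tJ; rewrite inE => /eqP -> kx.
by rewrite indicE mem_set// mulr1 tJ orbT.
Qed.

(** [G] drops the values of [F] up to [t / 2], which takes at most [t / 2] from an average exceeding
    [t]. The cubes selected at level [t] therefore satisfy the hypothesis of [vitali_measure] for
    [G] and [t / 2]. *)
Lemma grid_max_weak J t : 0 < t ->
  (mu [set x | (t < grid_max J x)%R] <= (2 * 3 ^+ n / t)%:E *
    \int[mu]_(x in [set x | (t < 2 * F x)%R]) (F x)%:E)%E.
Proof.
move=> t0; rewrite (grid_max_level _ (ltW t0)).
set r := [seq _ <- _ | _]; set E := [set x | t < 2 * F x].
have mE : measurable E.
  rewrite [X in measurable X](_ : _ = (fun x => 2 * F x) @^-1` `]t, +oo[%classic).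
    rewrite -[X in measurable X]setTI.
    by apply: (measurable_funM (measurable_cst _) mF).
  by apply/seteqP; split => x /=; rewrite in_itv/= andbT.
pose G x := \1_E x * F x.
have mG : measurable_fun setT G.
  by apply: measurable_funM => //; exact: measurable_indic.
have G0 x : 0 <= G x by rewrite mulr_ge0// indicE.
have GF x : F x <= G x + t / 2.
  rewrite /G indicE; case: (boolP (x \in E)) => [_|/negP xE].
    by rewrite mul1r; lra.
  rewrite mul0r add0r leNgt; apply/negP => h; apply: xE; apply/mem_set.
  by rewrite /E /=; lra.
have t2 : 0 <= t / 2 by lra.
have hr k : k \in r -> ((t / 2 * (grid_node k).2 ^+ n)%:E <=
    \int[mu]_(x in node_set (grid_node k)) (G x)%:E)%E.
  rewrite mem_filter => /andP[tk _].
  have s0 := grid_node_gt0 k; set v := grid_node k in s0 *.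
  have sn0 : 0 < v.2 ^+ n by rewrite exprn_gt0.
  have : (\int[mu]_(x in node_set v) (F x)%:E <=
      \int[mu]_(x in node_set v) (G x + t / 2)%:E)%E.
    by apply: ge0_le_integralW => x _; rewrite lee_fin.
  have c0 (x : T) : 0 <= t / 2 by [].
  rewrite (ge0_integralD_EFin mu (measurable_node v) mG G0 (measurable_cst _) c0).
  rewrite (integral_cst_hcube v.1 _ (ltW s0)) avgE -/v; clear c0.
  have : (0 <= \int[mu]_(x in node_set v) (G x)%:E)%E.
    by apply: integral_ge0 => x _; rewrite lee_fin.
  case: (\int[mu]_(x in node_set v) (G x)%:E)%E => [g g0|_ _|//]; last by rewrite leey.
  rewrite -EFinD !lee_fin => h.
  have : t * v.2 ^+ n <= avg k * v.2 ^+ n by rewrite ler_wpM2r// ltW.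
  by lra.
have := vitali_measure t2 grid_node_gt0 mG G0 hr.
set m := mu _; set I := (\int[mu]_(x in _) (F x)%:E)%E => h.
have I1 : (\int[mu]_(x in node_union grid_node r) (G x)%:E <= I)%E.
  rewrite /I [leRHS]integral_mkcond [leLHS]integral_mkcond.
  apply: ge0_le_integralW => x _.
    by rewrite patchE; case: ifP => _; rewrite ?lee_fin.
  rewrite !patchE /G indicE; case: ifP => _; case: (x \in E);
    by rewrite ?mul1r ?mul0r// lee_fin.
have h2 : ((t / 2)%:E * m <= (3 ^+ n)%:E * I)%E.
  by apply: le_trans h _; apply: lee_wpmul2l => //; rewrite lee_fin exprn_ge0.
have -> : 2 * 3 ^+ n / t = (t / 2)^-1 * 3 ^+ n by field; rewrite gt_eqF.
by rewrite EFinM -muleA lee_pdivlMl ?divr_gt0.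
Qed.

End maximal.

(** [G] is the supremum over [J] of the powers of the maximal functions of the first [J] grid cubes,
    hence measurable, and monotone convergence carries the bound over. The factor [4 ^+ n] is the
    volume lost in enlarging a cube to a grid cube. *)
Lemma maximal_bound (s : R) : 1 < s -> exists2 C, 0 < C &
  forall F, measurable_fun setT F -> (forall x, 0 <= F x) ->
    (forall v : @node R n, (0 < v.2)%R -> \int[mu]_(x in node_set v) (F x)%:E < +oo)%E ->
    exists G : T -> \bar R, [/\ measurable_fun setT G, forall x, (0 <= G x)%E,
      (\int[mu]_x G x <= C%:E * \int[mu]_x (F x `^ s)%:E)%E &
      forall a l x Av, 0 < l -> cube a l x ->
        (\int[mu]_(y in hcube (coordinate a) l) (F y)%:E = (Av * l ^+ n)%:E)%E ->
        (((Av / 4 ^+ n) `^ s)%:E <= G x)%E].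
Proof.
move=> s1; have A0 : 0 < 2 * 3 ^+ n :> R by rewrite mulr_gt0// exprn_gt0.
have [C C0 HC] := strong_type A0 s1.
exists C => // F mF F0 Ffin.
have H k : exists a : R, (\int[mu]_(x in node_set (grid_node k)) (F x)%:E =
    (a * (grid_node k).2 ^+ n)%:E)%E.
  have s0 := grid_node_gt0 k; have sn0 : 0 < (grid_node k).2 ^+ n by rewrite exprn_gt0.
  have : (0 <= \int[mu]_(x in node_set (grid_node k)) (F x)%:E)%E.
    by apply: integral_ge0 => x _; rewrite lee_fin.
  have := Ffin _ s0; case: (\int[mu]_(x in _) (F x)%:E)%E => [r _ _|//|//].
  by exists (r / (grid_node k).2 ^+ n); rewrite divfK// gt_eqF.
have [avg avgE] := choice H.
pose g J x : \bar R := (grid_max avg J x `^ s)%:E.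
have g0 J x : (0 <= g J x)%E by rewrite lee_fin powR_ge0.
have mg J : measurable_fun setT (g J).
  apply/measurable_EFinP.
  exact: (measurable_powR_fun (measurable_grid_max avg J) (measurable_cst _)).
have s0 : 0 <= s by lra.
have ndg x : nondecreasing_seq (g ^~ x).
  move=> i j ij; rewrite lee_fin; apply: ge0_powR_le => //.
    exact: grid_max_ge0.
  exact: grid_max_nondecreasing.
have cvg x : g ^~ x @ \oo --> ereal_sup (range (g ^~ x)).
  exact: ereal_nondecreasing_cvgn.
exists (fun x => ereal_sup (range (g ^~ x))); split.
- by apply: (emeasurable_fun_cvg g) => // x _; exact: cvg.
- by move=> x; apply: le_trans (g0 0%N x) _; apply: ereal_sup_ubound; exists 0%N.
- have -> : (\int[mu]_x ereal_sup (range (g ^~ x)) =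
      \int[mu]_x limn (g ^~ x))%E.
    by apply: eq_integral => x _; apply/esym/cvg_lim => //; exact: cvg.
  rewrite (monotone_convergence mu measurableT mg (fun J x _ => g0 J x)
    (fun x _ => ndg x)).
  apply: lime_le.
    apply: ereal_nondecreasing_is_cvgn => i j ij.
    by apply: ge0_le_integralW => x _; [exact: g0|exact: ndg].
  apply: nearW => J; rewrite /g.
  have [eps e0 gap] := grid_max_gap F0 avgE J.
  apply: (HC _ _ _ _ _ eps (measurable_grid_max avg J) mF F0 e0 gap).
  by move=> t t0; exact: (grid_max_weak mF F0 avgE).
move=> a l x Av l0 ax hAv.
have [k [kx ka k4]] := grid_cover l0 ax.
apply: (@le_trans _ _ (g k.+1 x)); last by apply: ereal_sup_ubound; exists k.+1.
have ln0 : 0 < l ^+ n by rewrite exprn_gt0.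
have Av0 : 0 <= Av.
  have : (0 <= (Av * l ^+ n)%:E)%E.
    by rewrite -hAv; apply: integral_ge0 => y _; rewrite lee_fin.
  by rewrite lee_fin pmulr_lge0.
rewrite lee_fin; apply: ge0_powR_le => //; first by rewrite divr_ge0// exprn_ge0.
apply: le_trans (grid_max_ge avg kx).
have h : Av * l ^+ n <= avg k * (grid_node k).2 ^+ n.
  rewrite -lee_fin -hAv -avgE.
  apply: (ge0_subset_integral mu (measurable_hcube _ _) (measurable_node _) _ _ ka).
    by apply/measurable_EFinP; exact: (measurable_funTS mF).
  by move=> y _; rewrite lee_fin.
have avg0 : 0 <= avg k.
  have : 0 <= avg k * (grid_node k).2 ^+ n by apply: le_trans h; rewrite mulr_ge0// ltW.
  by rewrite pmulr_lge0// exprn_gt0// grid_node_gt0.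
rewrite ler_pdivrMr ?exprn_gt0// -(ler_pM2r ln0); apply: le_trans h _.
rewrite -mulrA ler_wpM2l// -exprMn; apply: lerXn2r => //; rewrite nnegrE.
  exact: ltW (grid_node_gt0 k).
by rewrite mulr_ge0// ltW.
Qed.

End grid.

(** * Hermitian matrices as real self-adjoint operators *)

Section scalars.
Context {R : realType} {K : scalars}.
Local Notation F := (scalar_field R K).
Implicit Types (x y z : F) (r : R).

(** In the real case the second argument is dropped, hence the side condition of [scalar_im_of]. *)
Definition scalar_of (r s : R) : F :=
  match K return scalar_field R K with
  | RealScalars => r
  | ComplexScalars => Complex r s
  end.

Lemma scalar_reD x y : scalar_re (x + y) = scalar_re x + scalar_re y.
Proof. by case: K x y => //= -[a b] [c d]. Qed.

Lemma scalar_imD x y : scalar_im (x + y) = scalar_im x + scalar_im y.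
Proof. by case: K x y => [x y|[a b] [c d]] //=; rewrite addr0. Qed.

Lemma scalar_reM x y :
  scalar_re (x * y) = scalar_re x * scalar_re y - scalar_im x * scalar_im y.
Proof. by case: K x y => [x y|[a b] [c d]] //=; rewrite mulr0 subr0. Qed.

Lemma scalar_imM x y :
  scalar_im (x * y) = scalar_re x * scalar_im y + scalar_im x * scalar_re y.
Proof. by case: K x y => [x y|[a b] [c d]] //=; rewrite mulr0 mul0r addr0. Qed.

Lemma scalar_re_conj x : scalar_re (scalar_conj x) = scalar_re x.
Proof. by case: K x => [x|[a b]]. Qed.

Lemma scalar_im_conj x : scalar_im (scalar_conj x) = - scalar_im x.
Proof. by case: K x => [x|[a b]] //=; rewrite oppr0. Qed.

Lemma scalar_re0 : scalar_re (0 : F) = 0. Proof. by case: K. Qed.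
Lemma scalar_im0 : scalar_im (0 : F) = 0. Proof. by case: K. Qed.
Lemma scalar_re1 : scalar_re (1 : F) = 1. Proof. by case: K. Qed.
Lemma scalar_im1 : scalar_im (1 : F) = 0. Proof. by case: K. Qed.

Lemma scalar_eq x y : scalar_re x = scalar_re y -> scalar_im x = scalar_im y -> x = y.
Proof. by case: K x y => [x y|[a b] [c d]] //= -> ->. Qed.

Lemma modulusE x : modulus x = Num.sqrt (scalar_re x ^+ 2 + scalar_im x ^+ 2).
Proof.
case: K x => [x|[a b]] //=.
by rewrite expr0n addr0 sqrtr_sqr.
Qed.

Lemma modulus_sqr x : modulus x ^+ 2 = scalar_re x ^+ 2 + scalar_im x ^+ 2.
Proof. by rewrite modulusE sqr_sqrtr// addr_ge0 ?sqr_ge0. Qed.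

Lemma modulus_ge0 x : 0 <= modulus x.
Proof. by rewrite modulusE sqrtr_ge0. Qed.

Lemma modulusM x y : modulus (x * y) = modulus x * modulus y.
Proof.
apply/eqP; rewrite -(@eqrXn2 _ 2)// ?mulr_ge0 ?modulus_ge0// exprMn !modulus_sqr.
by rewrite scalar_reM scalar_imM; apply/eqP; ring.
Qed.

Lemma scalar_ofE r s : scalar_re (scalar_of r s) = r.
Proof. by rewrite /scalar_of; case: K. Qed.

Lemma scalar_im_of r s : (K = RealScalars -> s = 0) -> scalar_im (scalar_of r s) = s.
Proof. by rewrite /scalar_of; case: K => //= ->. Qed.

Lemma modulus_real r : modulus (scalar_of r 0) = `|r|.
Proof.
rewrite modulusE scalar_ofE scalar_im_of// expr0n addr0; exact: sqrtr_sqr.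
Qed.

Definition scalar_prod x y := scalar_re x * scalar_re y + scalar_im x * scalar_im y.

Lemma scalar_prod_adj a x y :
  scalar_prod (a * x) y = scalar_prod x (scalar_conj a * y).
Proof.
rewrite /scalar_prod !(scalar_reM, scalar_imM, scalar_re_conj, scalar_im_conj).
by ring.
Qed.

Lemma scalar_prodC x y : scalar_prod x y = scalar_prod y x.
Proof. by rewrite /scalar_prod mulrC [scalar_im x * _]mulrC. Qed.

Lemma scalar_prodDl x y z : scalar_prod (x + y) z = scalar_prod x z + scalar_prod y z.
Proof. by rewrite /scalar_prod scalar_reD scalar_imD; ring. Qed.

Lemma scalar_prod0 z : scalar_prod 0 z = 0.
Proof. by rewrite /scalar_prod scalar_re0 scalar_im0 !mul0r addr0. Qed.

Lemma scalar_prod_suml (I : finType) (f : I -> F) z :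
  scalar_prod (\sum_i f i) z = \sum_i scalar_prod (f i) z.
Proof.
apply: (big_morph (fun x => scalar_prod x z)) => [x y|]; first exact: scalar_prodDl.
exact: scalar_prod0.
Qed.

Lemma scalar_prodxx x : scalar_prod x x = modulus x ^+ 2.
Proof. by rewrite modulus_sqr /scalar_prod !expr2. Qed.

End scalars.

Section real_inner_product.
Context {R : realType} {K : scalars} {d : nat}.
Local Notation F := (scalar_field R K).
Implicit Types (A B : 'M[F]_d) (u v z : 'cV[F]_d).

(** The real part of the Hermitian product: it yields the same norm and lets both scalar fields be
    treated as real inner product spaces. *)
Definition rip u v : R := \sum_i scalar_prod (u i 0) (v i 0).

Lemma ripC u v : rip u v = rip v u.
Proof. by apply: eq_bigr => i _; rewrite scalar_prodC. Qed.

Lemma ripDl u v z : rip (u + v) z = rip u z + rip v z.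
Proof. by rewrite -big_split; apply: eq_bigr => i _; rewrite mxE scalar_prodDl. Qed.

Lemma ripDr u v z : rip z (u + v) = rip z u + rip z v.
Proof. by rewrite ripC ripDl ripC [rip v z]ripC. Qed.

Lemma ripZl (r : R) u v : rip (scalar_of r 0 *: u) v = r * rip u v.
Proof.
rewrite mulr_sumr; apply: eq_bigr => i _; rewrite mxE /scalar_prod.
by rewrite scalar_reM scalar_imM scalar_ofE scalar_im_of//; ring.
Qed.

Lemma rip_adjoint A u v : rip (A *m u) v = rip u (map_mx scalar_conj A^T *m v).
Proof.
rewrite /rip (eq_bigr (fun i => \sum_j scalar_prod (A i j * u j 0) (v i 0))); last first.
  by move=> i _; rewrite mxE scalar_prod_suml.
rewrite exchange_big; apply: eq_bigr => j _ /=.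
rewrite mxE scalar_prodC scalar_prod_suml; apply: eq_bigr => i _.
by rewrite scalar_prod_adj scalar_prodC !mxE.
Qed.

Lemma vnorm_sqr u : vnorm u ^+ 2 = rip u u.
Proof.
rewrite sqr_sqrtr; last by apply: sumr_ge0 => i _; rewrite sqr_ge0.
by apply: eq_bigr => i _; rewrite scalar_prodxx.
Qed.

Lemma vnorm_ge0 u : 0 <= vnorm u. Proof. exact: sqrtr_ge0. Qed.

Lemma rip_ge0 u : 0 <= rip u u.
Proof. by rewrite -vnorm_sqr sqr_ge0. Qed.

Lemma vnorm_eq0 u : vnorm u = 0 -> u = 0.
Proof.
move=> u0; have := vnorm_sqr u; rewrite u0 expr0n /= => /esym/eqP.
rewrite psumr_eq0 => [/allP h|i _]; last by rewrite scalar_prodxx sqr_ge0.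
apply/matrixP => i j; rewrite ord1 mxE.
have := h i (mem_index_enum _) => /eqP; rewrite /scalar_prod -!expr2.
move=> /eqP; rewrite paddr_eq0 ?sqr_ge0// !sqrf_eq0 => /andP[/eqP h1 /eqP h2].
by apply: scalar_eq; rewrite ?h1 ?h2 ?scalar_re0 ?scalar_im0.
Qed.

Lemma vnorm0 : vnorm (0 : 'cV[F]_d) = 0.
Proof.
apply/eqP; rewrite -(@eqrXn2 _ 2)// ?vnorm_ge0// vnorm_sqr expr0n /rip big1//= => i _.
by rewrite mxE scalar_prod0.
Qed.

Lemma rip_le u v : rip u v <= vnorm u * vnorm v.
Proof.
have [v0|v0] := eqVneq (vnorm v) 0.
  have -> : v = 0 by exact: vnorm_eq0.
  by rewrite vnorm0 mulr0 ripC /rip big1// => i _; rewrite mxE scalar_prod0.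
have vp : 0 < vnorm v by rewrite lt_neqAle eq_sym v0 vnorm_ge0.
pose a := vnorm v ^+ 2; pose b := - rip u v.
have := rip_ge0 (scalar_of a 0 *: u + scalar_of b 0 *: v).
rewrite ripDl !ripDr !ripZl ![rip _ (_ *: _)]ripC !ripZl -!vnorm_sqr -/a.
rewrite [rip v u]ripC => h.
have h2 : a * (rip u v ^+ 2) <= a * (a * vnorm u ^+ 2).
  by move: h; rewrite /b; lra.
have a0 : 0 < a by rewrite exprn_gt0.
rewrite ler_pM2l// in h2.
have uv0 : 0 <= vnorm u * vnorm v by rewrite mulr_ge0 ?vnorm_ge0.
have [r0|r0] := leP 0 (rip u v); last by apply: le_trans uv0; exact: ltW.
rewrite -ler_sqr ?nnegrE// exprMn; move: h2; rewrite /a; lra.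
Qed.

Lemma vnormD u v : vnorm (u + v) <= vnorm u + vnorm v.
Proof.
rewrite -ler_sqr ?nnegrE ?addr_ge0 ?vnorm_ge0// vnorm_sqr.
rewrite ripDl !ripDr [rip v u]ripC -!vnorm_sqr sqrrD; have := rip_le u v; lra.
Qed.

Lemma vnormZ (c : F) u : vnorm (c *: u) = modulus c * vnorm u.
Proof.
apply/eqP; rewrite -(@eqrXn2 _ 2)// ?mulr_ge0 ?vnorm_ge0 ?modulus_ge0//.
apply/eqP; rewrite exprMn !vnorm_sqr mulr_sumr; apply: eq_bigr => i _.
by rewrite !scalar_prodxx mxE modulusM exprMn.
Qed.

Lemma vnorm_sum (I : finType) (f : I -> 'cV[F]_d) :
  vnorm (\sum_i f i) <= \sum_i vnorm (f i).
Proof.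
elim/big_ind2: _ => [|x1 x2 y1 y2 h1 h2|//]; first by rewrite vnorm0.
by apply: le_trans (vnormD _ _) _; exact: lerD.
Qed.

Lemma modulus_le_vnorm u i : modulus (u i 0) <= vnorm u.
Proof.
rewrite -ler_sqr ?nnegrE ?vnorm_ge0 ?modulus_ge0// vnorm_sqr /rip.
rewrite (bigD1 i)//= scalar_prodxx lerDl; apply: sumr_ge0 => j _.
by rewrite scalar_prodxx sqr_ge0.
Qed.

Lemma vnorm_le_sum u : vnorm u <= \sum_i modulus (u i 0).
Proof.
have S0 : 0 <= \sum_i modulus (u i 0) by apply: sumr_ge0 => i _; exact: modulus_ge0.
rewrite -ler_sqr ?nnegrE ?vnorm_ge0// vnorm_sqr expr2 mulr_suml; apply: ler_sum => i _.
rewrite scalar_prodxx expr2 ler_wpM2l ?modulus_ge0// (bigD1 i)//= lerDl.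
by apply: sumr_ge0 => j _; exact: modulus_ge0.
Qed.

Lemma mulmx_vnorm_bounded A : exists2 C, 0 <= C & forall u, vnorm (A *m u) <= C * vnorm u.
Proof.
exists (\sum_j vnorm (col j A)); first by apply: sumr_ge0 => j _; exact: vnorm_ge0.
move=> u; have -> : A *m u = \sum_j (u j 0 *: col j A).
  apply/matrixP => i k; rewrite ord1 mxE summxE; apply: eq_bigr => j _.
  by rewrite !mxE mulrC.
apply: le_trans (vnorm_sum _) _; rewrite mulr_suml; apply: ler_sum => j _.
by rewrite vnormZ mulrC ler_wpM2l ?vnorm_ge0// modulus_le_vnorm.
Qed.

Lemma opnorm_has_sup A :
  has_sup [set vnorm (A *m u) | u in [set u | vnorm u <= 1]].
Proof.
split; first by exists (vnorm (A *m 0)), 0 => //=; rewrite vnorm0.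
have [C C0 hC] := mulmx_vnorm_bounded A.
exists C => _ [u /= u1 <-]; apply: le_trans (hC u) _.
by rewrite -[leRHS]mulr1 ler_wpM2l.
Qed.

Lemma opnorm_ge0 A : 0 <= opnorm A.
Proof.
apply: le_trans (vnorm_ge0 (A *m 0)) _; apply: sup_upper_bound.
  exact: opnorm_has_sup.
by exists 0 => //=; rewrite vnorm0.
Qed.

Lemma mulmx_opnorm A u : vnorm (A *m u) <= opnorm A * vnorm u.
Proof.
have [u0|u0] := eqVneq (vnorm u) 0.
  by rewrite u0 mulr0 (vnorm_eq0 u0) mulmx0 vnorm0.
have up : 0 < vnorm u by rewrite lt_neqAle eq_sym u0 vnorm_ge0.
rewrite -ler_pdivrMr//.
pose c : F := scalar_of (vnorm u)^-1 0.
have mc : modulus c = (vnorm u)^-1 by rewrite modulus_real ger0_norm// invr_ge0 ltW.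
have -> : vnorm (A *m u) / vnorm u = vnorm (A *m (c *: u)).
  by rewrite -scalemxAr vnormZ mc mulrC.
apply: sup_upper_bound; first exact: opnorm_has_sup.
by exists (c *: u) => //=; rewrite vnormZ mc mulVf.
Qed.

Definition self_adjoint A := forall u v, rip (A *m u) v = rip u (A *m v).

Lemma posdef_self_adjoint A : posdef A -> self_adjoint A.
Proof. by move=> [hA _] u v; rewrite rip_adjoint hA. Qed.

Lemma posdef_unit A : posdef A -> A \in unitmx.
Proof.
move=> [_ pos]; rewrite unitmxE unitfE -det_tr; apply/negP => /det0P[v v0 hv].
have := pos v^T; rewrite -trmx_eq0 trmxK => /(_ v0).
rewrite -mulmxA -[A]trmxK -trmx_mul hv trmx0 mulmx0 mxE.
by rewrite ltxx.
Qed.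

Lemma self_adjoint_inv A : A \in unitmx -> self_adjoint A -> self_adjoint (invmx A).
Proof.
move=> uA hA u v.
by rewrite -{1}[v](mulKVmx uA) -hA mulKVmx.
Qed.

(** [B *m A] is the adjoint of [A *m B]. Pairing the vector with itself moves both factors to the
    other side, where the operator norm of the product applies. *)
Lemma self_adjoint_mul_le A B z : self_adjoint A -> self_adjoint B ->
  vnorm (B *m (A *m z)) <= opnorm (A *m B) * vnorm z.
Proof.
move=> hA hB; set v := B *m (A *m z).
have [v0|v0] := eqVneq (vnorm v) 0.
  by rewrite v0 mulr_ge0 ?opnorm_ge0 ?vnorm_ge0.
have vp : 0 < vnorm v by rewrite lt_neqAle eq_sym v0 vnorm_ge0.
rewrite -(ler_pM2r vp) -expr2 vnorm_sqr {1}/v hB hA.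
apply: le_trans (rip_le _ _) _; rewrite mulrC mulrAC ler_wpM2r ?vnorm_ge0//.
by rewrite mulmxA mulmx_opnorm.
Qed.

(* The i-th component of A B f is the pairing of f with B A e_i. *)
Lemma self_adjoint_mul_le_sum A B f : self_adjoint A -> self_adjoint B ->
  vnorm (A *m B *m f) <= \sum_i vnorm (B *m (A *m delta_mx i 0)) * vnorm f.
Proof.
move=> hA hB; apply: le_trans (vnorm_le_sum _) _; apply: ler_sum => i _.
set z := (A *m B *m f) i 0.
have [z0|z0] := eqVneq (modulus z) 0.
  by rewrite z0 mulr_ge0 ?vnorm_ge0.
have zp : 0 < modulus z by rewrite lt_neqAle eq_sym z0 modulus_ge0.
rewrite -(ler_pM2l zp) -expr2.
have -> : modulus z ^+ 2 = rip (A *m B *m f) (z *: delta_mx i 0).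
  rewrite /rip (bigD1 i)//= big1 => [|j ji]; last first.
    by rewrite !mxE (negbTE ji) mulr0 scalar_prodC scalar_prod0.
  have e1 : (z *: delta_mx i 0 : 'cV[F]_d) i 0 = z.
    by rewrite mxE [delta_mx _ _ _ _]mxE !eqxx mulr1.
  by rewrite e1 addr0 -/z scalar_prodxx.
rewrite -mulmxA hA hB -!scalemxAr ripC.
apply: le_trans (rip_le _ _) _; rewrite vnormZ mulrA.
by [].
Qed.

End real_inner_product.

(** * Measurability of matrix-valued functions *)

Section measurable_matrices.
Context {R : realType} {K : scalars} {n : nat}.
Local Notation F := (scalar_field R K).
Local Notation T := (euclid R n).
Implicit Types (f g : T -> F).

Definition measurable_scalar f :=
  measurable_fun setT (fun x => scalar_re (f x)) /\
  measurable_fun setT (fun x => scalar_im (f x)).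

Lemma measurable_scalar_cst c : measurable_scalar (fun=> c).
Proof. by split; exact: measurable_cst. Qed.

Lemma measurable_scalarD f g : measurable_scalar f -> measurable_scalar g ->
  measurable_scalar (fun x => f x + g x).
Proof.
move=> [f1 f2] [g1 g2]; split.
  rewrite (_ : (fun x => _) = (fun x => scalar_re (f x) + scalar_re (g x))).
    exact: measurable_funD.
  by apply/funext => x; rewrite scalar_reD.
rewrite (_ : (fun x => _) = (fun x => scalar_im (f x) + scalar_im (g x))).
  exact: measurable_funD.
by apply/funext => x; rewrite scalar_imD.
Qed.

Lemma measurable_scalarM f g : measurable_scalar f -> measurable_scalar g ->
  measurable_scalar (fun x => f x * g x).
Proof.
move=> [f1 f2] [g1 g2]; split.
  rewrite (_ : (fun x => _) = (fun x =>
    scalar_re (f x) * scalar_re (g x) - scalar_im (f x) * scalar_im (g x))).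
    exact: (measurable_funB (measurable_funM f1 g1) (measurable_funM f2 g2)).
  by apply/funext => x; rewrite scalar_reM.
rewrite (_ : (fun x => _) = (fun x =>
    scalar_re (f x) * scalar_im (g x) + scalar_im (f x) * scalar_re (g x))).
  exact: (measurable_funD (measurable_funM f1 g2) (measurable_funM f2 g1)).
by apply/funext => x; rewrite scalar_imM.
Qed.

Lemma measurable_scalar_sum (I : Type) (r : seq I) (h : I -> T -> F) :
  (forall i, measurable_scalar (h i)) ->
  measurable_scalar (fun x => \sum_(i <- r) h i x).
Proof.
move=> mh; elim: r => [|i r IH].
  rewrite (_ : (fun x => _) = (fun=> 0)); first exact: measurable_scalar_cst.
  by apply/funext => x; rewrite big_nil.
rewrite (_ : (fun x => _) = (fun x => h i x + \sum_(j <- r) h j x)).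
  exact: measurable_scalarD.
by apply/funext => x; rewrite big_cons.
Qed.

Lemma measurable_scalar_prod (I : Type) (r : seq I) (h : I -> T -> F) :
  (forall i, measurable_scalar (h i)) ->
  measurable_scalar (fun x => \prod_(i <- r) h i x).
Proof.
move=> mh; elim: r => [|i r IH].
  rewrite (_ : (fun x => _) = (fun=> 1)); first exact: measurable_scalar_cst.
  by apply/funext => x; rewrite big_nil.
rewrite (_ : (fun x => _) = (fun x => h i x * \prod_(j <- r) h j x)).
  exact: measurable_scalarM.
by apply/funext => x; rewrite big_cons.
Qed.

Lemma scalar_inv (x : F) : x^-1 =
  scalar_of (scalar_re x / modulus x ^+ 2) (- scalar_im x / modulus x ^+ 2).
Proof.
have imR : K = RealScalars -> - scalar_im x / modulus x ^+ 2 = 0.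
  move=> h; suff -> : scalar_im x = 0 by rewrite oppr0 mul0r.
  by rewrite /scalar_im; move: x; rewrite h.
have [->|x0] := eqVneq x 0.
  rewrite invr0; apply: scalar_eq.
    by rewrite scalar_ofE scalar_re0 mul0r.
  rewrite /scalar_of; case: K => //=.
  by rewrite oppr0 mul0r.
have m0 : modulus x ^+ 2 != 0.
  apply/eqP; rewrite modulus_sqr => /eqP; rewrite paddr_eq0 ?sqr_ge0//.
  rewrite !sqrf_eq0 => /andP[/eqP h1 /eqP h2]; move/eqP: x0; apply.
  by apply: scalar_eq; rewrite ?h1 ?h2 ?scalar_re0 ?scalar_im0.
apply: (mulfI x0); rewrite divff//; apply/esym/scalar_eq.
  rewrite scalar_reM scalar_ofE scalar_im_of// scalar_re1.
  move: m0; rewrite modulus_sqr => m0; field.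
  by [].
rewrite scalar_imM scalar_ofE scalar_im_of// scalar_im1.
by move: m0; rewrite modulus_sqr => m0; field.
Qed.

Lemma measurable_modulus_sqr f : measurable_scalar f ->
  measurable_fun setT (fun x => modulus (f x) ^+ 2).
Proof.
move=> [f1 f2]; rewrite (_ : (fun x => _) = (fun x =>
    scalar_re (f x) * scalar_re (f x) + scalar_im (f x) * scalar_im (f x))).
  exact: (measurable_funD (measurable_funM f1 f1) (measurable_funM f2 f2)).
by apply/funext => x; rewrite modulus_sqr !expr2.
Qed.

Lemma measurable_scalarV f : measurable_scalar f ->
  measurable_scalar (fun x => (f x)^-1).
Proof.
move=> mf; have [f1 f2] := mf.
have mm := measurable_inv_fun (measurable_modulus_sqr mf) (fun x => sqr_ge0 _); split.
  rewrite (_ : (fun x => _) = (fun x => scalar_re (f x) * (modulus (f x) ^+ 2)^-1)).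
    exact: (measurable_funM f1 mm).
  by apply/funext => x; rewrite scalar_inv scalar_ofE.
rewrite (_ : (fun x => _) = (fun x => - scalar_im (f x) * (modulus (f x) ^+ 2)^-1)).
  exact: (measurable_funM (measurable_funN f2) mm).
apply/funext => x; rewrite scalar_inv scalar_im_of// => h.
suff -> : scalar_im (f x) = 0 by rewrite oppr0 mul0r.
by rewrite /scalar_im; move: (f x); rewrite h.
Qed.

Lemma measurable_mx_cst m k (A : 'M[F]_(m, k)) : measurable_mx (fun _ : T => A).
Proof. by move=> i j; exact: measurable_scalar_cst. Qed.

Lemma measurable_mxM m k l (A : T -> 'M[F]_(m, k)) (B : T -> 'M[F]_(k, l)) :
  measurable_mx A -> measurable_mx B -> measurable_mx (fun x => A x *m B x).
Proof.
move=> mA mB i j; change (measurable_scalar (fun x => (A x *m B x) i j)).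
rewrite (_ : (fun x => _) = (fun x => \sum_(t < k) A x i t * B x t j)).
  by apply: measurable_scalar_sum => t; apply: measurable_scalarM; [exact: mA|exact: mB].
by apply/funext => x; rewrite mxE.
Qed.

Lemma measurable_det m (A : T -> 'M[F]_m) : measurable_mx A ->
  measurable_scalar (fun x => \det (A x)).
Proof.
move=> mA; apply: measurable_scalar_sum => s.
apply: measurable_scalarM; first exact: measurable_scalar_cst.
by apply: measurable_scalar_prod => i; exact: mA.
Qed.

Lemma measurable_invmx m (A : T -> 'M[F]_m) : measurable_mx A ->
  (forall x, A x \in unitmx) -> measurable_mx (fun x => invmx (A x)).
Proof.
move=> mA uA i j; change (measurable_scalar (fun x => invmx (A x) i j)).
rewrite (_ : (fun x => _) = (fun x => (\det (A x))^-1 *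
    ((-1) ^+ (j + i) * \det (row' j (col' i (A x)))))).
  apply: measurable_scalarM; first exact: measurable_scalarV (measurable_det mA).
  apply: measurable_scalarM; first exact: measurable_scalar_cst.
  apply: measurable_det => i' j'.
  rewrite (_ : (fun x => _) = (fun x => scalar_re (A x (lift j i') (lift i j')))).
    rewrite (_ : (fun x => scalar_im _) = (fun x => scalar_im (A x (lift j i') (lift i j')))).
      exact: mA.
    by apply/funext => x; rewrite !mxE.
  by apply/funext => x; rewrite !mxE.
by apply/funext => x; rewrite /invmx uA mxE mxE.
Qed.

Lemma measurable_vnorm d (f : T -> 'cV[F]_d) : measurable_mx f ->
  measurable_fun setT (fun x => vnorm (f x)).
Proof.
move=> mf; apply: measurable_sqrt_fun; last first.
  by move=> x; apply: sumr_ge0 => i _; exact: sqr_ge0.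
have H i : measurable_fun setT (fun x => modulus (f x i 0) ^+ 2).
  by apply: measurable_modulus_sqr; exact: mf.
exact: measurable_sum.
Qed.

End measurable_matrices.

(** * From matrix weights to scalar weights *)

Section variable_norm.
Context {R : realType} {n : nat}.
Local Notation T := (euclid R n).
Local Notation mu := (lebesgue R n).
Implicit Types (x y : T) (f g : T -> \bar R) (A : set T).
Variable p : T -> R.
Hypothesis p0 : forall x, 0 < p x.

Lemma modularE f :
  modular (EFin \o p) f = (\int[mu]_x (`|f x| `^ p x))%E.
Proof.
rewrite /modular (_ : [set x | (EFin \o p) x = +oo%E] = set0); last first.
  by apply/seteqP; split.
rewrite setC0 (_ : (fun x => f x * _)%E = cst 0%E) ?Lnorm0 ?adde0//.
by apply/funext => x; rewrite indic0 mule0.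
Qed.

Lemma Lpnorm_ge0 f : (0 <= Lpnorm (EFin \o p) f)%E.
Proof. by apply: le_ereal_inf_tmp => _ [l [l0 _] <-]; rewrite lee_fin ltW. Qed.

Lemma Lpnorm_le f (l : R) : 0 < l ->
  (modular (EFin \o p) (fun x => f x * (l^-1)%:E) <= 1)%E ->
  (Lpnorm (EFin \o p) f <= l%:E)%E.
Proof. by move=> l0 h; apply: ereal_inf_lbound; exists l. Qed.

Lemma ge0_le_poweR (a b : \bar R) (r : R) : 0 <= r -> (0 <= a)%E -> (a <= b)%E ->
  (a `^ r <= b `^ r)%E.
Proof.
move=> r0 a0 ab; apply: gt0_ler_poweR => //; rewrite in_itv/= leey ?a0//.
by rewrite (le_trans a0 ab).
Qed.

(** The strict inequality yields an admissible value below [l], whether or not the infimum is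
    attained. It is the source of the factor 2 in [inner_norm_ub]. *)
Lemma Lpnorm_lt f (l : R) : (Lpnorm (EFin \o p) f < l%:E)%E ->
  (modular (EFin \o p) (fun x => f x * (l^-1)%:E) <= 1)%E.
Proof.
move=> /ereal_inf_lt[_ [l1 [l10 hl1] <-]]; rewrite lte_fin => l1l.
have l0 : 0 < l by exact: lt_trans l1l.
apply: le_trans hl1; rewrite !modularE; apply: ge0_le_integralW => x _.
  exact: poweR_ge0.
apply: ge0_le_poweR; [exact: ltW|exact: abse_ge0|].
rewrite !abseM; apply: lee_wpmul2l; first exact: abse_ge0.
by rewrite lee_fin !ger0_norm ?invr_ge0 ?(ltW l0) ?(ltW l10)// lef_pV2// ltW.
Qed.

(** [g] will in particular be the inner norm of $[W]$, whose measurability is not known; the passage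
    to the lower bound [h] is pure monotonicity of the integral. *)
Lemma integral_le_modular (g : T -> \bar R) (h : T -> R) A B (l : R) : 0 < l ->
  A `<=` B -> (modular (EFin \o p) (fun x => g x * (\1_B x)%:E * (l^-1)%:E) <= 1)%E ->
  (forall x, A x -> 0 <= h x) -> (forall x, A x -> (h x)%:E <= g x)%E ->
  (\int[mu]_(x in A) ((h x / l) `^ p x)%:E <= 1)%E.
Proof.
move=> l0 AB; rewrite modularE => hl h0 hg; apply: le_trans hl.
rewrite integral_mkcond; apply: ge0_le_integralW => x _.
  by rewrite patchE; case: ifP => _; rewrite ?lee_fin ?powR_ge0.
rewrite patchE; case: ifPn => [/set_mem Ax|_]; last exact: poweR_ge0.
rewrite indicE (mem_set (AB _ Ax)) mule1 -poweR_EFin.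
have hg' := hg _ Ax; have h0' := h0 _ Ax.
have g0 : (0 <= g x)%E by apply: le_trans hg'; rewrite lee_fin.
apply: ge0_le_poweR; [exact: ltW|by rewrite lee_fin divr_ge0// ltW|].
rewrite gee0_abs; last by rewrite mule_ge0// lee_fin invr_ge0 ltW.
by rewrite EFinM; apply: lee_wpmul2r => //; rewrite lee_fin invr_ge0 ltW.
Qed.

End variable_norm.

Lemma hoelder_conjugateE (R : realType) (a : R) : 1 < a ->
  hoelder_conjugate a%:E = (conjugate_exponent a)%:E.
Proof.
move=> a1; rewrite /hoelder_conjugate /= eqe gt_eqF; last by lra.
by rewrite -EFinD inver subr_eq0 gt_eqF.
Qed.

(** * Integrable real functions with a named integral *)

Section has_integral.
Context d (T : measurableType d) (R : realType) (mu : {measure set T -> \bar R})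
  (A : set T).
Hypothesis mA : measurable A.

Definition has_integral (h : T -> R) (I : R) :=
  mu.-integrable A (EFin \o h) /\ (\int[mu]_(x in A) (h x)%:E = I%:E)%E.

Lemma has_integral_integrable h : mu.-integrable A (EFin \o h) ->
  has_integral h (fine (\int[mu]_(x in A) (h x)%:E)).
Proof. by move=> ih; split => //; rewrite fineK//; exact: integrable_fin_num. Qed.

Lemma has_integralZ c h I : has_integral h I ->
  has_integral (fun x => c * h x) (c * I).
Proof.
move=> [ih hI]; split; first exact: (integrableZl mA c ih).
under eq_integral do rewrite EFinM.
by rewrite (integralZl mA ih) hI.
Qed.

Lemma has_integralD h k I J : has_integral h I -> has_integral k J ->
  has_integral (fun x => h x + k x) (I + J).
Proof.
move=> [ih hI] [ik kJ]; split; first exact: (integrableD mA ih ik).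
under eq_integral do rewrite EFinD.
by rewrite (integralD mA ih ik) hI kJ.
Qed.

Lemma has_integral_sum (J : Type) (r : seq J) (h : J -> T -> R) (I : J -> R) :
  (forall i, has_integral (h i) (I i)) ->
  has_integral (fun x => \sum_(i <- r) h i x) (\sum_(i <- r) I i).
Proof.
move=> H; elim: r => [|i r IH].
  rewrite big_nil (_ : (fun x => _) = (fun=> 0)); last first.
    by apply/funext => x; rewrite big_nil.
  split; first exact: integrable0.
  by rewrite integral0.
rewrite big_cons (_ : (fun x => _) = (fun x => h i x + \sum_(j <- r) h j x)).
  exact: has_integralD.
by apply/funext => x; rewrite big_cons.
Qed.

Lemma has_integral_le h k I J : has_integral h I -> has_integral k J ->
  (forall x, A x -> h x <= k x) -> I <= J.
Proof.
move=> [ih hI] [ik kJ] hk; rewrite -lee_fin -hI -kJ.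
by apply: le_integral => // x /set_mem Ax; rewrite lee_fin hk.
Qed.

Lemma has_integral_dominated (h k : T -> R) : measurable_fun A h -> measurable_fun A k ->
  (forall x, A x -> 0 <= k x) -> (\int[mu]_(x in A) (k x)%:E < +oo)%E ->
  (forall x, A x -> `|h x| <= k x) ->
  exists I, has_integral h I.
Proof.
move=> mh mk k0 kfin hk; eexists; apply: has_integral_integrable.
apply: (le_integrable mA (g := EFin \o k)); first exact/measurable_EFinP.
  by move=> x Ax /=; rewrite lee_fin (ger0_norm (k0 _ Ax)) hk.
apply/integrableP; split; first exact/measurable_EFinP.
by under eq_integral => x /set_mem Ax do rewrite /= (ger0_norm (k0 _ Ax)).
Qed.

End has_integral.

Section scalar_weight.
Context {R : realType} {K : scalars} {n d : nat}.
Local Notation T := (euclid R n).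
Local Notation mu := (lebesgue R n).
Local Notation F := (scalar_field R K).
Local Notation conj := conjugate_exponent.
Variables (lo hi D pinf Kc : R) (p : T -> R) (W : T -> 'M[F]_d).
Hypotheses (lo1 : 1 < lo) (Hp : exponent_class lo hi D pinf p)
  (mW : measurable_mx W) (Wpos : forall x, posdef (W x)) (Kc1 : 1 <= Kc)
  (AW : (Ap_const (EFin \o p) W <= Kc%:E)%E).
Let q := conj \o p.

Let mp : measurable_fun setT p. Proof. by case: Hp. Qed.
Let p1 x : 1 < p x. Proof. by case: Hp => _ /(_ x)/andP[h _] _ _ _; exact: lt_le_trans h. Qed.
Let p0 x : 0 < p x. Proof. exact: lt_trans (p1 x). Qed.
Let q1 x : 1 < q x. Proof. exact: conjugate_exponent_gt1. Qed.
Let q0 x : 0 < q x. Proof. exact: lt_trans (q1 x). Qed.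
Let Hq := exponent_class_conjugate lo1 Hp.
Let mq : measurable_fun setT q. Proof. by case: Hq. Qed.

Definition inner_norm (Q : set T) x : \bar R := Lpnorm (EFin \o q)
  (fun y => (opnorm (W x *m invmx (W y)) * \1_Q y)%:E).

Let qE : hoelder_conjugate \o (EFin \o p) = EFin \o q.
Proof. by apply/funext => x /=; rewrite hoelder_conjugateE. Qed.

Let uW x : W x \in unitmx. Proof. exact: posdef_unit. Qed.
Let sW x : self_adjoint (W x). Proof. exact: posdef_self_adjoint. Qed.
Let sWi x : self_adjoint (invmx (W x)). Proof. exact: self_adjoint_inv. Qed.

Lemma inner_norm_ub (a : T) (l : R) : 0 < l ->
  (modular (EFin \o p) (fun x => inner_norm (cube a l) x * (\1_(cube a l) x)%:E
    * ((2 * Kc * l ^+ n)^-1)%:E) <= 1)%E.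
Proof.
move=> l0; apply: Lpnorm_lt => //.
have ln0 : 0 < l ^+ n by rewrite exprn_gt0.
have Kc0 : 0 < Kc by exact: lt_le_trans Kc1.
apply: (@le_lt_trans _ _ (Kc * l ^+ n)%:E); last first.
  by rewrite lte_fin ltr_pM2r// ltr_pMl//; lra.
have volE : vol (cube a l) = l ^+ n by rewrite /vol lebesgue_cube// ltW.
have : ((((vol (cube a l))^-1)%:E * Lpnorm (EFin \o p) (fun x =>
    inner_norm (cube a l) x * (\1_(cube a l) x)%:E)) <= Kc%:E)%E.
  apply: le_trans AW; apply: ereal_sup_ubound; exists (cube a l).
    by exists a, l.
  by rewrite qE.
by rewrite volE lee_pdivrMl// => h; rewrite mulrC EFinM.
Qed.

Variable z : 'cV[F]_d.
Hypothesis z0 : z != 0.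

Definition adjoint_weight y : R := vnorm (invmx (W y) *m z).
Local Notation w := adjoint_weight.

Lemma measurable_adjoint_weight : measurable_fun setT w.
Proof.
apply: measurable_vnorm; apply: measurable_mxM; last exact: measurable_mx_cst.
exact: measurable_invmx.
Qed.

Lemma adjoint_weight_gt0 y : 0 < w y.
Proof.
rewrite lt_neqAle vnorm_ge0 andbT eq_sym; apply/negP => /eqP /vnorm_eq0 h.
move/eqP: z0; apply; by rewrite -(mulKVmx (uW y) z) h mulmx0.
Qed.

Lemma adjoint_weight_le x y :
  w y <= opnorm (W x *m invmx (W y)) * w x.
Proof.
rewrite /w -{1}(mulKVmx (uW x) z).
exact: self_adjoint_mul_le.
Qed.

Let w0 := adjoint_weight_gt0.
Let mw := measurable_adjoint_weight.

Lemma inner_modular_le Q A x (l : R) : 0 < l -> A `<=` Q ->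
  (modular (EFin \o q) (fun y =>
    (opnorm (W x *m invmx (W y)) * \1_Q y)%:E * (l^-1)%:E) <= 1)%E ->
  forall h : T -> R, (forall y, A y -> 0 <= h y <= opnorm (W x *m invmx (W y))) ->
  (\int[mu]_(y in A) ((h y / l) `^ q y)%:E <= 1)%E.
Proof.
move=> l0 AQ hl h hh.
apply: (@integral_le_modular _ _ q q0 (fun y => (opnorm (W x *m invmx (W y)))%:E) h A Q l).
- exact: l0.
- exact: AQ.
- by under eq_fun do rewrite -EFinM.
- by move=> y /hh /andP[].
- by move=> y /hh /andP[]; rewrite lee_fin.
Qed.

Let inner_wmod Q A x (l : R) : 0 < l -> A `<=` Q ->
  (modular (EFin \o q) (fun y =>
    (opnorm (W x *m invmx (W y)) * \1_Q y)%:E * (l^-1)%:E) <= 1)%E ->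
  (\int[mu]_(y in A) (wmod q w (l * w x) y)%:E <= 1)%E.
Proof.
move=> l0 AQ hl.
have := inner_modular_le l0 AQ hl (h := fun y => w y / w x).
rewrite /wmod; under eq_integral do rewrite -mulrA -invfM [w x * l]mulrC.
apply => y _; rewrite divr_ge0 ?(ltW (w0 _))//= ler_pdivrMr//.
exact: adjoint_weight_le.
Qed.

Let qb x : conj hi <= q x <= conj lo. Proof. by case: Hq. Qed.
Let chi1 : 1 < conj hi.
Proof.
by apply: conjugate_exponent_gt1; case: Hp => _ _ /andP[h1 h2] _ _; apply: lt_le_trans h2; exact: lt_le_trans h1.
Qed.

(** By [adjoint_weight_le], an [l] admissible for the inner norm at [x] makes [l * w x] admissible
    for [w], hence at least [N]. *)
Lemma le_inner_norm b (s : R) N x : 0 < s -> 0 < N ->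
  (1 <= \int[mu]_(y in hcube b s) (wmod q w N y)%:E)%E ->
  ((N / w x)%:E <= inner_norm (cube (point b) s) x)%E.
Proof.
move=> s0 N0 hN; apply: le_ereal_inf_tmp => _ [l [l0 hl] <-].
rewrite lee_fin ler_pdivrMr//.
have sub : hcube b s `<=` cube (point b) s.
  by have := @hcube_cube_sub R n (point b) s; rewrite (_ : coordinate (point b) = b)//;
     apply/funext => i; exact: coordinate_point.
have h := inner_wmod l0 sub hl.
by apply: (unit_norm_le chi1 mq qb mw w0 (measurable_hcube b s) (measurable_hcube b s)
  (@subset_refl _ _) N0 (mulr_gt0 l0 (w0 x)) hN h).
Qed.

(** An inner norm infinite on the whole cube would dominate every constant, and the outer modular
    would exceed 1; [c] satisfies [c * s ^+ n = 2 + s ^+ n] for that purpose. *)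
Lemma inner_norm_fin (a : T) (s : R) : 0 < s ->
  exists x l, [/\ cube a s x, 0 < l & (modular (EFin \o q) (fun y =>
    (opnorm (W x *m invmx (W y)) * \1_(cube a s) y)%:E * (l^-1)%:E) <= 1)%E].
Proof.
move=> s0; apply: contrapT => nex.
have oo x : cube a s x -> inner_norm (cube a s) x = +oo%E.
  move=> ax; apply/ereal_inf_pinfty => _ [l [l0 hl] <-]; exfalso; apply: nex.
  by exists x, l.
have sn0 : 0 < s ^+ n by rewrite exprn_gt0.
have Kc0 : 0 < Kc by exact: lt_le_trans Kc1.
pose c : R := 2 / s ^+ n + 1; pose l := 2 * Kc * s ^+ n.
have c1 : 1 <= c by rewrite /c lerDr divr_ge0// ltW.
have l0 : 0 < l by rewrite /l !mulr_gt0.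
have c0 : 0 < c by lra.
have := @integral_le_modular _ _ p p0 (inner_norm (cube a s)) (fun=> l * c)
  (hcube (coordinate a) s) (cube a s) l l0 (@hcube_cube_sub _ _ _ _) (inner_norm_ub a s0).
have h1 x : hcube (coordinate a) s x -> 0 <= l * c by rewrite mulr_ge0// ltW.
have h2 x : hcube (coordinate a) s x -> ((l * c)%:E <= inner_norm (cube a s) x)%E.
  by move=> ax; rewrite (oo x) ?leey//; exact: hcube_cube_sub.
move=> /(_ h1 h2) h3; clear h1 h2.
have : ((c * s ^+ n)%:E <= 1)%E.
  apply: le_trans h3; rewrite -(integral_cst_hcube (coordinate a) c (ltW s0)).
  apply: ge0_le_integralW => x _; rewrite lee_fin ?(ltW c0)//.
  have -> : l * c / l = c by field; rewrite gt_eqF.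
  rewrite -[leLHS]powRr1 ?(ltW c0)//; apply: ler_powR => //; exact: ltW.
rewrite lee_fin /c mulrDl divfK ?gt_eqF// mul1r.
by have := sn0; lra.
Qed.

Lemma integral_wmod_fin b (s : R) : 0 < s ->
  (\int[mu]_(x in hcube b s) (wmod q w 1 x)%:E < +oo)%E.
Proof.
move=> s0; have [x [l [_ l0 hl]]] := inner_norm_fin (point b) s0.
have sub : hcube b s `<=` cube (point b) s.
  by have := @hcube_cube_sub R n (point b) s; rewrite (_ : coordinate (point b) = b)//;
     apply/funext => i; exact: coordinate_point.
have h := inner_wmod l0 sub hl.
set N := l * w x in h; have N0 : 0 < N by exact: mulr_gt0.
pose c := N `^ conj lo + 1.
have c0 : 0 <= c by rewrite /c addr_ge0 ?powR_ge0.
apply: (@le_lt_trans _ _ (c%:E * 1%E)%E); last by rewrite mule1 ltry.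
apply: le_trans (lee_wpmul2l _ h); last by rewrite lee_fin.
have mN : measurable_fun setT (wmod q w N) by exact: measurable_wmod.
rewrite -(ge0_integralZ_EFin mu (measurable_hcube b s) mN (wmod_ge0 q w N) c0).
apply: ge0_le_integralW => y _; rewrite lee_fin ?wmod_ge0//.
rewrite /wmod divr1.
have -> : w y `^ q y = N `^ q y * (w y / N) `^ q y.
  rewrite -powRM ?(ltW N0) ?divr_ge0 ?(ltW (w0 y)) ?(ltW N0)//; congr (_ `^ _).
  by field; rewrite gt_eqF.
rewrite ler_wpM2r ?powR_ge0//.
have /andP[qb1 qb2] := qb y; have q1y := q1 y.
have [N1|N1] := leP 1 N.
  by rewrite /c; apply: ler_wpDr => //; exact: ler_powR.
apply: (@le_trans _ _ 1); last by rewrite /c lerDr powR_ge0.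
have -> : 1 = 1 `^ q y :> R by rewrite powR1.
apply: ge0_powR_le; [exact: ltW (lt_trans _ q1y)|exact: ltW|exact: ltW].
Qed.

(** The matrix condition and [le_inner_norm] bound the $L^{p(\cdot)}$ modular of $N/(lw)$ on [E] by
    1. Young's inequality for the constant [2 / m], factored as $N/(lw)$ times $w/N'$, integrates
    over [E] to show that 2 is at most 1 plus the modular of $w/N'$. In [4 * Kc], one 2 comes from
    [inner_norm_ub] and the other from this 2. *)
Lemma weight_class_adjoint : weight_class (4 * Kc) q w.
Proof.
split; [exact: mw|exact: w0|exact: integral_wmod_fin|].
move=> b s E N m s0 mE EP N0 hN m0 hm.
have Kc0 : 0 < Kc by exact: lt_le_trans Kc1.
have sn0 : 0 < s ^+ n by rewrite exprn_gt0.
set l := 2 * Kc * s ^+ n; have l0 : 0 < l by rewrite /l !mulr_gt0.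
have cE : coordinate (point b) = b :> ('I_n -> R).
  by apply/funext => i; exact: coordinate_point.
have sub : hcube b s `<=` cube (point b) s.
  by have := @hcube_cube_sub R n (point b) s; rewrite cE.
have hE : (\int[mu]_(x in E) ((N / w x / l) `^ p x)%:E <= 1)%E.
  apply: (integral_le_modular p0 l0 (subset_trans EP sub) (inner_norm_ub (point b) s0)).
    by move=> x _; rewrite divr_ge0 ?(ltW N0) ?(ltW (w0 x)).
  by move=> x _; exact: le_inner_norm.
set N' := N * m / (4 * Kc * s ^+ n).
have N'0 : 0 < N' by rewrite /N' divr_gt0 ?mulr_gt0.
pose A x := (N / w x / l) `^ p x.
have mA : measurable_fun setT A.
  apply: measurable_powR_fun mp; apply: (measurable_funM _ (measurable_cst _)).
  apply: (measurable_funM (measurable_cst _)); apply: measurable_inv_fun => //.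
  by move=> x; exact: ltW.
have A0 x : 0 <= A x by exact: powR_ge0.
have mN' : measurable_fun setT (wmod q w N') by exact: measurable_wmod.
have two : (2 <= 1 + \int[mu]_(x in E) (wmod q w N' x)%:E)%E.
  apply: le_trans (leeD2r _ hE).
  rewrite -(ge0_integralD_EFin mu mE mA A0 mN' (wmod_ge0 q w N')).
  apply: (@le_trans _ _ (\int[mu]_(x in E) (2 / m)%:E)%E).
    rewrite integral_cst// -lee_pdivrMl ?divr_gt0//.
    apply: le_trans hm; rewrite -EFinM lee_fin.
    by rewrite le_eqVlt; apply/orP; left; apply/eqP; field; rewrite gt_eqF.
  apply: ge0_le_integralW => x _; rewrite lee_fin ?divr_ge0 ?(ltW m0)//.
  have -> : 2 / m = N / w x / l * (w x / N').
    rewrite /l /N'; field; rewrite !gt_eqF//.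
  apply: young => //.
    by rewrite !divr_ge0 ?(ltW N0) ?(ltW (w0 x)) ?(ltW l0).
  by rewrite divr_ge0 ?(ltW (w0 x)) ?(ltW N'0).
move: two; have := integral_ge0; move=> _.
have : (0 <= \int[mu]_(x in E) (wmod q w N' x)%:E)%E.
  by apply: integral_ge0 => x _; rewrite lee_fin wmod_ge0.
case: (\int[mu]_(x in E) (wmod q w N' x)%:E)%E => [r r0|_ _|//]; last by rewrite leey.
by rewrite -EFinD !lee_fin => h; lra.
Qed.

Variables (a : T) (s : R) (WQ : 'M[F]_d) (e : 'cV[F]_d).
Local Notation Q := (cube a s).
Let P := hcube (coordinate a) s.
Let mean := recip_mean (EFin \o p) Q.
Hypotheses (s0 : 0 < s) (zE : z = WQ *m e) (e1 : vnorm e = 1)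
  (sWQ : self_adjoint WQ)
  (hWQ : forall u, ((vnorm (WQ *m u))%:E <= (Num.sqrt d%:R)%:E *
    (((s ^+ n) `^ (- mean))%:E *
      Lpnorm (EFin \o p) (fun x => (vnorm (W x *m u) * \1_Q x)%:E)))%E).

Let mP : measurable P. Proof. exact: measurable_hcube. Qed.
Let PQ : P `<=` Q. Proof. exact: hcube_cube_sub. Qed.
Let sn0 : 0 < s ^+ n. Proof. by rewrite exprn_gt0. Qed.
Let Kc0 : 0 < Kc. Proof. exact: lt_le_trans Kc1. Qed.

Section extremal_vector.
(* The weighted average of zeta against g is extremal in the duality between
   L^q(.) and L^p(.): its real inner product with z is the norm N of w. *)
Variable N : R.
Hypotheses (N0 : 0 < N) (hN : (\int[mu]_(x in P) (wmod q w N x)%:E = 1)%E).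

Let g y := (w y / N) `^ (q y - 1).
Let zeta y : 'cV[F]_d :=
  scalar_of (w y)^-1 0 *: (invmx (W y) *m (invmx (W y) *m z)).

Let wN0 y : 0 < w y / N. Proof. by rewrite divr_gt0. Qed.
Let g0 y : 0 <= g y. Proof. exact: powR_ge0. Qed.
Let mwN : measurable_fun setT (fun y => w y / N).
Proof. exact: (measurable_funM mw (measurable_cst _)). Qed.
Let mg : measurable_fun setT g.
Proof. exact: (measurable_powR_fun mwN (measurable_funB mq (measurable_cst _))). Qed.

Let gp y : g y `^ p y = wmod q w N y.
Proof.
rewrite /g -powRrM; congr (_ `^ _); rewrite /q /= /conjugate_exponent.
by field; rewrite subr_eq0 gt_eqF.
Qed.

Let gw y : g y * w y = N * wmod q w N y.
Proof.
rewrite /wmod -(mulr_powRB1 (ltW (wN0 y)) (q0 y)) -/(g y).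
by field; rewrite gt_eqF.
Qed.

Let mWi : measurable_mx (fun y => invmx (W y)).
Proof. exact: measurable_invmx. Qed.

Let mzeta : measurable_mx zeta.
Proof.
move=> i j; change (measurable_scalar (fun y => zeta y i j)).
rewrite (_ : (fun y => _) = (fun y => scalar_of (w y)^-1 0 *
    (invmx (W y) *m (invmx (W y) *m z)) i j)); last first.
  by apply/funext => y; rewrite mxE.
apply: measurable_scalarM.
  split; last by rewrite (_ : (fun y => _) = (fun=> 0))//; apply/funext => y; rewrite scalar_im_of.
  rewrite (_ : (fun y => _) = (fun y => (w y)^-1)).
    by apply: measurable_inv_fun => // y; exact: ltW.
  by apply/funext => y; rewrite scalar_ofE.
exact: (measurable_mxM mWi (measurable_mxM mWi (measurable_mx_cst _))).
Qed.

Let mWzeta x : measurable_fun setT (fun y => vnorm (W x *m zeta y)).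
Proof. apply: measurable_vnorm; exact: (measurable_mxM (measurable_mx_cst _) mzeta). Qed.

Let zeta_le x y : vnorm (W x *m zeta y) <= opnorm (W x *m invmx (W y)).
Proof.
rewrite /zeta -scalemxAr vnormZ modulus_real gtr0_norm ?invr_gt0//.
rewrite mulrC ler_pdivrMr// (mulmxA (W x)).
exact: mulmx_opnorm.
Qed.

(** Young's inequality for [g] and the vector norm divided by [l]: the power [p] of [g] is the
    normalized modular density of [w], with integral 1, and the other modular is at most 1. *)
Let pairing_le x l : 0 < l ->
  (modular (EFin \o q) (fun y =>
    (opnorm (W x *m invmx (W y)) * \1_Q y)%:E * (l^-1)%:E) <= 1)%E ->
  (\int[mu]_(y in P) (g y * vnorm (W x *m zeta y))%:E <= (2 * l)%:E)%E.
Proof.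
move=> l0 hl; set h := fun y => vnorm (W x *m zeta y).
have h0 y : 0 <= h y by exact: vnorm_ge0.
have hh y : P y -> 0 <= h y <= opnorm (W x *m invmx (W y)) by move=> _; rewrite h0; exact: zeta_le.
have hq := inner_modular_le l0 PQ hl hh.
have mhq : measurable_fun setT (fun y => (h y / l) `^ q y).
  apply: (measurable_powR_fun _ mq); exact: (measurable_funM (mWzeta x) (measurable_cst _)).
have hq0 y : 0 <= (h y / l) `^ q y by exact: powR_ge0.
have mN : measurable_fun setT (wmod q w N) by exact: measurable_wmod.
apply: (@le_trans _ _ (\int[mu]_(y in P) (l * (wmod q w N y + (h y / l) `^ q y))%:E)%E).
  apply: ge0_le_integralW => y _; rewrite lee_fin; first by rewrite mulr_ge0 ?vnorm_ge0.
  rewrite -/(h y); have -> : g y * h y = l * (g y * (h y / l)) by field; rewrite gt_eqF.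
  rewrite ler_pM2l// -gp; apply: young => //.
  by rewrite divr_ge0// ltW.
rewrite (ge0_integralZ_EFin mu mP (measurable_funD mN mhq) _ (ltW l0)); last first.
  by move=> y; rewrite addr_ge0 ?wmod_ge0.
rewrite (ge0_integralD_EFin mu mP mN (wmod_ge0 q w N) mhq hq0) hN.
rewrite [2 * l]mulrC EFinM; apply: lee_wpmul2l; first by rewrite lee_fin ltW.
have -> : 2%:E = (1 + 1)%E :> \bar R by rewrite -EFinD.
by rewrite leeD2l.
Qed.

(** The vector is the integral of [g] times [zeta], taken coordinate by coordinate. Domination needs
    one point [x] with finite inner norm: writing [zeta] as $W(x)^{-1}W(x)\zeta$ reduces it to
    [pairing_le]. *)
Let extremal_vector : exists u, forall v,
  has_integral mu P (fun y => g y * rip v (zeta y)) (rip v u).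
Proof.
have [x [l [_ l0 hl]]] := inner_norm_fin a s0.
pose C := opnorm (invmx (W x)); have C0 : 0 <= C by exact: opnorm_ge0.
pose k y := C * (g y * vnorm (W x *m zeta y)).
have gv0 y : 0 <= g y * vnorm (W x *m zeta y) by rewrite mulr_ge0 ?vnorm_ge0.
have k0 y : P y -> 0 <= k y by move=> _; rewrite /k mulr_ge0.
have mgv : measurable_fun setT (fun y => g y * vnorm (W x *m zeta y)).
  exact: (measurable_funM mg (mWzeta x)).
have mk : measurable_fun setT k by exact: (measurable_funM (measurable_cst _) mgv).
have kfin : (\int[mu]_(y in P) (k y)%:E < +oo)%E.
  rewrite (ge0_integralZ_EFin mu mP mgv gv0 C0).
  apply: le_lt_trans (lee_wpmul2l _ (pairing_le l0 hl)) _; first by rewrite lee_fin.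
  by rewrite -EFinM ltry.
have modk i y : g y * modulus (zeta y i 0) <= k y.
  rewrite /k mulrCA ler_wpM2l//; apply: le_trans (modulus_le_vnorm _ _) _.
  rewrite -{1}(mulKmx (uW x) (zeta y)); exact: mulmx_opnorm.
have re_le (c : F) : `|scalar_re c| <= modulus c.
  rewrite -ler_sqr ?nnegrE ?modulus_ge0// modulus_sqr real_normK ?num_real//.
  by rewrite lerDl sqr_ge0.
have im_le (c : F) : `|scalar_im c| <= modulus c.
  rewrite -ler_sqr ?nnegrE ?modulus_ge0// modulus_sqr real_normK ?num_real//.
  by rewrite lerDr sqr_ge0.
have Hre i : exists I, has_integral mu P (fun y => g y * scalar_re (zeta y i 0)) I.
  apply: (has_integral_dominated mP _ (measurable_funTS mk) k0 kfin).
    by apply: measurable_funTS; exact: (measurable_funM mg (mzeta i 0).1).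
  move=> y _; rewrite normrM ger0_norm//; apply: le_trans (modk i y).
  by rewrite ler_wpM2l.
have Him i : exists I, has_integral mu P (fun y => g y * scalar_im (zeta y i 0)) I.
  apply: (has_integral_dominated mP _ (measurable_funTS mk) k0 kfin).
    by apply: measurable_funTS; exact: (measurable_funM mg (mzeta i 0).2).
  move=> y _; rewrite normrM ger0_norm//; apply: le_trans (modk i y).
  by rewrite ler_wpM2l.
have [Ire HIre] := choice Hre; have [Iim HIim] := choice Him.
exists (\col_i scalar_of (Ire i) (Iim i)) => v.
rewrite /rip (_ : (fun y => _) = (fun y => \sum_i
    (scalar_re (v i 0) * (g y * scalar_re (zeta y i 0)) +
     scalar_im (v i 0) * (g y * scalar_im (zeta y i 0))))); last first.
  apply/funext => y; rewrite mulr_sumr; apply: eq_bigr => i _.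
  by rewrite /scalar_prod; ring.
rewrite (eq_bigr (fun i => scalar_re (v i 0) * Ire i + scalar_im (v i 0) * Iim i)).
  by apply: has_integral_sum => // i; apply: has_integralD => //;
     apply: has_integralZ.
move=> i _; rewrite /scalar_prod mxE scalar_ofE scalar_im_of// => KR.
have [_] := HIim i; rewrite (_ : (fun y => _) = (fun=> 0%E)).
  by rewrite integral0 => -[].
apply/funext => y; have -> : scalar_im (zeta y i 0) = 0 by rewrite /scalar_im; move: (zeta y i 0); rewrite KR.
by rewrite mulr0.
Qed.

(** The pairing of [z] with [zeta] is [w], so [gw] and the normalization give [rip z u = N]. Moving
    [WQ] to the other side bounds this by [vnorm (WQ *m u)], hence by the norm of [W u]. In the
    constant, one 2 comes from Young's inequality in [pairing_le] and the other from
    [inner_norm_ub]. *)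
Lemma unit_norm_reducing : N <= 4 * Num.sqrt d%:R * Kc * (s ^+ n) `^ (1 - mean).
Proof.
have [u Hu] := extremal_vector.
have zN : rip z u = N.
  have := Hu z => -[_ ]; rewrite (_ : (fun y => _) = (fun y => (N * wmod q w N y)%:E)).
    rewrite (ge0_integralZ_EFin mu mP (measurable_wmod _ mq mw) (wmod_ge0 q w N) (ltW N0)).
    by rewrite hN mule1 => -[].
  apply/funext => y; rewrite -gw; congr (_ * _)%:E.
  rewrite ripC ripZl sWi -vnorm_sqr -/(w y) expr2 mulKf// gt_eqF//.
(* With $t=|W(x)u|$, the square $t^2$ is the integral of [g] times the pairing of $W(x)u$ with
   $W(x)\zeta$, at most $t\cdot2l$; dividing by [t] gives the claim. *)
have Wu x l : 0 < l ->
    (modular (EFin \o q) (fun y =>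
      (opnorm (W x *m invmx (W y)) * \1_Q y)%:E * (l^-1)%:E) <= 1)%E ->
    vnorm (W x *m u) <= 2 * l.
  move=> l0 hl; set t := vnorm (W x *m u).
  have [t0|t0] := eqVneq t 0; first by rewrite t0 mulr_ge0// ltW.
  have tp : 0 < t by rewrite lt_neqAle eq_sym t0 vnorm_ge0.
  rewrite -(ler_pM2l tp) -expr2 /t vnorm_sqr -/t.
  rewrite -sW.
  have mgv : measurable_fun setT (fun y => g y * vnorm (W x *m zeta y)).
    exact: (measurable_funM mg (mWzeta x)).
  have gv0 y : P y -> 0 <= g y * vnorm (W x *m zeta y).
    by move=> _; rewrite mulr_ge0 ?vnorm_ge0.
  have pl := pairing_le l0 hl.
  have [I HI] : exists I, has_integral mu P (fun y => g y * vnorm (W x *m zeta y)) I.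
    apply: (has_integral_dominated mP (measurable_funTS mgv) (measurable_funTS mgv) gv0).
      by apply: le_lt_trans pl _; rewrite ltry.
    by move=> y Py; rewrite ger0_norm// gv0.
  have I2 : I <= 2 * l by rewrite -lee_fin -HI.2.
  apply: (@le_trans _ _ (t * I)); last by rewrite ler_pM2l.
  apply: (has_integral_le mP (Hu _) (has_integralZ mP t HI)) => y _.
  rewrite sW mulrCA ler_wpM2l//; exact: rip_le.
have Wu2 x : ((vnorm (W x *m u) / 2)%:E <= inner_norm Q x)%E.
  apply: le_ereal_inf_tmp => _ [l [l0 hl] <-].
  by rewrite lee_fin ler_pdivrMr// mulrC; exact: Wu.
have L0 : 0 < 2 * Kc * s ^+ n by rewrite !mulr_gt0.
have L40 : 0 < 4 * Kc * s ^+ n by rewrite !mulr_gt0.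
have F4 : (Lpnorm (EFin \o p) (fun x => (vnorm (W x *m u) * \1_Q x)%:E)
    <= (4 * Kc * s ^+ n)%:E)%E.
  apply: (Lpnorm_le L40); rewrite modularE.
  have h := integral_le_modular p0 L0 (@subset_refl _ Q) (inner_norm_ub a s0)
    (h := fun x => vnorm (W x *m u) / 2).
  apply: (@le_trans _ _ (\int[mu]_(x in Q)
      ((vnorm (W x *m u) / 2 / (2 * Kc * s ^+ n)) `^ p x)%:E)%E); last first.
    by apply: h => [x _|x _]; [rewrite divr_ge0 ?vnorm_ge0|exact: Wu2].
  rewrite [leRHS]integral_mkcond; apply: ge0_le_integralW => x _; first exact: poweR_ge0.
  rewrite patchE indicE; case: ifP => xQ; last first.
    by rewrite mulr0 mul0e abse0 poweR0r// gt_eqF.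
  rewrite mulr1 -EFinM abse_EFin poweR_EFin lee_fin ger0_norm; last first.
    by rewrite divr_ge0 ?vnorm_ge0// ltW.
  rewrite (_ : vnorm (W x *m u) / (4 * Kc * s ^+ n) =
     vnorm (W x *m u) / 2 / (2 * Kc * s ^+ n))//.
  by field; rewrite !gt_eqF.
have sd0 : 0 <= Num.sqrt d%:R :> R by exact: sqrtr_ge0.
have F5 : vnorm (WQ *m u) <= 4 * Num.sqrt d%:R * Kc * (s ^+ n) `^ (1 - mean).
  rewrite -lee_fin; apply: le_trans (hWQ u) _.
  apply: (@le_trans _ _ ((Num.sqrt d%:R)%:E *
    (((s ^+ n) `^ (- mean))%:E * (4 * Kc * s ^+ n)%:E))%E).
    apply: lee_wpmul2l; first by rewrite lee_fin.
    by apply: lee_wpmul2l F4; rewrite lee_fin powR_ge0.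
  rewrite -!EFinM lee_fin powRD; last by apply/implyP => _; rewrite gt_eqF.
  rewrite powRr1 ?(ltW sn0)//.
  by rewrite le_eqVlt; apply/orP; left; apply/eqP; ring.
apply: le_trans F5; rewrite -zN zE sWQ.
by apply: le_trans (rip_le _ _) _; rewrite e1 mul1r.
Qed.

End extremal_vector.

Lemma integral_wmod_reducing :
  (\int[mu]_(y in P) (wmod q w
    (4 * Num.sqrt d%:R * Kc * (s ^+ n) `^ (1 - mean)) y)%:E <= 1)%E.
Proof.
have [N N0 hN] := unit_norm_exists chi1 mq qb mw w0 s0 (integral_wmod_fin (coordinate a) s0).
have NN := unit_norm_reducing N0 hN.
rewrite -[leRHS]hN; apply: ge0_le_integralW => y _; rewrite lee_fin; first exact: wmod_ge0.
have M0 := lt_le_trans N0 NN.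
apply: ge0_powR_le; [exact: ltW|by rewrite divr_ge0 ?(ltW (w0 y))// ltW|].
by rewrite ler_wpM2l ?(ltW (w0 y))// lef_pV2.
Qed.

End scalar_weight.

(** * The auxiliary maximal operator *)

Section goldberg.
Context {R : realType} {K : scalars} {n d : nat}.
Local Notation T := (euclid R n).
Local Notation mu := (lebesgue R n).
Local Notation F := (scalar_field R K).
Local Notation conj := conjugate_exponent.

Lemma powRD_le (a b s : R) : 0 <= a -> 0 <= b -> 0 <= s ->
  (a + b) `^ s <= 2 `^ s * (a `^ s + b `^ s).
Proof.
move=> a0 b0 s0; wlog ab : a b a0 b0 / a <= b.
  move=> H; have [ab|ba] := leP a b; first exact: H.
  by rewrite addrC [_ + b `^ s]addrC; apply: H => //; exact: ltW.
apply: (@le_trans _ _ ((2 * b) `^ s)).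
  by apply: ge0_powR_le => //; rewrite ?addr_ge0//; lra.
by rewrite powRM// ler_wpM2l ?powR_ge0// lerDr powR_ge0.
Qed.

Lemma vnorm_delta (i : 'I_d) : vnorm (delta_mx i 0 : 'cV[F]_d) = 1.
Proof.
apply/eqP; rewrite -(@eqrXn2 _ 2)// ?vnorm_ge0// vnorm_sqr /rip (bigD1 i)//=.
rewrite big1 => [|j ji]; last by rewrite !mxE (negbTE ji) scalar_prod0.
by rewrite !mxE !eqxx /scalar_prod scalar_re1 scalar_im1 mulr0 !addr0 mulr1 expr1n.
Qed.

Section fixed_data.
Variables (lo hi D pinf Kc s Cp CE CM : R) (p : T -> R) (W : T -> 'M[F]_d)
  (WQ : set T -> 'M[F]_d) (f : T -> 'cV[F]_d) (l : R).
Hypotheses (lo1 : 1 < lo) (Hp : exponent_class lo hi D pinf p)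
  (mW : measurable_mx W) (Wpos : forall x, posdef (W x)) (Kc1 : 1 <= Kc)
  (AW : (Ap_const (EFin \o p) W <= Kc%:E)%E)
  (red : reducing_operators (EFin \o p) W WQ)
  (mf : measurable_mx f) (l0 : 0 < l)
  (fl : (modular (EFin \o p) (fun x => (vnorm (f x))%:E * (l^-1)%:E) <= 1)%E)
  (s1 : 1 < s) (slo : s < lo) (Cp0 : 0 < Cp) (d0 : (0 < d)%N).
Let q := conj \o p.
Let c := 4 * Num.sqrt d%:R * Kc.

Hypothesis pointwise : forall (w f : T -> R) (a x : T) (l Av : R),
  weight_class (4 * Kc) q w ->
  measurable_fun setT f -> (forall y, 0 <= f y) ->
  (\int[mu]_y (f y `^ p y)%:E <= 1)%E -> 0 < l ->
  (\int[mu]_(y in hcube (coordinate a) l) (wmod q w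
    (c * (l ^+ n) `^ (1 - recip_mean (EFin \o p) (cube a l))) y)%:E <= 1)%E ->
  cube a l x ->
  (\int[mu]_(y in hcube (coordinate a) l) (f y `^ (p y / s) + decay y)%:E =
    (Av * l ^+ n)%:E)%E ->
  (\int[mu]_(y in hcube (coordinate a) l) (w y * f y)%:E <=
    (l ^+ n * (Cp * (Av + decay x) `^ s) `^ (p x)^-1)%:E)%E.
Hypothesis intdecay : (\int[mu]_x (decay x)%:E <= CE%:E)%E.

Let mp : measurable_fun setT p. Proof. by case: Hp. Qed.
Let plo x : lo <= p x. Proof. by case: Hp => _ /(_ x)/andP[]. Qed.
Let p1 x : 1 < p x. Proof. exact: lt_le_trans (plo x). Qed.
Let p0 x : 0 < p x. Proof. exact: lt_trans (p1 x). Qed.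
Let s0 : 0 < s. Proof. exact: lt_trans s1. Qed.

Let h x := vnorm (f x) / l.
Let h0 x : 0 <= h x. Proof. by rewrite divr_ge0 ?vnorm_ge0// ltW. Qed.
Let mvf : measurable_fun setT (fun x => vnorm (f x)). Proof. exact: measurable_vnorm. Qed.
Let mh : measurable_fun setT h. Proof. exact: (measurable_funM mvf (measurable_cst _)). Qed.
Let hp : (\int[mu]_x (h x `^ p x)%:E <= 1)%E.
Proof.
apply: le_trans fl; rewrite modularE; apply: ge0_le_integralW => x _.
  by rewrite lee_fin powR_ge0.
by rewrite -EFinM abse_EFin poweR_EFin (ger0_norm (h0 x)).
Qed.

Let G x := h x `^ (p x / s) + decay x.
Let mhs : measurable_fun setT (fun x => h x `^ (p x / s)).
Proof. exact: (measurable_powR_fun mh (measurable_funM mp (measurable_cst _))). Qed.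
Let mG : measurable_fun setT G.
Proof. exact: (measurable_funD mhs measurable_decay). Qed.
Let decay0 (x : T) : 0 <= decay x. Proof. exact: ltW (decay_gt0 x). Qed.
Let G0 x : 0 <= G x. Proof. by rewrite addr_ge0 ?powR_ge0. Qed.
Let mhp : measurable_fun setT (fun x => h x `^ p x).
Proof. exact: (measurable_powR_fun mh mp). Qed.
Let hp0 x : 0 <= h x `^ p x. Proof. exact: powR_ge0. Qed.

Lemma measurable_majorant : measurable_fun setT (fun x => h x `^ (p x / s) + decay x).
Proof. exact: mG. Qed.

Lemma majorant_ge0 x : 0 <= h x `^ (p x / s) + decay x.
Proof. exact: G0. Qed.

Lemma majorant_locally_integrable (v : @node R n) : 0 < v.2 ->
  (\int[mu]_(x in node_set v) (G x)%:E < +oo)%E.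
Proof.
move=> v0; have mv := measurable_node v.
apply: (@le_lt_trans _ _ (\int[mu]_(x in node_set v) (2 + h x `^ p x)%:E)%E).
  apply: ge0_le_integralW => x _; rewrite lee_fin//.
  have : h x `^ (p x / s) <= 1 + h x `^ p x.
    apply: powR_le1D => //; rewrite divr_ge0 ?(ltW s0) ?(ltW (p0 x))//=.
    by rewrite ler_pdivrMr// ler_peMr ?(ltW s1)// ltW.
  by have := decay_le1 x; rewrite /G; lra.
have c2 (x : T) : 0 <= 2 :> R by [].
rewrite (ge0_integralD_EFin mu mv (measurable_cst _) c2 mhp hp0).
rewrite (integral_cst_hcube v.1 _ (ltW v0)).
have : (\int[mu]_(x in node_set v) (h x `^ p x)%:E <= 1)%E.
  apply: le_trans hp; apply: (ge0_subset_integral mu mv measurableT _ _ (@subsetT _ _)).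
    by apply/measurable_EFinP; exact: mhp.
  by move=> x _; rewrite lee_fin.
move=> h1; apply: le_lt_trans (leeD2l _ h1) _.
by rewrite -EFinD ltry.
Qed.

Lemma integral_majorant_le :
  (\int[mu]_x (G x `^ s)%:E <= (2 `^ s * (1 + CE))%:E)%E.
Proof.
have m1 : measurable_fun setT (fun x : T => h x `^ p x + decay x).
  exact: (measurable_funD mhp measurable_decay).
have p1' x : 0 <= h x `^ p x + decay x by rewrite addr_ge0.
apply: (@le_trans _ _ (\int[mu]_x (2 `^ s * (h x `^ p x + decay x))%:E)%E).
  apply: ge0_le_integralW => x _; rewrite lee_fin ?powR_ge0//.
  apply: le_trans (powRD_le (powR_ge0 _ _) (decay0 x) (ltW s0)) _.
  rewrite ler_wpM2l ?powR_ge0// lerD//.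
    by rewrite -powRrM divfK// gt_eqF.
  by apply: ge1r_powR; rewrite ?decay_gt0 ?decay_le1// ltW.
rewrite (ge0_integralZ_EFin mu measurableT m1 p1' (powR_ge0 _ _)) EFinM.
apply: lee_wpmul2l; first by rewrite lee_fin powR_ge0.
rewrite (ge0_integralD_EFin mu measurableT mhp hp0 measurable_decay decay0).
by rewrite EFinD; exact: leeD.
Qed.

Lemma cube_average_le (a x : T) (r Av : R) : 0 < r -> cube a r x ->
  (\int[mu]_(y in hcube (coordinate a) r) (G y)%:E = (Av * r ^+ n)%:E)%E ->
  (((vol (cube a r))^-1)%:E * (\int[mu]_(y in cube a r)
    (vnorm (WQ (cube a r) *m invmx (W y) *m f y))%:E) <=
  (l * (d%:R * (Cp * (Av + decay x) `^ s) `^ (p x)^-1))%:E)%E.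
Proof.
move=> r0 ax hAv; set Q := cube a r.
have Qc : cubes Q by exists a, r.
have [pQ rQ] := red Qc.
have uQ := posdef_unit pQ; have sQ := posdef_self_adjoint pQ.
have rn0 : 0 < r ^+ n by rewrite exprn_gt0.
have volE : vol Q = r ^+ n by rewrite /vol lebesgue_cube// ltW.
pose e i : 'cV[F]_d := delta_mx i 0.
pose z i := WQ Q *m e i.
have z0 i : z i != 0.
  apply/eqP => zi0; have : e i = 0 by rewrite -(mulKmx uQ (e i)) -/(z i) zi0 mulmx0.
  by move/(congr1 vnorm); rewrite vnorm_delta vnorm0; apply/eqP; rewrite oner_eq0.
pose w i := adjoint_weight W (z i).
have w0 i y : 0 <= w i y by exact: vnorm_ge0.
have mw i : measurable_fun setT (w i) by exact: measurable_adjoint_weight.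
have uW y : W y \in unitmx by exact: posdef_unit.
have sWi y : self_adjoint (invmx (W y)).
  by apply: self_adjoint_inv => //; exact: posdef_self_adjoint.
set M := (Cp * (Av + decay x) `^ s) `^ (p x)^-1.
have wi i : (\int[mu]_(y in hcube (coordinate a) r) (w i y * h y)%:E <= (r ^+ n * M)%:E)%E.
  apply: (pointwise _ mh h0 hp r0 _ ax hAv).
  - exact: (weight_class_adjoint lo1 Hp mW Wpos Kc1 AW (z0 i)).
  - apply: (integral_wmod_reducing lo1 Hp mW Wpos Kc1 AW (z0 i) r0 (erefl _)
      (vnorm_delta i) sQ) => u.
    by have /andP[_] := rQ u; rewrite volE.
have mwh i : measurable_fun setT (fun y => w i y * h y) by exact: measurable_funM.
have wh0 i y : 0 <= w i y * h y by rewrite mulr_ge0.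
rewrite volE lee_pdivrMl//.
apply: (@le_trans _ _ (\int[mu]_(y in Q) (l * \sum_i w i y * h y)%:E)%E).
  apply: ge0_le_integralW => y _; rewrite lee_fin ?vnorm_ge0//.
  apply: le_trans (self_adjoint_mul_le_sum _ sQ (sWi y)) _.
  rewrite mulr_sumr; apply: ler_sum => i _.
  rewrite le_eqVlt; apply/orP; left; apply/eqP; rewrite /h /w /adjoint_weight -/(e i) -/(z i).
  by field; rewrite gt_eqF.
have mS : measurable_fun setT (fun y => \sum_i w i y * h y) by exact: measurable_sum.
have S0 y : 0 <= \sum_i w i y * h y by exact: sumr_ge0.
have mlS : measurable_fun setT (fun y => (l * \sum_i w i y * h y)%:E).
  by apply/measurable_EFinP; exact: (measurable_funM (measurable_cst _) mS).
rewrite (ge0_integral_cube a (ltW r0) mlS); last first.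
  by move=> y; rewrite lee_fin mulr_ge0// ltW.
rewrite (ge0_integralZ_EFin mu (measurable_hcube _ _) mS S0 (ltW l0)).
rewrite [leRHS]muleC -EFinM [_ * r ^+ n]mulrC mulrCA EFinM.
apply: lee_wpmul2l; first by rewrite lee_fin ltW.
under eq_integral do rewrite -sumEFin.
have mwhE i : measurable_fun (hcube (coordinate a) r) (fun y => (w i y * h y)%:E).
  by apply: measurable_funTS; apply/measurable_EFinP; exact: mwh.
have whE i y : hcube (coordinate a) r y -> (0 <= (w i y * h y)%:E)%E.
  by move=> _; rewrite lee_fin.
rewrite (ge0_integral_sum mu (measurable_hcube _ _) mwhE whE).
apply: (@le_trans _ _ (\sum_(i < d) (r ^+ n * M)%:E)%E).
  by apply: lee_sum => i _; exact: wi.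
rewrite sumEFin sumr_const card_ord lee_fin.
by rewrite -mulr_natl le_eqVlt; apply/orP; left; apply/eqP; ring.
Qed.

(* MG stands for a majorant of the s-th power of the maximal function. *)
Variable MG : T -> \bar R.
Hypotheses (mMG : measurable_fun setT MG) (MG0 : forall x, (0 <= MG x)%E)
  (CM0 : 0 < CM) (CE0 : 0 < CE)
  (intMG : (\int[mu]_x MG x <= CM%:E * \int[mu]_x (G x `^ s)%:E)%E)
  (geMG : forall a r x Av, 0 < r -> cube a r x ->
    (\int[mu]_(y in hcube (coordinate a) r) (G y)%:E = (Av * r ^+ n)%:E)%E ->
    (((Av / 4 ^+ n) `^ s)%:E <= MG x)%E).

Let C1 : R := Cp * 2 `^ s * (4 ^+ n) `^ s.
Let C2 : R := C1 * (CM * (2 `^ s * (1 + CE)) + CE).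

(** The integral of [H] is at most [C2]. Dividing by [1 + C2] before raising to the power [p x >= 1]
    gains at least the factor [(1 + C2)^-1], which brings the modular down to at most 1. *)
Lemma Lpnorm_goldberg_le :
  (Lpnorm (EFin \o p) (goldberg_aux WQ W f) <= (d%:R * (1 + C2) * l)%:E)%E.
Proof.
have CE0' := CE0; have dR : 1 <= d%:R :> R by rewrite ler1n.
have dR0 : 0 < d%:R :> R by rewrite ltr0n.
have s20 : 0 < 2 `^ s :> R by exact: powR_gt0.
have four1 : 1 <= (4 ^+ n) `^ s :> R.
  rewrite -[leLHS](powRr0 (4 ^+ n)) ler_powR// ?(ltW s0)// exprn_ege1//; lra.
have C10 : 0 < C1 by rewrite /C1 !mulr_gt0//; exact: lt_le_trans four1.
have C20 : 0 <= C2.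
  by rewrite /C2 mulr_ge0 ?(ltW C10)// addr_ge0 ?(ltW CE0)// !mulr_ge0 ?(ltW CM0) ?(ltW s20)//; lra.
pose H x := (C1%:E * (MG x + (decay x)%:E))%E.
have H0 x : (0 <= H x)%E by rewrite mule_ge0 ?lee_fin ?(ltW C10)// adde_ge0 ?lee_fin.
have gH x : (goldberg_aux WQ W f x <= (l * d%:R)%:E * H x `^ (p x)^-1)%E.
  have RHS0 : (0 <= (l * d%:R)%:E * H x `^ (p x)^-1)%E.
    by rewrite mule_ge0 ?poweR_ge0// lee_fin mulr_ge0// ltW.
  apply: ge_ereal_sup => _ [Q [a [r [r0 QE]]] <-].
  rewrite indicE; case: (boolP (x \in Q)) => [/set_mem xQ|_]; last by rewrite mule0.
  rewrite mule1; rewrite QE in xQ *.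
  have rn0 : 0 < r ^+ n by rewrite exprn_gt0.
  have [Av hAv] : exists Av, (\int[mu]_(y in hcube (coordinate a) r) (G y)%:E =
      (Av * r ^+ n)%:E)%E.
    have := @majorant_locally_integrable (coordinate a, r) r0.
    have : (0 <= \int[mu]_(y in hcube (coordinate a) r) (G y)%:E)%E.
      by apply: integral_ge0 => y _; rewrite lee_fin.
    rewrite /node_set /=.
    case: (\int[mu]_(y in hcube (coordinate a) r) (G y)%:E)%E => [t _ _|//|//].
    by exists (t / r ^+ n); rewrite divfK// gt_eqF.
  have Av0 : 0 <= Av.
    have : (0 <= (Av * r ^+ n)%:E)%E.
      by rewrite -hAv; apply: integral_ge0 => y _; rewrite lee_fin.
    by rewrite lee_fin pmulr_lge0.
  apply: le_trans (cube_average_le r0 xQ hAv) _.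
  rewrite mulrA [leLHS]EFinM; apply: lee_wpmul2l.
    by rewrite lee_fin mulr_ge0// ltW.
  rewrite -poweR_EFin; apply: ge0_le_poweR.
  - by rewrite invr_ge0 ltW.
  - by rewrite lee_fin mulr_ge0 ?powR_ge0// ltW.
  apply: (@le_trans _ _ (C1%:E * (((Av / 4 ^+ n) `^ s)%:E + (decay x)%:E))%E); last first.
    apply: lee_wpmul2l; first by rewrite lee_fin ltW.
    by rewrite leeD2r// (geMG r0 xQ hAv).
  rewrite -EFinD -EFinM lee_fin /C1 -!mulrA ler_pM2l//.
  apply: le_trans (powRD_le Av0 (decay0 x) (ltW s0)) _; rewrite ler_pM2l//.
  rewrite mulrDr; apply: lerD.
    rewrite -powRM ?divr_ge0 ?exprn_ge0// mulrC divfK// gt_eqF// exprn_gt0//.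
  apply: (@le_trans _ _ (decay x)).
    by apply: ge1r_powR; rewrite ?decay_gt0 ?decay_le1// ltW.
  by rewrite ler_peMl.
have B0 : 0 < d%:R * (1 + C2) * l by rewrite !mulr_gt0//; lra.
apply: Lpnorm_le => //; rewrite modularE.
have k01 : 0 < (1 + C2)^-1 <= 1.
  have C21 : 0 < 1 + C2 by lra.
  by rewrite invr_gt0 C21 invf_le1// lerDl.
apply: (@le_trans _ _ (\int[mu]_x (((1 + C2)^-1)%:E * H x))%E).
  apply: ge0_le_integralW => x _; first exact: poweR_ge0.
  have gx0 : (0 <= goldberg_aux WQ W f x)%E.
    apply: le_ereal_sup_tmp.
    have cQ : cubes (cube x (1 : R)) by exists x, 1.
    eexists; first by exists (cube x 1) => //.
    rewrite mule_ge0 ?lee_fin ?indicE//; rewrite mule_ge0 ?lee_fin ?invr_ge0 ?fine_ge0//.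
    by apply: integral_ge0 => y _; rewrite lee_fin vnorm_ge0.
  rewrite gee0_abs; last by rewrite mule_ge0// lee_fin invr_ge0 ltW.
  have /andP[k0 k1] := k01.
  apply: (@le_trans _ _ ((((1 + C2)^-1)%:E * H x `^ (p x)^-1) `^ p x)%E).
    apply: ge0_le_poweR; first exact: ltW.
      by rewrite mule_ge0// lee_fin invr_ge0 ltW.
    apply: le_trans (lee_wpmul2r _ (gH x)) _; first by rewrite lee_fin invr_ge0 ltW.
    rewrite muleAC -EFinM; apply: lee_wpmul2r; first exact: poweR_ge0.
    rewrite lee_fin le_eqVlt; apply/orP; left; apply/eqP.
    by field; rewrite !gt_eqF//; lra.
  rewrite poweRM ?poweR_ge0 ?lee_fin ?(ltW k0)// -poweRrM mulVf ?gt_eqF// poweRe1//.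
  apply: lee_wpmul2r => //; rewrite poweR_EFin lee_fin.
  by apply: ge1r_powR => //; exact: ltW.
have mD : measurable_fun setT (fun x : T => (decay x)%:E).
  by apply/measurable_EFinP; exact: measurable_decay.
have mS : measurable_fun setT (fun x => MG x + (decay x)%:E)%E.
  exact: emeasurable_funD.
have S0 x : (0 <= MG x + (decay x)%:E)%E by rewrite adde_ge0// lee_fin.
under eq_integral do rewrite /H muleA -EFinM.
have kC : 0 <= (1 + C2)^-1 * C1.
  by have /andP[k0 _] := k01; rewrite mulr_ge0// ltW.
have D0 (x : T) : (0 <= (decay x)%:E)%E by rewrite lee_fin.
rewrite (ge0_integralZl_EFin mu measurableT (fun x _ => S0 x) mS kC).
rewrite (ge0_integralD mu measurableT (fun x _ => MG0 x) mMG (fun x _ => D0 x) mD).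
apply: (@le_trans _ _ (((1 + C2)^-1 * C1)%:E * ((CM * (2 `^ s * (1 + CE)))%:E + CE%:E))%E).
  apply: lee_wpmul2l; first by rewrite lee_fin.
  apply: leeD => //; apply: le_trans intMG _; rewrite EFinM.
  by apply: lee_wpmul2l; [rewrite lee_fin ltW|exact: integral_majorant_le].
rewrite -EFinD -EFinM lee_fin -mulrA -/C2 mulrC ler_pdivrMr; lra.
Qed.

End fixed_data.
End goldberg.

Lemma goldberg_bound (R : realType) (K : scalars) (n d : nat) (lo hi D pinf Kc : R) :
  (0 < n)%N -> (0 < d)%N -> 1 < lo -> lo <= hi -> 0 <= D -> 1 <= Kc ->
  exists2 C : R, 0 < C &
    forall (p : euclid R n -> R) (W : euclid R n -> 'M[scalar_field R K]_d)
      (WQ : set (euclid R n) -> 'M[scalar_field R K]_d)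
      (f : euclid R n -> 'cV[scalar_field R K]_d),
      exponent_class lo hi D pinf p -> measurable_mx W ->
      (forall x, posdef (W x)) -> (Ap_const (EFin \o p) W <= Kc%:E)%E ->
      reducing_operators (EFin \o p) W WQ -> measurable_mx f ->
      (Lpnorm (EFin \o p) (goldberg_aux WQ W f) <= C%:E * vLpnorm (EFin \o p) f)%E.
Proof.
move=> n0 d0 lo1 lohi D0 Kc1.
have dR : 1 <= d%:R :> R by rewrite ler1n.
have sd1 : 1 <= Num.sqrt d%:R :> R by rewrite -[leLHS]sqrtr1 ler_wsqrtr.
have k4 : 1 <= 4 * Kc by lra.
have c1 : 1 <= 4 * Num.sqrt d%:R * Kc by nra.
have [s [Cp [/andP[s1 slo] Cp0] HP]] :=
  @pointwise_bound R n lo hi D pinf _ _ n0 lo1 lohi D0 k4 c1.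
have [CE CE0 HCE] := @integral_decay_fin R n.
have [CM CM0 HM] := @maximal_bound R n s s1.
pose C2 := Cp * 2 `^ s * (4 ^+ n) `^ s * (CM * (2 `^ s * (1 + CE)) + CE).
have C20 : 0 <= C2.
  rewrite /C2 mulr_ge0 ?mulr_ge0 ?powR_ge0 ?(ltW Cp0)//.
  by rewrite addr_ge0 ?(ltW CE0)// !mulr_ge0 ?powR_ge0 ?(ltW CM0)//; lra.
have C0 : 0 < d%:R * (1 + C2) by rewrite mulr_gt0 ?ltr0n// ltr_wpDr.
exists (d%:R * (1 + C2)) => // p W WQ f Hp mW Wpos AW red mf.
(* After division by the constant, the left-hand side is a lower bound of all [l] admissible for
   [f], so the infimum need not be attained. *)
rewrite -lee_pdivrMl//; apply: le_ereal_inf_tmp => _ [l [l0 hl] <-].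
rewrite lee_pdivrMl// -EFinM.
have HPp w g a x r Av hw mg g0 gp r0 hB ax hAv :=
  HP p w g a x r Av Hp hw mg g0 gp r0 hB ax hAv.
have mG := measurable_majorant s l Hp mf.
have [MG [mMG MG0 intMG geMG]] := HM _ (mG) (majorant_ge0 s p f l)
  (majorant_locally_integrable lo1 Hp mf l0 hl s1).
exact: (Lpnorm_goldberg_le lo1 Hp mW Wpos Kc1 AW red mf l0 hl s1 Cp0 d0 HPp HCE
  mMG MG0 CM0 CE0 intMG geMG).
Qed.

Theorem theoremB (R : realType) (K : scalars) (n d : nat)
    (pminus pplus pinf C0 Cinf : R) :
  (0 < n)%N -> (0 < d)%N -> 1 < pminus -> pminus <= pplus ->
  exists phi : R -> R,
    (forall t, 1 <= t -> 0 < phi t) /\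
    (forall s t, 1 <= s -> s < t -> phi s < phi t) /\
    forall (p : euclid R n -> R) (W : euclid R n -> 'M[scalar_field R K]_d)
      (WQ : set (euclid R n) -> 'M[scalar_field R K]_d),
      is_exponent (EFin \o p) ->
      log_hoelder C0 Cinf pinf p ->
      ess_inf (lebesgue R n) (EFin \o p) = pminus%:E ->
      ess_sup (lebesgue R n) (EFin \o p) = pplus%:E ->
      matrix_weight W ->
      in_Ap (EFin \o p) W ->
      reducing_operators (EFin \o p) W WQ ->
      forall f : euclid R n -> 'cV[scalar_field R K]_d,
        in_vLp (EFin \o p) f ->
        (Lpnorm (EFin \o p) (goldberg_aux WQ W f)
         <= (phi (fine (Ap_const (EFin \o p) W)))%:E
            * vLpnorm (EFin \o p) f)%E.
Proof.
move=> n0 d0 lo1 lohi.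
have [D HD] := log_hoelder_class n0 C0 Cinf pinf pminus pplus.
(* [HD] records no sign of [D], while [goldberg_bound] asks for a nonnegative constant. *)
have Dabs p : exponent_class pminus pplus D pinf p ->
    exponent_class pminus pplus `|D| pinf (p : euclid R n -> R).
  move=> [mp pb pinfb loc inf]; split=> // [b s x y s0 bx by_|x].
    exact: le_trans (loc b s x y s0 bx by_) (ler_norm D).
  exact: le_trans (inf x) (ler_norm D).
(* The way the constant grows with the bound on $[W]$ is not tracked; one constant is chosen for
   each integer bound [k.+1], and [phi] adds them up. *)
have bound k : exists C : R, 0 < C /\
    forall (p : euclid R n -> R) (W : euclid R n -> 'M[scalar_field R K]_d)
      (WQ : set (euclid R n) -> 'M[scalar_field R K]_d)
      (f : euclid R n -> 'cV[scalar_field R K]_d),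
      exponent_class pminus pplus `|D| pinf p -> measurable_mx W ->
      (forall x, posdef (W x)) -> (Ap_const (EFin \o p) W <= k.+1%:R%:E)%E ->
      reducing_operators (EFin \o p) W WQ -> measurable_mx f ->
      (Lpnorm (EFin \o p) (goldberg_aux WQ W f) <= C%:E * vLpnorm (EFin \o p) f)%E.
  have k1 : 1 <= k.+1%:R :> R by rewrite ler1n.
  have [C C00 HC] := goldberg_bound K pinf n0 d0 lo1 lohi (normr_ge0 D) k1.
  by exists C.
have [C HC] := choice bound.
(* [t + 1] makes [phi] positive and strictly increasing, the sum being nondecreasing in [t]. Its
   last term has index [truncn t], whose bound [(truncn t).+1] is at least [t]. *)
pose phi (t : R) := t + 1 + \sum_(i < (Num.truncn t).+1) C i.
have sum0 m : 0 <= \sum_(i < m) C i by apply: sumr_ge0 => i _; exact: ltW (HC i).1.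
exists phi; split; [|split].
- by move=> t t1; rewrite /phi ltr_wpDr//; lra.
- move=> s t s1 st; rewrite /phi ltr_leD ?ltrD2r//.
  have le_m : ((Num.truncn s).+1 <= (Num.truncn t).+1)%N.
    by rewrite ltnS; apply: le_truncn; exact: ltW.
  rewrite -(big_mkord xpredT C) -(big_mkord xpredT C) (big_cat_nat _ le_m)//= lerDl.
  by apply: sumr_ge0 => i _; exact: ltW (HC i).1.
move=> p W WQ pexp plog pinf_ psup [mW Wpos _] Wfin red f [mf ffin].
have Hp := Dabs _ (HD p pexp plog pinf_ psup).
have A0 : (0 <= Ap_const (EFin \o p) W)%E.
  pose o := point (fun=> 0) : euclid R n.
  have cQ : cubes (cube o (1 : R)) by exists o, 1.
  apply: le_ereal_sup_tmp; eexists; first by exists (cube o 1) => //.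
  rewrite mule_ge0 ?lee_fin ?invr_ge0 ?fine_ge0//.
  apply: Lpnorm_ge0 => //.
have Afin : Ap_const (EFin \o p) W \is a fin_num by rewrite ge0_fin_numE.
set t := fine (Ap_const (EFin \o p) W).
have AE : Ap_const (EFin \o p) W = t%:E by rewrite /t fineK.
have t0 : 0 <= t by rewrite -lee_fin -AE.
set k := Num.truncn t.
have tk : t <= k.+1%:R by have /andP[_ /ltW] := truncn_itv t0.
have bk := (HC k).2 p W WQ f Hp mW Wpos; rewrite AE lee_fin in bk.
apply: le_trans (bk tk red mf) _.
apply: lee_wpmul2r; first exact: Lpnorm_ge0.
rewrite lee_fin /phi big_ord_recr /=.
by have := sum0 k; rewrite -/k; lra.
Qed.
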